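(* Let $T$ be a Calderón–Zygmund operator on $\mathbb{R}^n$ satisfying $T(1)=0\in BMO$. Then there is a constant $C$ such that for every $f\in L^2(\mathbb{R}^n)$ there exists a sparse collection $\mathcal{S}$ such that, for almost every $x\in\mathbb{R}^n$, $$|T(f)(x)|\le C\sum_{Q\in\mathcal{S}}\operatorname{osc}_Q(f)\,\mathbf{1}_Q(x).$$
   Context: A linear operator $T$ bounded on $L^2(\mathbb{R}^n)$ is Calderón–Zygmund if it is associated with a kernel $K:\mathbb{R}^n\times\mathbb{R}^n\to\mathbb{R}$ such that for some $\epsilon>0$ and all $x\ne y$, $|K(x,y)|\lesssim|x-y|^{-n}$, and for all $z$ with $2|z|<|x-y|$, $|K(x+z,y)-K(x,y)|+|K(x,y+z)-K(x,y)|\lesssim|z|^\epsilon|x-y|^{-n-\epsilon}$. Such $T$ extends continuously from $L^\infty$ to $BMO$, so $T(1)\in BMO$ is defined; since $BMO$ is taken modulo constants, $T(1)=0$ means that $T(1)$ is a constant function. Oscillation: $\operatorname{osc}_Q(f)=\frac1{|Q|}\int_Q\big|f-\frac1{|Q|}\int_Qf\,\big|\,dx$. For $\alpha\in\{0,\frac13\}^n$ let $\mathbb{D}^\alpha=\{2^{-k}([0,1]^n+m+(-1)^k\alpha): k\in\mathbb{Z},\ m\in\mathbb{Z}^n\}$ and $\mathbb{D}=\bigcup_\alpha\mathbb{D}^\alpha$. A collection $\mathcal{S}\subset\mathbb{D}$ is $\eta$-sparse, $\eta\in(0,1)$, if there are pairwise disjoint measurable sets $(E_Q)_{Q\in\mathcal{S}}$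 with $E_Q\subset Q$ and $|E_Q|\ge\eta|Q|$ for all $Q\in\mathcal{S}$. ''Sparse'' means $\eta$-sparse for an implicit fixed parameter $\eta\in(0,1)$ that does not depend on $f$. *)

(* Defs.v *)
From HB Require Import structures.
From mathcomp Require Import all_boot all_order all_algebra.
From mathcomp Require Import all_classical all_reals all_analysis.
Set Implicit Arguments.
Unset Strict Implicit.
Unset Printing Implicit Defensive.
Import Order.TTheory GRing.Theory Num.Theory.
Import numFieldTopology.Exports numFieldNormedType.Exports.
Local Open Scope classical_set_scope.
Local Open Scope ring_scope.

(* R^n is 'rV[R]_n with the sigma-algebra generated by the coordinates, that
   is, the Borel sigma-algebra. The norm `|x| of the library is the sup norm;
   the Euclidean norm is [enorm] below. *)
Definition rV_display : measure_display. Proof. exact: default_measure_display. Qed.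

Definition rV_coord (R : realType) (n : nat) (i : 'I_n) (x : 'rV[R]_n) : R :=
  x ord0 i.

HB.instance Definition _ (R : realType) (n : nat) :=
  @isMeasurable.Build rV_display 'rV[R]_n
    (g_sigma_preimage (@rV_coord R n))
    (@sigma_algebra0 _ _ _)
    (@sigma_algebraC _ _)
    (@sigma_algebra_bigcup _ _ _).

Lemma measurable_rV_coord (R : realType) (n : nat) (i : 'I_n) :
  measurable_fun [set: 'rV[R]_n] (@rV_coord R n i).
Proof.
move=> _ Y mY; rewrite setTI; apply: sub_sigma_algebra => /=.
rewrite -bigcup_seq/=; exists i => /=; first by rewrite mem_index_enum.
by exists Y => //; rewrite setTI.
Qed.

Lemma measurable_fun_rV (d : measure_display) (T : measurableType d)
    (R : realType) (n : nat) (f : T -> 'rV[R]_n) :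
  (forall i, measurable_fun setT (@rV_coord R n i \o f)) ->
  measurable_fun setT f.
Proof.
move=> mf.
suff H : g_sigma_preimage (fun i => @rV_coord R n i \o f) `<=` measurable.
  by move=> _ A mA; apply: H; rewrite g_sigma_preimage_comp; exists A.
apply: smallest_sub; first exact: sigma_algebra_measurable.
case: n => [|n] in f mf *; first by rewrite big_ord0.
rewrite -bigcup_mkord_ord; apply: bigcup_sub => i Ii.
by move=> A [B mB <-]; exact: mf.
Qed.

Definition rV_cons (R : realType) (n : nat) (p : measurableTypeR R * 'rV[R]_n) :
  'rV[R]_n.+1 := row_mx (p.1 : R)%:M p.2.

Definition rV_uncons (R : realType) (n : nat) (x : 'rV[R]_n.+1) :
  measurableTypeR R * 'rV[R]_n := (x ord0 ord0, \row_i x ord0 (lift ord0 i)).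

Lemma rV_consE0 (R : realType) (n : nat) (p : measurableTypeR R * 'rV[R]_n) :
  rV_cons p ord0 ord0 = p.1.
Proof.
transitivity (row_mx (p.1 : R)%:M p.2 ord0 (lshift n (ord0 : 'I_1))).
  by apply: (congr1 (fun_of_matrix (rV_cons p) ord0)); exact: val_inj.
by rewrite row_mxEl mxE mulr1n.
Qed.

Lemma rV_consES (R : realType) (n : nat) (p : measurableTypeR R * 'rV[R]_n)
    (i : 'I_n) : rV_cons p ord0 (lift ord0 i) = p.2 ord0 i.
Proof.
transitivity (row_mx (p.1 : R)%:M p.2 ord0 (rshift 1 i)).
  by apply: (congr1 (fun_of_matrix (rV_cons p) ord0)); exact: val_inj.
exact: row_mxEr.
Qed.

Lemma rV_consK (R : realType) (n : nat) : cancel (@rV_cons R n) (@rV_uncons R n).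
Proof.
move=> [a x]; rewrite /rV_uncons rV_consE0; congr (_, _).
by apply/rowP => i; rewrite mxE rV_consES.
Qed.

Lemma measurable_rV_cons (R : realType) (n : nat) :
  measurable_fun setT (@rV_cons R n).
Proof.
apply: measurable_fun_rV => i.
have [->|[j ->]] : i = ord0 \/ exists j, i = lift ord0 j.
  by case: (unliftP ord0 i) => [j ->|->]; [right; exists j|left].
  rewrite (_ : _ \o _ = fst); first exact: measurable_fst.
  by apply/funext => p; exact: rV_consE0.
rewrite (_ : _ \o _ = @rV_coord R n j \o snd); last first.
  by apply/funext => p; exact: rV_consES.
apply: measurableT_comp; last exact: measurable_snd.
exact: measurable_rV_coord.
Qed.

HB.instance Definition _ (R : realType) (n : nat) :=
  isMeasurableFun.Build _ _ _ _ (@rV_cons R n) (@measurable_rV_cons R n).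

Lemma measurable_rV_uncons (R : realType) (n : nat) :
  measurable_fun setT (@rV_uncons R n).
Proof.
apply: measurable_fun_pair => /=; first exact: (measurable_rV_coord ord0).
apply: measurable_fun_rV => i.
rewrite (_ : _ \o _ = @rV_coord R n.+1 (lift ord0 i)); last first.
  by apply/funext => x; rewrite /rV_coord/= mxE.
exact: measurable_rV_coord.
Qed.

Section lebesgue_rV_succ.
Context (R : realType) (n : nat).
Context (m : {sigma_finite_measure set 'rV[R]_n -> \bar R}).
Local Open Scope ereal_scope.

Definition lebesgue_rV_succ : set 'rV[R]_n.+1 -> \bar R :=
  pushforward (@lebesgue_measure R \x m) (@rV_cons R n).

Let m0 : lebesgue_rV_succ set0 = 0.
Proof. by rewrite /lebesgue_rV_succ /pushforward preimage_set0 measure0. Qed.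

Let m_ge0 A : 0 <= lebesgue_rV_succ A.
Proof. exact: measure_ge0. Qed.

Let m_sigma_additive : semi_sigma_additive lebesgue_rV_succ.
Proof.
exact: measure_semi_sigma_additive.
Qed.

HB.instance Definition _ :=
  isMeasure.Build _ _ _ lebesgue_rV_succ m0 m_ge0 m_sigma_additive.

Let m_sigma_finite : sigma_finite setT lebesgue_rV_succ.
Proof.
have /sigma_finiteP[F [TF ndF Foo]] := sigma_finiteT (@lebesgue_measure R).
have /sigma_finiteP[G [TG ndG Goo]] := sigma_finiteT m.
exists (fun k => @rV_uncons R n @^-1` (F k `*` G k)).
  rewrite -preimage_bigcup (_ : \bigcup_i _ = setT) ?preimage_setT//.
  rewrite -setXTT TF TG predeqE => -[x y]; split.
    by move=> [k _ [/= ? ?]]; split; exists k.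
  move=> [/= [k _ Fkx] [l _ Gly]]; exists (maxn k l) => //; split.
    by move: x Fkx; exact/subsetPset/ndF/leq_maxl.
  by move: y Gly; exact/subsetPset/ndG/leq_maxr.
move=> k; have [mF Fk] := Foo k; have [mG Gk] := Goo k; split.
  rewrite -[X in measurable X]setTI; apply: measurable_rV_uncons => //.
  exact: measurableX.
rewrite /lebesgue_rV_succ /pushforward -comp_preimage.
rewrite (_ : _ \o _ = id) ?preimage_id; last first.
  by apply/funext => p; exact: rV_consK.
by rewrite product_measure1E// lte_mul_pinfty// ge0_fin_numE.
Qed.

HB.instance Definition _ :=
  Measure_isSigmaFinite.Build _ _ _ lebesgue_rV_succ m_sigma_finite.

End lebesgue_rV_succ.

(* n-dimensional Lebesgue measure: the n-fold product of the Lebesgue measure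
   on R, the first coordinate being split off at each step. *)
Fixpoint lebesgue_rV (R : realType) (n : nat) :
    {sigma_finite_measure set 'rV[R]_n -> \bar R} :=
  if n is n'.+1 then lebesgue_rV_succ (lebesgue_rV R n') else \d_(0 : 'rV[R]_0).

Lemma lebesgue_rV_box (R : realType) (n : nat) (a b : 'rV[R]_n) :
  (forall i, a ord0 i <= b ord0 i) ->
  lebesgue_rV R n [set x : 'rV[R]_n | forall i, a ord0 i <= x ord0 i <= b ord0 i] =
  (\prod_(i < n) (b ord0 i - a ord0 i))%:E.
Proof.
elim: n a b => [|n IHn] a b ab.
  rewrite big_ord0 /= diracE mem_set//= => i; by case: i.
pose tl (x : 'rV[R]_n.+1) : 'rV[R]_n := \row_i x ord0 (lift ord0 i).
rewrite big_ord_recl EFinM /= /lebesgue_rV_succ /pushforward.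
have -> : @rV_cons R n @^-1`
    [set x : 'rV[R]_n.+1 | forall i, a ord0 i <= x ord0 i <= b ord0 i] =
    `[a ord0 ord0, b ord0 ord0]%classic `*`
    [set x : 'rV[R]_n | forall i, tl a ord0 i <= x ord0 i <= tl b ord0 i].
  apply/seteqP; split=> [[r x] /= H|[r x] /= [H0 H] i].
    split=> [|i]; first by rewrite in_itv/=; have := H ord0; rewrite rV_consE0.
    by have := H (lift ord0 i); rewrite rV_consES !mxE.
  have [j ->|->] := unliftP ord0 i.
    by have := H j; rewrite rV_consES !mxE.
  by move: H0; rewrite in_itv/= rV_consE0.
rewrite product_measure1E//.
  rewrite IHn; last by move=> i; rewrite !mxE.
  congr (_ * _)%E; last by congr EFin; apply: eq_bigr => i _; rewrite !mxE.
  apply: eq_trans (lebesgue_measure_itv _) _; rewrite /= lte_fin.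
  by case: ltgtP (ab ord0) => // -> _; rewrite subrr.
rewrite (_ : [set x : 'rV[R]_n | _] =
  \bigcap_(i in [set: 'I_n]) (@rV_coord R n i @^-1` `[tl a ord0 i, tl b ord0 i])).
  apply: fin_bigcap_measurable => //= i _.
  by rewrite -[X in measurable X]setTI; exact: measurable_rV_coord.
apply/seteqP; split=> [x /= H i _ | x H i]/=; first by rewrite in_itv/=; exact: H.
by have := H i I; rewrite /= in_itv.
Qed.

Definition enorm (R : realType) (n : nat) (x : 'rV[R]_n) : R :=
  Num.sqrt (\sum_(i < n) x ord0 i ^+ 2).

Definition eball (R : realType) (n : nat) (c : 'rV[R]_n) (r : R) :
  set 'rV[R]_n := [set x | enorm (x - c) < r].

Definition L2_bounded_linear (R : realType) (n : nat)
    (T : ('rV[R]_n -> R) -> 'rV[R]_n -> R) : Prop :=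
  let mu := lebesgue_rV R n in
  [/\ forall f, f \in Lfun mu 2%:E -> T f \in Lfun mu 2%:E,
      forall (a : R) f g, f \in Lfun mu 2%:E -> g \in Lfun mu 2%:E ->
        {ae mu, forall x, T (fun y => a * f y + g y) x = a * T f x + T g x} &
      exists M : R, forall f, f \in Lfun mu 2%:E ->
        ('N[mu]_2%:E[EFin \o T f] <= M%:E * 'N[mu]_2%:E[EFin \o f])%E].

Definition CZ_kernel (R : realType) (n : nat)
    (K : 'rV[R]_n -> 'rV[R]_n -> R) : Prop :=
  exists eps C : R, 0 < eps /\ forall x y, x != y ->
    `|K x y| <= C * enorm (x - y) ^- n /\
    forall z, 2 * enorm z < enorm (x - y) ->
      `|K (x + z) y - K x y| + `|K x (y + z) - K x y|
      <= C * enorm z `^ eps * enorm (x - y) `^ (- n%:R - eps).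

(* T is given by K off the support of f; the integral converges there since
   f is square integrable with compact support. *)
Definition associated_kernel (R : realType) (n : nat)
    (T : ('rV[R]_n -> R) -> 'rV[R]_n -> R)
    (K : 'rV[R]_n -> 'rV[R]_n -> R) : Prop :=
  let mu := lebesgue_rV R n in
  forall f, f \in Lfun mu 2%:E -> compact (closure [set y | f y != 0]) ->
    {ae mu, forall x, ~ closure [set y | f y != 0] x ->
      T f x = \int[mu]_y (K x y * f y)}.

Definition calderon_zygmund (R : realType) (n : nat)
    (T : ('rV[R]_n -> R) -> 'rV[R]_n -> R)
    (K : 'rV[R]_n -> 'rV[R]_n -> R) : Prop :=
  [/\ L2_bounded_linear T, CZ_kernel K & associated_kernel T K].

(* g represents T(b) in BMO, for b bounded: T b cannot be evaluated directly,
   and on each ball B it is, modulo an additive constant,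
   T(b 1_2B)(x) + int_{y notin 2B} (K(x, y) - K(c, y)) b(y) dy,
   where c is the centre of B; the integral converges absolutely for x in B. *)
Definition represents_Linfty_image (R : realType) (n : nat)
    (T : ('rV[R]_n -> R) -> 'rV[R]_n -> R) (K : 'rV[R]_n -> 'rV[R]_n -> R)
    (b g : 'rV[R]_n -> R) : Prop :=
  let mu := lebesgue_rV R n in
  forall (c : 'rV[R]_n) (r : R), 0 < r -> exists a : R,
    {ae mu, forall x, eball c r x ->
      g x = T (fun y => b y * \1_(eball c (2 * r)) y) x
            + \int[mu]_(y in ~` eball c (2 * r)) ((K x y - K c y) * b y) + a}.

Definition T1_eq0_BMO (R : realType) (n : nat)
    (T : ('rV[R]_n -> R) -> 'rV[R]_n -> R)
    (K : 'rV[R]_n -> 'rV[R]_n -> R) : Prop :=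
  exists g, represents_Linfty_image T K (cst 1) g /\
    exists c : R, {ae lebesgue_rV R n, forall x, g x = c}.

Definition mean (R : realType) (n : nat) (Q : set 'rV[R]_n)
    (f : 'rV[R]_n -> R) : R :=
  let mu := lebesgue_rV R n in (fine (mu Q))^-1 * \int[mu]_(x in Q) f x.

Definition osc (R : realType) (n : nat) (Q : set 'rV[R]_n)
    (f : 'rV[R]_n -> R) : R :=
  mean Q (fun x => `|f x - mean Q f|).

Definition dyadic_cube (R : realType) (n : nat) (alpha : 'rV[R]_n) (k : int)
    (m : 'rV[int]_n) : set 'rV[R]_n :=
  [set (2 : R) ^ (- k) *: (u + map_mx intr m + (-1 : R) ^ k *: alpha) |
    u in [set u : 'rV[R]_n | forall i, 0 <= u ord0 i <= 1]].

Definition dyadic_grid (R : realType) (n : nat) (alpha : 'rV[R]_n) :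
  set (set 'rV[R]_n) := [set Q | exists k m, Q = dyadic_cube alpha k m].

Definition dyadic (R : realType) (n : nat) : set (set 'rV[R]_n) :=
  \bigcup_(alpha in [set alpha : 'rV[R]_n |
      forall i, alpha ord0 i = 0 \/ alpha ord0 i = 3^-1])
    dyadic_grid alpha.

Definition sparse (R : realType) (n : nat) (eta : R)
    (S : set (set 'rV[R]_n)) : Prop :=
  let mu := lebesgue_rV R n in
  S `<=` @dyadic R n /\
  exists E : set 'rV[R]_n -> set 'rV[R]_n, trivIset S E /\
    forall Q, S Q ->
      [/\ measurable (E Q), E Q `<=` Q & (eta%:E * mu Q <= mu (E Q))%E].

(* Main.v *)
(* For a dyadic cell q let dil q be its enlargement by N > 2n layers of cells
   and f_q := (f - mean of f on dil q) 1_{dil q}. Outside a set E q of measure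
   at most delta |q|, both |T f_q| and the averages of |f_q| over the
   enlargements of smaller cells are O(osc_{dil q} f): the first by the weak
   (1,1) bound, which follows from the L^2 bound by a Calderon-Zygmund
   decomposition, the second by a maximal inequality. The maximal subcells P of
   q in which E q has density above a small theta cover E q up to a null set
   and a fixed fraction of q remains uncovered. On such a P,
     f_q = (mean on dil P - mean on dil q) 1_{dil P} + f_P + f_q 1_{(dil P)^c};
   T(1) = 0 makes T(1_{dil P}) bounded on P, and T of the last term varies
   little on P by kernel regularity while being O(osc_{dil q} f) at some point
   of P outside E q. Hence |T f_q| <= |T f_P| + C osc_{dil q} f on P, and
   iterating over the tree of stopping cells gives a sparse domination of
   |T f_q|. The cells at the origin, one chain in each orthant, are added to the
   stopping cells, so that the trees started from larger and larger cells of a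
   chain are nested and give a single sparse family; along a chain the mean of
   f and the part of f outside dil q tend to 0. Finally each dil q sits in a
   dyadic cube of comparable size of one of the shifted grids (one-third
   trick). *)

Require Import Defs.
From mathcomp Require Import all_boot all_order all_algebra.
From mathcomp Require Import all_classical all_reals all_analysis.
From mathcomp Require Import ring lra zify measurable_realfun.
Set Implicit Arguments.
Unset Strict Implicit.
Unset Printing Implicit Defensive.
Import Order.TTheory GRing.Theory Num.Theory.
Import numFieldTopology.Exports numFieldNormedType.Exports.
Local Open Scope classical_set_scope.
Local Open Scope ring_scope.

(** * Dyadic cells and their enlargements *)

(** The lower bound on N reconciles two norms: cells live in the sup norm, while kernel regularity
    is stated in the Euclidean one, and comparing the two costs a factor n in its smallness
    condition. [T] acts on functions and not on classes; it is linear only almost everywhere and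
    only over finite sums. Hence comparison points are picked by measure among points where finitely
    many almost-sure bounds hold, and the bad part of the Calderon-Zygmund decomposition is cut
    after finitely many cells. Differentiation enters only through [density]: some cell is more than
    half filled by a given set of positive measure. It yields both the bound on the good part and
    the covering of E q. With theta = 2^-n / 4 and delta = theta / 4, dense stopping cells fill at
    most 1/4 of q and the chain child at most 1/2; the remaining quarter is the set witnessing
    sparseness. That quarter also makes the measures of the tree cells summable, so by
    Borel-Cantelli the recursion ends at almost every point. *)

Section grid.
Context (R : realType) (n : nat).
Implicit Types (x y : 'rV[R]_n) (k : int) (q : int * 'rV[int]_n).

Definition side k : R := (2 : R) ^ (- k).

Lemma side_gt0 k : 0 < side k.
Proof. exact: exprz_gt0. Qed.

Lemma side_neq0 k : side k != 0.
Proof. by rewrite gt_eqF ?side_gt0. Qed.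

Lemma exp2_gt0 k : 0 < (2 : R) ^ k.
Proof. exact: exprz_gt0. Qed.

Lemma exp2V k : (2 : R) ^ k = (side k)^-1.
Proof. by rewrite /side -invr_expz invrK. Qed.

Lemma exp2_side k : (2 : R) ^ k * side k = 1.
Proof. by rewrite exp2V mulVf ?side_neq0. Qed.

Lemma sideB k (i : nat) : side (k - i%:Z) = 2 ^+ i * side k.
Proof. by rewrite /side opprB expfzDr. Qed.

Lemma exp2D k (i : nat) : (2 : R) ^ (k + i%:Z) = 2 ^ k * (2 ^+ i).
Proof. by rewrite expfzDr. Qed.

Lemma le_side k k' : k <= k' -> side k' <= side k.
Proof. by move=> kk'; rewrite /side ler_eXz2l ?ltr1n// lerN2. Qed.

(* A pair (k, m) stands for the half-open cell 2^-k (m + [0, 1[^n), and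
   [gen k x] is the index of the cell of generation k that contains x; [dil N q]
   is the union of the cells at distance at most N layers from q. *)
Definition gen k x : 'rV[int]_n := \row_i Num.floor (2 ^ k * x ord0 i).

Definition dil (N : nat) q : set 'rV[R]_n :=
  [set x | forall i, `|gen q.1 x ord0 i - q.2 ord0 i| <= N%:Z].

Definition cell q : set 'rV[R]_n := [set x | gen q.1 x = q.2].

Definition corner q : 'rV[R]_n := \row_i ((q.2 ord0 i)%:~R * side q.1).

Lemma genE k x i : gen k x ord0 i = Num.floor (2 ^ k * x ord0 i).
Proof. by rewrite mxE. Qed.

Lemma cell_gen k x : cell (k, gen k x) x.
Proof. by []. Qed.

Lemma cell_inj q x : cell q x -> q = (q.1, gen q.1 x).
Proof. by case: q => k m h; congr pair; exact/esym. Qed.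

Lemma cell_dil0 q : cell q = dil 0 q.
Proof.
apply/seteqP; split => x; first by move=> /= h i; rewrite h subrr normr0.
by move=> /= H; apply/rowP => i; have := H i; rewrite normr_le0 subr_eq0 => /eqP.
Qed.

Lemma dil_sub N M q : (N <= M)%N -> dil N q `<=` dil M q.
Proof. by move=> NM x H i; apply: (le_trans (H i)); rewrite lez_nat. Qed.

Lemma cell_sub_dil N q : cell q `<=` dil N q.
Proof. by rewrite cell_dil0; exact: dil_sub. Qed.

Lemma dilP N q x : dil N q x <-> forall i,
  (q.2 ord0 i)%:~R - N%:R <= 2 ^ q.1 * x ord0 i < (q.2 ord0 i)%:~R + N%:R + 1.
Proof.
split=> H i; have := H i; rewrite genE.
  move=> h; have h1 : q.2 ord0 i - N%:Z <= Num.floor (2 ^ q.1 * x ord0 i) by lia.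
  have h2 : Num.floor (2 ^ q.1 * x ord0 i) < q.2 ord0 i + N%:Z + 1 by lia.
  move: h1 h2; rewrite floor_ge_int floor_lt_int !intrD rmorphN/= => -> ->//.
move=> /andP[h1 h2].
have : q.2 ord0 i - N%:Z <= Num.floor (2 ^ q.1 * x ord0 i).
  by rewrite floor_ge_int !intrD rmorphN.
have : Num.floor (2 ^ q.1 * x ord0 i) < q.2 ord0 i + N%:Z + 1.
  by rewrite floor_lt_int !intrD.
lia.
Qed.

Lemma dilPs N q x : dil N q x <-> forall i,
  ((q.2 ord0 i)%:~R - N%:R) * side q.1 <= x ord0 i <
  ((q.2 ord0 i)%:~R + N%:R + 1) * side q.1.
Proof.
have E i (c d : R) : (c <= 2 ^ q.1 * x ord0 i < d) =
    (c * side q.1 <= x ord0 i < d * side q.1).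
  by rewrite exp2V mulrC ler_pdivlMr ?side_gt0// ltr_pdivrMr ?side_gt0.
by split=> [/dilP|] H; [|apply/dilP] => i; have := H i; rewrite E.
Qed.

Lemma corner_cell q : cell q (corner q).
Proof.
apply/rowP => i; rewrite genE mxE mulrCA exp2_side mulr1.
by apply/eqP; rewrite floor_eq lexx/= ltr_int ltzD1.
Qed.

(** With j the floor of u, the gap reads u < j + 1 and j + N + 1 <= v. Both bounds are integers, so
    they survive multiplication by 2^p and still bound the floors. *)
Let floor_far (p N : nat) (u v : R) : N%:Z < Num.floor v - Num.floor u ->
  (N * 2 ^ p)%N%:Z < Num.floor (2 ^+ p * v) - Num.floor (2 ^+ p * u).
Proof.
move=> uv; set j := Num.floor u.
have v1 : j + N%:Z + 1 <= Num.floor v by rewrite /j; lia.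
have u1 : Num.floor u < j + 1 by rewrite /j; lia.
have h1 : (2 ^ p)%N%:Z * (j + N%:Z + 1) <= Num.floor (2 ^+ p * v).
  by rewrite floor_ge_int intrM /= -pmulrn natrX ler_pM2l ?exprn_gt0// -floor_ge_int.
have h2 : Num.floor (2 ^+ p * u) < (2 ^ p)%N%:Z * (j + 1).
  by rewrite floor_lt_int intrM /= -pmulrn natrX ltr_pM2l ?exprn_gt0// -floor_lt_int.
rewrite PoszM; lia.
Qed.

(** Contrapositive of [floor_far] in each coordinate: nearness counted in layers is inherited by
    coarser generations with the same N. Thus the enlargement of a cell lies in the enlargement of
    each of its ancestors. *)
Lemma gen_near k (p : nat) (N : nat) x y :
  dil N (k + p%:Z, gen (k + p%:Z) x) y -> dil N (k, gen k x) y.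
Proof.
move=> H i; move: (H i) => /=; rewrite !genE !exp2D.
set a := 2 ^ k * x ord0 i; set b := 2 ^ k * y ord0 i.
have -> : 2 ^ k * 2 ^+ p * x ord0 i = 2 ^+ p * a by rewrite /a; ring.
have -> : 2 ^ k * 2 ^+ p * y ord0 i = 2 ^+ p * b by rewrite /b; ring.
move=> h.
have [//|] := lerP _ N%:Z.
have : N%:Z <= (N * 2 ^ p)%N%:Z by rewrite lez_nat leq_pmulr ?expn_gt0.
move=> h0; move: h0 (@floor_far p N a b) (@floor_far p N b a) h.
move: (N * 2 ^ p)%N (Num.floor (2 ^+ p * a)) (Num.floor (2 ^+ p * b)).
move: (Num.floor a) (Num.floor b) => *; lia.
Qed.

Lemma gen_le_near k k' N x y : k <= k' ->
  dil N (k', gen k' x) y -> dil N (k, gen k x) y.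
Proof.
move=> kk'; have [p ->] : exists p : nat, k' = k + p%:Z.
  by exists `|k' - k|%N; lia.
exact: gen_near.
Qed.

Lemma gen_mono k k' x y : k <= k' -> gen k' x = gen k' y -> gen k x = gen k y.
Proof.
move=> kk' e; have : cell (k, gen k x) y.
  by rewrite cell_dil0; apply: (gen_le_near kk'); rewrite -cell_dil0 /cell/= e.
by rewrite /cell /=.
Qed.

Lemma cell_sub k k' x : k <= k' -> cell (k', gen k' x) `<=` cell (k, gen k x).
Proof. by move=> kk' y /= h; exact: (gen_mono kk' h). Qed.

(** The opposite trade: 2^p times as many layers of small cells fit into N layers of the ancestor p
    generations up. Averages over the shells around a cell are thereby controlled by averages over
    enlarged ancestors. *)
Lemma dil_parent k (p N : nat) x :
  dil (N * 2 ^ p) (k, gen k x) `<=` dil N (k - p%:Z, gen (k - p%:Z) x).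
Proof.
move=> y H i; have := H i => /=; rewrite !genE.
have -> : (2 : R) ^ k = 2 ^ (k - p%:Z) * 2 ^+ p by rewrite -exp2D subrK.
set a := 2 ^ (k - p%:Z) * x ord0 i; set b := 2 ^ (k - p%:Z) * y ord0 i.
have -> : 2 ^ (k - p%:Z) * 2 ^+ p * x ord0 i = 2 ^+ p * a by rewrite /a; ring.
have -> : 2 ^ (k - p%:Z) * 2 ^+ p * y ord0 i = 2 ^+ p * b by rewrite /b; ring.
move=> h.
have [//|] := lerP _ N%:Z.
move: (@floor_far p N a b) (@floor_far p N b a) h.
move: (N * 2 ^ p)%N (Num.floor (2 ^+ p * a)) (Num.floor (2 ^+ p * b)).
move: (Num.floor a) (Num.floor b) => *; lia.
Qed.

Lemma dil_sym N k x y : dil N (k, gen k x) y -> dil N (k, gen k y) x.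
Proof. by move=> H i; have := H i; rewrite distrC. Qed.

End grid.

(** * Half-open boxes and the measure of cells *)

Section box.
Context (R : realType).

Definition box (n : nat) (a b : 'rV[R]_n) : set 'rV[R]_n :=
  [set x | forall i, a ord0 i <= x ord0 i < b ord0 i].

Lemma measurable_box (n : nat) (a b : 'rV[R]_n) : measurable (box a b).
Proof.
rewrite (_ : box a b = \bigcap_(i in [set: 'I_n])
    (@rV_coord R n i @^-1` `[a ord0 i, b ord0 i[)).
  apply: fin_bigcap_measurable => //= i _.
  by rewrite -[X in measurable X]setTI; exact: measurable_rV_coord.
apply/seteqP; split=> [x /= H i _ | x H i]/=; first by rewrite in_itv/=; exact: H.
by have := H i I; rewrite /= in_itv.
Qed.

Lemma lebesgue_box (n : nat) (a b : 'rV[R]_n) :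
  (forall i, a ord0 i <= b ord0 i) ->
  lebesgue_rV R n (box a b) = (\prod_(i < n) (b ord0 i - a ord0 i))%:E.
Proof.
elim: n a b => [|n IHn] a b ab.
  by rewrite big_ord0 /= diracE mem_set//= => i; case: i.
pose tl (x : 'rV[R]_n.+1) : 'rV[R]_n := \row_i x ord0 (lift ord0 i).
rewrite big_ord_recl EFinM /= /lebesgue_rV_succ /pushforward.
have -> : @rV_cons R n @^-1` box a b =
    `[a ord0 ord0, b ord0 ord0[%classic `*` box (tl a) (tl b).
  apply/seteqP; split=> [[r x] /= H|[r x] /= [H0 H] i].
    split=> [|i]; first by rewrite in_itv/=; have := H ord0; rewrite rV_consE0.
    by have := H (lift ord0 i); rewrite rV_consES !mxE.
  have [j ->|->] := unliftP ord0 i.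
    by have := H j; rewrite rV_consES !mxE.
  by move: H0; rewrite in_itv/= rV_consE0.
rewrite product_measure1E//; last exact: measurable_box.
rewrite IHn; last by move=> i; rewrite !mxE.
congr (_ * _)%E; last by congr EFin; apply: eq_bigr => i _; rewrite !mxE.
apply: eq_trans (lebesgue_measure_itv _) _; rewrite /= lte_fin.
by case: ltgtP (ab ord0) => // -> _; rewrite subrr.
Qed.

End box.

Section grid_measure.
Context (R : realType) (n : nat).
Local Open Scope ereal_scope.
Local Notation mu := (lebesgue_rV R n).
Implicit Types (q : int * 'rV[int]_n).

Lemma dil_box N q : @dil R n N q =
  box (\row_i (((q.2 ord0 i)%:~R - N%:R) * side R q.1)%R)
      (\row_i (((q.2 ord0 i)%:~R + N%:R + 1) * side R q.1)%R).
Proof.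
by apply/seteqP; split=> x; [move=> /dilPs|move=> h; apply/dilPs] => [h|] i;
  have := h i; rewrite !mxE.
Qed.

Lemma measurable_dil N q : measurable (@dil R n N q).
Proof. by rewrite dil_box; exact: measurable_box. Qed.

Lemma measurable_cell q : measurable (@cell R n q).
Proof. by rewrite cell_dil0; exact: measurable_dil. Qed.

Lemma mu_dil N q : mu (dil N q) = ((((2 * N).+1)%:R * side R q.1) ^+ n)%:E.
Proof.
rewrite dil_box lebesgue_box => [|i]; last first.
  by rewrite !mxE ler_pM2r ?side_gt0//; have : (0 <= N%:R :> R)%R by []; lra.
congr EFin; rewrite (eq_bigr (fun=> (((2 * N).+1)%:R * side R q.1)%R)).
  by rewrite prodr_const card_ord.
by move=> i _; rewrite !mxE -mulrBl; congr (_ * _)%R; rewrite -natr1 natrM; lra.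
Qed.

Lemma mu_cell q : mu (cell q) = (side R q.1 ^+ n)%:E.
Proof. by rewrite cell_dil0 mu_dil mul1r. Qed.

Lemma mu_dil_cell N q : mu (dil N q) = (((2 * N).+1)%:R ^+ n)%:E * mu (cell q).
Proof. by rewrite mu_dil mu_cell -EFinM exprMn. Qed.

Lemma mu_cell_gt0 q : 0 < mu (cell q).
Proof. by rewrite mu_cell lte_fin exprn_gt0// side_gt0. Qed.

Lemma mu_cell_lty q : mu (cell q) < +oo.
Proof. by rewrite mu_cell ltry. Qed.

Lemma mu_dil_lty N q : mu (dil N q) < +oo.
Proof. by rewrite mu_dil ltry. Qed.

End grid_measure.

(** * Maximal cells and dyadic density *)

Section countable_families.
Context d (T : measurableType d) (R : realType) (I : countType).
Variable mu : {measure set T -> \bar R}.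
Implicit Types (P : set I) (D : I -> set T).
Local Open Scope ereal_scope.

(** Padding with [set0] turns a family indexed by part of a countable type into a sequence, the form
    in which countable additivity applies; disjointness is preserved. *)
Definition enum_fam P D (j : nat) : set T :=
  if @pickle_inv I j is Some i then (if `[< P i >] then D i else set0) else set0.

Lemma enum_fam_pickle P D i : P i -> enum_fam P D (pickle i) = D i.
Proof. by move=> Pi; rewrite /enum_fam pickleK_inv asboolT. Qed.

Lemma enum_famP P D j x : enum_fam P D j x -> exists i, [/\ P i, pickle i = j & D i x].
Proof.
rewrite /enum_fam; case E : (@pickle_inv I j) => [i|//].
case: asboolP => // Pi Dx; exists i; split => //.
by have := @pickle_invK I j; rewrite /ocancel E.
Qed.

Lemma bigcup_enum_fam P D : \bigcup_j enum_fam P D j = \bigcup_(i in P) D i.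
Proof.
apply/seteqP; split=> x [].
  by move=> j _ /enum_famP[i [Pi _ Dx]]; exists i.
by move=> i Pi Dx; exists (pickle i) => //; rewrite enum_fam_pickle.
Qed.

Lemma trivIset_enum_fam P D : trivIset P D -> trivIset setT (enum_fam P D).
Proof.
move=> tD j j' _ _ [x [/enum_famP[i [Pi <- Di]] /enum_famP[i' [Pi' <- Di']]]].
by congr pickle; apply: (tD i i') => //; exists x.
Qed.

Lemma measurable_enum_fam P D j : (forall i, measurable (D i)) ->
  measurable (enum_fam P D j).
Proof.
by move=> mD; rewrite /enum_fam; case: pickle_inv => // i; case: ifP.
Qed.

Lemma measurable_bigcup_count P D : (forall i, measurable (D i)) ->
  measurable (\bigcup_(i in P) D i).
Proof.
move=> mD; rewrite -bigcup_enum_fam.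
by apply: bigcupT_measurable => j; exact: measurable_enum_fam.
Qed.

Lemma le_integral_bigcup P D (f g : T -> \bar R) :
  trivIset P D -> (forall i, measurable (D i)) ->
  measurable_fun setT f -> measurable_fun setT g ->
  (forall x, 0 <= f x) -> (forall x, 0 <= g x) ->
  (forall i, P i -> \int[mu]_(x in D i) f x <= \int[mu]_(x in D i) g x) ->
  \int[mu]_(x in \bigcup_(i in P) D i) f x <=
  \int[mu]_(x in \bigcup_(i in P) D i) g x.
Proof.
move=> tD mD mf mg f0 g0 fg; rewrite -bigcup_enum_fam.
rewrite !ge0_integral_bigcup//=; first last.
- exact: trivIset_enum_fam.
- exact: (measurable_funS measurableT).
- by move=> k; exact: measurable_enum_fam.
- exact: trivIset_enum_fam.
- exact: (measurable_funS measurableT).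
- by move=> k; exact: measurable_enum_fam.
apply: lee_nneseries => [j _ _|j _]; first by rewrite integral_ge0.
rewrite /enum_fam; case: pickle_inv => [i|]; last by rewrite !integral_set0.
by case: asboolP => Pi; [exact: fg|rewrite !integral_set0].
Qed.

(** Subadditivity for [D'], additivity for [D]: only [D] is disjoint, which allows [D'] to be the
    overlapping enlargements of disjoint cells. *)
Lemma measure_bigcup_le P D D' (c : R) :
  trivIset P D -> (forall i, measurable (D i)) -> (forall i, measurable (D' i)) ->
  (0 <= c)%R -> (forall i, P i -> mu (D' i) <= c%:E * mu (D i)) ->
  mu (\bigcup_(i in P) D' i) <= c%:E * mu (\bigcup_(i in P) D i).
Proof.
move=> tD mD mD' c0 H; rewrite -!bigcup_enum_fam.
have mE := fun j => @measurable_enum_fam P D j mD.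
have mE' := fun j => @measurable_enum_fam P D' j mD'.
apply: (@le_trans _ _ (\sum_(j <oo) mu (enum_fam P D' j))).
  apply: measure_sigma_subadditive => //.
  exact: bigcupT_measurable.
rewrite measure_semi_bigcup//; last 2 first.
- exact: trivIset_enum_fam.
- exact: bigcupT_measurable.
rewrite -nneseriesZl//.
apply: lee_nneseries => [//|j _].
rewrite /enum_fam; case: pickle_inv => [i|]; last by rewrite !measure0 mule0.
by case: asboolP => Pi; [exact: H|rewrite !measure0 mule0].
Qed.

End countable_families.

Section maximal_cells.
Context (R : realType) (n : nat).
Implicit Types (S : set (int * 'rV[int]_n)) (x : 'rV[R]_n).

(* Maximality is tested on the ancestors of q, which are the cells
   [(k, gen k x)] with x in q and k < q.1. *)
Definition maxcell S : set (int * 'rV[int]_n) :=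
  [set q | S q /\ forall x k, @cell R n q x -> k < q.1 -> ~ S (k, gen k x)].

(** A lower bound on the generations of members of S around x makes them well ordered; the coarsest
    one is maximal, since the ancestors of a cell do not depend on the point of the cell. *)
Lemma maxcell_exists S x k : S (k, gen k x) ->
  (exists k0, forall j, j < k0 -> ~ S (j, gen j x)) ->
  exists2 j, j <= k & maxcell S (j, gen j x).
Proof.
move=> Sk [k0 nS].
have k0k : k0 <= k by rewrite leNgt; apply/negP => /nS.
have ex : exists p : nat, `[< S (k0 + p%:Z, gen (k0 + p%:Z) x) >].
  by exists `|k - k0|%N; apply/asboolP; rewrite gez0_abs ?subr_ge0// subrKC.
have [p /asboolP Sp pmin] := ex_minnP ex.
exists (k0 + p%:Z).
  rewrite -lerBrDl -(@gez0_abs (k - k0)) ?subr_ge0// lez_nat.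
  by apply: pmin; apply/asboolP; rewrite gez0_abs ?subr_ge0// subrKC.
split=> // y j; rewrite /cell/= => yx jp.
have [jk0|k0j] := ltP j k0.
  by rewrite -(gen_mono (ltW jp) (esym yx)); exact: nS.
move=> Sj; have : (p <= `|j - k0|)%N.
  apply: pmin; apply/asboolP; rewrite gez0_abs ?subr_ge0// subrKC.
  by rewrite (gen_mono (ltW jp) (esym yx)).
by rewrite leqNgt => /negP; apply; lia.
Qed.

(** Both cells are of the form [(k, gen k x)] for the common point x, so with different generations
    the coarser would be a member of S among the ancestors of the finer. *)
Lemma maxcell_triv S : trivIset (maxcell S) (@cell R n).
Proof.
move=> q q' [Sq mq] [Sq' mq'] [x [qx q'x]].
rewrite (cell_inj qx) (cell_inj q'x).
have [h|h|-> //] := ltgtP q.1 q'.1.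
  by case: (mq' x _ q'x h); rewrite -(cell_inj qx).
by case: (mq x _ qx h); rewrite -(cell_inj q'x).
Qed.

End maximal_cells.

Section density.
Context (R : realType) (n : nat).
Local Open Scope ereal_scope.
Local Notation mu := (lebesgue_rV R n).
Local Notation cell := (@cell R n).
Implicit Types (q Q : int * 'rV[int]_n) (Z : set 'rV[int]_n) (A B : set 'rV[R]_n).

Definition gset k Z : set 'rV[R]_n := gen k @^-1` Z.

Lemma gset_bigcup k Z : gset k Z = \bigcup_(m in Z) cell (k, m).
Proof.
apply/seteqP; split=> x; first by exists (gen k x).
by move=> [m Zm xm]; rewrite /gset/= xm.
Qed.

Lemma gset_triv k Z : trivIset Z (fun m => cell (k, m)).
Proof. by move=> m m' _ _ [x [xm xm']]; rewrite -[m]xm -[m']xm'. Qed.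

Lemma measurable_gset k Z : measurable (gset k Z).
Proof.
rewrite gset_bigcup; apply: measurable_bigcup_count => m; exact: measurable_cell.
Qed.

Lemma gset_finer k k' Z : (k <= k')%R ->
  gset k Z = gset k' (gen k' @` gset k Z).
Proof.
move=> kk'; apply/seteqP; split=> x; first by exists x.
by move=> [y Zy yx]; rewrite /gset/= -(gen_mono kk' yx).
Qed.

Let sdiff A B := (A `\` B) `|` (B `\` A).

(** Approximation by a union of cells of a single generation is asked only inside a given cell Q,
    where the measure is finite. The sets with this property form a sigma-algebra [C] containing the
    coordinate half-spaces, hence all measurable sets. *)
Let approx A := forall Q (e : R), (0 < e)%R ->
  exists k Z, mu (cell Q `&` sdiff A (gset k Z)) <= e%:E.

Let C := [set A | measurable A /\ approx A].

Let msdiff A k Z : measurable A -> measurable (sdiff A (gset k Z)).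
Proof.
move=> mA; apply: measurableU; apply: measurableD => //; exact: measurable_gset.
Qed.

Let approx_gset k Z : C (gset k Z).
Proof.
split; first exact: measurable_gset.
move=> Q e e0; exists k, Z; rewrite /sdiff setDv setU0 setI0 measure0 lee_fin ltW//.
Qed.

Let approxC A : C A -> C (~` A).
Proof.
move=> [mA aA]; split; first exact: measurableC.
move=> Q e e0; have [k [Z H]] := aA Q e e0; exists k, (~` Z).
rewrite (_ : sdiff _ _ = sdiff A (gset k Z))// /sdiff /gset preimage_setC.
by rewrite !setDE !setCK setUC [~` A `&` _]setIC [in RHS]setIC.
Qed.

Let approxU A B : C A -> C B -> C (A `|` B).
Proof.
move=> [mA aA] [mB aB]; split; first exact: measurableU.
move=> Q e e0; have e20 : (0 < e / 2)%R by rewrite divr_gt0.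
have [k [Z H]] := aA Q _ e20; have [k' [Z' H']] := aB Q _ e20.
pose K := Num.max k k'.
have kK : (k <= K)%R by rewrite le_max lexx.
have kK' : (k' <= K)%R by rewrite le_max lexx orbT.
exists K, (gen K @` gset k Z `|` gen K @` gset k' Z').
rewrite (_ : gset K _ = gset k Z `|` gset k' Z'); last first.
  by rewrite [in RHS](gset_finer Z kK) [in RHS](gset_finer Z' kK').
apply: (@le_trans _ _ (mu ((cell Q `&` sdiff A (gset k Z)) `|`
                           (cell Q `&` sdiff B (gset k' Z'))))).
  have mG := measurable_gset k Z; have mG' := measurable_gset k' Z'.
  have mQ := @measurable_cell R n Q.
  apply: le_measure; rewrite ?inE.
  - by apply: measurableI => //; apply: measurableU; apply: measurableD => //;
      exact: measurableU.
  - by apply: measurableU; apply: measurableI => //; exact: msdiff.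
  move=> x [Qx [[[Ax|Bx] /not_orP[nG nG']]|[[Gx|Gx'] /not_orP[nA nB]]]].
  - by left; split=> //; left.
  - by right; split=> //; left.
  - by left; split=> //; right.
  - by right; split=> //; right.
apply: (le_trans (measureU2 _ _ _)).
- by apply: measurableI; [exact: measurable_cell|exact: msdiff].
- by apply: measurableI; [exact: measurable_cell|exact: msdiff].
by rewrite [e]splitr EFinD leeD.
Qed.

Let approx_bigcup (F : (set 'rV[R]_n)^nat) : (forall i, C (F i)) ->
  C (\bigcup_i F i).
Proof.
move=> CF; have mF i : measurable (F i) by case: (CF i).
split; first exact: bigcupT_measurable.
pose G N := \big[setU/set0]_(i < N) F i.
have CG N : C (G N).
  rewrite /G; elim: N => [|N IH]; last by rewrite big_ord_recr; exact: approxU.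
  by rewrite big_ord0; have := approx_gset 0 set0; rewrite /gset preimage_set0.
have mG N : measurable (G N) by case: (CG N).
move=> Q e e0; have e20 : (0 < e / 2)%R by rewrite divr_gt0.
have mQ := @measurable_cell R n Q.
have mU : measurable (\bigcup_i F i) by exact: bigcupT_measurable.
(* Countable unions reduce to finite ones: the remainders decrease to the empty set inside a cell of
   finite measure. *)
pose H N := cell Q `&` (\bigcup_i F i `\` G N).
have mH N : measurable (H N).
  by apply: measurableI => //; apply: measurableD.
have H0 : \bigcap_N H N = set0.
  apply/seteqP; split=> // x h; have [Qx [[i _ Fx] _]] := h 0%N I.
  have [_ [_]] := h i.+1 I; apply; rewrite /G -bigcup_mkord.
  by exists i => //=.
have : mu (H N) @[N --> \oo] --> mu (\bigcap_N H N).
  apply: nonincreasing_cvg_mu => //.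
  - by rewrite (le_lt_trans _ (@mu_cell_lty R n Q))// le_measure ?inE//; exact: subIsetl.
  - exact: bigcapT_measurable.
  - move=> a b ab; apply/subsetPset => x [Qx [Ux nG]]; split=> //; split=> // Gx.
    apply: nG; move: Gx; rewrite /G -!bigcup_mkord => -[i /= ia Fx].
    by exists i => //=; exact: leq_trans ab.
rewrite H0 measure0 => cvgH.
have [N HN] : exists N, mu (H N) <= (e / 2)%:E.
  have /fine_cvgP[_ /cvgrPdist_lt/(_ _ e20)[N _ hN]] := cvgH.
  exists N; have := hN N (leqnn N); rewrite sub0r normrN /= => /ltW.
  rewrite ger0_norm ?fine_ge0// -lee_fin fineK// ge0_fin_numE//.
  by rewrite (le_lt_trans _ (@mu_cell_lty R n Q))// le_measure ?inE//; exact: subIsetl.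
have [_ /(_ Q _ e20)[k [Z HZ]]] := CG N; exists k, Z.
have mZ := measurable_gset k Z.
apply: (@le_trans _ _ (mu (H N `|` (cell Q `&` sdiff (G N) (gset k Z))))).
  apply: le_measure; rewrite ?inE.
  - by apply: measurableI => //; exact: msdiff.
  - by apply: measurableU => //; apply: measurableI => //; exact: msdiff.
  move=> x [Qx [[Ux nZ]|[Zx nU]]].
    have [Gx|nG] := pselect (G N x); last by left.
    by right; split=> //; left.
  right; split=> //; right; split=> // Gx; apply: nU.
  by move: Gx; rewrite /G -bigcup_mkord => -[i _ Fx]; exists i.
apply: (le_trans (measureU2 _ _ _)) => //.
  by apply: measurableI => //; exact: msdiff.
by rewrite [e]splitr EFinD leeD.
Qed.

Let C_sigma : sigma_algebra setT C.
Proof.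
split.
- by have := approx_gset 0 set0; rewrite /gset preimage_set0.
- by move=> A CA; rewrite setTD; exact: approxC.
- exact: approx_bigcup.
Qed.

Let C_ray i (a : R) : C (@rV_coord R n i @^-1` `[a, +oo[).
Proof.
rewrite -[X in C X]setCK; apply: approxC.
(* A point strictly below a has, at a fine enough generation, an index strictly below that of a:
   once 2^K (a - x) >= 1 the floors differ. *)
rewrite (_ : ~` _ = \bigcup_(K : nat)
    gset K%:Z [set m : 'rV[int]_n | (m ord0 i < Num.floor (2 ^ K%:Z * a))%R]).
  by apply: approx_bigcup => K; exact: approx_gset.
apply/seteqP; split=> x; rewrite /rV_coord /=.
  rewrite in_itv/= andbT => /negP; rewrite -ltNge => xa.
  pose K := Num.bound (a - x ord0 i)^-1.
  exists K => //; rewrite /gset/= genE.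
  have h : (1 <= 2 ^+ K * (a - x ord0 i))%R.
    have h1 : ((a - x ord0 i)^-1 < K%:R)%R.
      by apply: le_lt_trans (archi_boundP _) => //; rewrite invr_ge0 subr_ge0 ltW.
    rewrite -ler_pdivrMr ?subr_gt0// mul1r (le_trans (ltW h1))//.
    by rewrite -natrX ler_nat ltnW// ltn_expl.
  have h2 : (2 ^ K%:Z * x ord0 i + 1 <= 2 ^ K%:Z * a)%R.
    by rewrite /exprz/=; move: h; rewrite mulrBr; lra.
  have : (Num.floor (2 ^ K%:Z * x ord0 i) + 1 <= Num.floor (2 ^ K%:Z * a))%R.
    rewrite floor_ge_int intrD (le_trans _ h2)// lerD2r; exact: floor_le.
  by lia.
move=> [K _]; rewrite /gset/= genE => h; rewrite in_itv/= andbT => ax.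
move: h; rewrite ltNge => /negP; apply; apply: le_floor.
by rewrite ler_pM2l// exp2_gt0.
Qed.

Let measurable_C A : measurable A -> C A.
Proof.
suff H : @measurable _ 'rV[R]_n `<=` C by move=> /H.
apply: smallest_sub; first exact: C_sigma.
have HY i (Y : set R) : measurable Y -> C (@rV_coord R n i @^-1` Y).
  move=> mY; have {}mY : <<s (@RGenCInfty.G R) >> Y.
    by have := RGenCInfty.measurableE R; rewrite /measurable/= => <-.
  suff H : <<s (@RGenCInfty.G R) >> `<=` [set Y | C (@rV_coord R n i @^-1` Y)].
    exact: H.
  apply: smallest_sub.
    split=> /=.
    - by rewrite preimage_set0; case: C_sigma.
    - by move=> B CB; rewrite setTD preimage_setC; exact: approxC.
    - by move=> F CF; rewrite preimage_bigcup; exact: approx_bigcup.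
  by move=> _ [a ->]; exact: C_ray.
rewrite -bigcup_seq => B [i _ [Y mY <-]].
by rewrite setTI; exact: HY.
Qed.

(** Were the density at most 1/2 in every cell, so would it be on every disjoint union of cells.
    Inside a cell where A has measure b > 0, such a union U approximates A up to b/4; then mu U <=
    5b/4 and b <= 5b/8 + b/4 < b. *)
Lemma density A : measurable A -> 0 < mu A ->
  exists q, mu (cell q) < 2%:E * mu (A `&` cell q).
Proof.
move=> mA A0; apply: contrapT => /forallNP H.
have {}H q : mu (A `&` cell q) <= (2^-1)%:E * mu (cell q).
  have /negP := H q; rewrite -leNgt => {}H.
  by rewrite muleC lee_pdivlMr// muleC.
have mQ := @measurable_cell R n.
have [m B0] : exists m, 0 < mu (A `&` cell (0%R, m)).
  apply: contrapT => /forallNP N; move: A0; apply/negP; rewrite -leNgt.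
  rewrite (_ : A = \bigcup_(m in [set: 'rV[int]_n]) (A `&` cell (0%R, m))); last first.
    by rewrite -setI_bigcupr -gset_bigcup /gset preimage_setT setIT.
  rewrite -[leRHS](mul0e (mu (\bigcup_(m in [set: 'rV[int]_n]) cell (0%R, m)))).
  apply: measure_bigcup_le => // [|m|m _]; first exact: gset_triv.
    exact: measurableI.
  by rewrite mul0e leNgt; apply/negP; exact: N.
set Q := (0%R, m) in B0; pose b := fine (mu (A `&` cell Q)).
have mIQ B : measurable B -> mu (B `&` cell Q) \is a fin_num.
  move=> mB; rewrite ge0_fin_numE// (le_lt_trans _ (@mu_cell_lty R n Q))//.
  by rewrite le_measure ?inE//; exact: measurableI.
have bE : mu (A `&` cell Q) = b%:E by rewrite fineK// mIQ.
have b0 : (0 < b)%R by rewrite -lte_fin -bE.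
have [|k [Z HZ]] := (measurable_C mA).2 Q (b / 4)%R; first by rewrite divr_gt0.
(* Refining to a generation at least that of Q makes U, the approximating union cut by Q, again a
   union of whole cells. *)
pose K := Num.max k 0%R.
have kK : (k <= K)%R by rewrite le_max lexx.
have QK : (0 <= K)%R by rewrite le_max lexx orbT.
pose U := gset k Z `&` cell Q.
have mZ := measurable_gset k Z.
have mU : measurable U by exact: measurableI.
have UE : U = \bigcup_(p in gen K @` U) cell (K, p).
  rewrite -gset_bigcup; apply/seteqP; split=> x; first by exists x.
  move=> [y [Zy Qy] yx]; split; first by rewrite /gset/= -(gen_mono kK yx).
  by rewrite /cell/= -(gen_mono QK yx).
have h1 : mu (A `&` U) <= (2^-1)%:E * mu U.
  rewrite UE setI_bigcupr; apply: measure_bigcup_le => // [|p|p _]; first exact: gset_triv.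
    exact: measurableI.
  exact: H.
have mS : measurable (cell Q `&` sdiff A (gset k Z)).
  by apply: measurableI => //; exact: msdiff.
have h2 : mu U <= mu (A `&` cell Q) + (b / 4)%:E.
  apply: (@le_trans _ _ (mu ((A `&` cell Q) `|` (cell Q `&` sdiff A (gset k Z))))).
    apply: le_measure; rewrite ?inE//; first by apply: measurableU => //; exact: measurableI.
    move=> x [Zx Qx]; have [Ax|nA] := pselect (A x); first by left.
    by right; split=> //; right.
  apply: (le_trans (measureU2 _ _ _)) => //; first exact: measurableI.
  by rewrite leeD.
have h3 : mu (A `&` cell Q) <= mu (A `&` U) + (b / 4)%:E.
  apply: (@le_trans _ _ (mu ((A `&` U) `|` (cell Q `&` sdiff A (gset k Z))))).
    apply: le_measure; rewrite ?inE//; first exact: measurableI.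
      by apply: measurableU => //; exact: measurableI.
    move=> x [Ax Qx]; have [Zx|nZ] := pselect (gset k Z x); first by left.
    by right; split=> //; left.
  apply: (le_trans (measureU2 _ _ _)) => //; first exact: measurableI.
  by rewrite leeD.
have fU : mu U \is a fin_num by exact: mIQ.
have fAU : mu (A `&` U) \is a fin_num by rewrite /U setIA; apply: mIQ; exact: measurableI.
move: h1 h2 h3; rewrite bE -(fineK fU) -(fineK fAU) -!EFinD -EFinM !lee_fin.
lra.
Qed.

End density.

(** * Kernel estimates in the sup norm *)

Section sup_norm.
Context (R : realType) (n : nat).
Implicit Types (x y : 'rV[R]_n) (k : int) (q : int * 'rV[int]_n).

Lemma coord_le_norm x i : `|x ord0 i| <= `|x|.
Proof.
by rewrite [leRHS]/Num.Def.normr/= mx_normrE; exact: (le_bigmax _ _ (ord0, i)).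
Qed.

Lemma norm_le_coord x (r : R) : 0 <= r -> (forall i, `|x ord0 i| <= r) -> `|x| <= r.
Proof.
move=> r0 H; rewrite [leLHS]/Num.Def.normr/= mx_normrE (bigmax_le _ r0)//.
by move=> [a i] _ /=; rewrite (ord1 a); exact: H.
Qed.

Lemma norm_le_enorm x : `|x| <= enorm x.
Proof.
apply: norm_le_coord => [|i]; first exact: sqrtr_ge0.
rewrite -sqrtr_sqr /enorm ler_wsqrtr// (bigD1 i)//= lerDl.
by apply: sumr_ge0 => j _; exact: sqr_ge0.
Qed.

Lemma enorm_le_norm x : enorm x <= n%:R * `|x|.
Proof.
rewrite -[leRHS]ger0_norm ?mulr_ge0// -sqrtr_sqr ler_wsqrtr//.
apply: (@le_trans _ _ (\sum_(i < n) `|x| ^+ 2)).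
  apply: ler_sum => i _; rewrite -[leLHS]ger0_norm ?sqr_ge0// normrX.
  by rewrite lerXn2r ?nnegrE// coord_le_norm.
rewrite sumr_const card_ord exprMn -[leLHS]mulr_natl ler_wpM2r ?exprn_ge0//.
by rewrite -natrX ler_nat; case: (n) => // m; rewrite leq_pmull.
Qed.

Lemma enorm_ge0 x : 0 <= enorm x.
Proof. exact: sqrtr_ge0. Qed.

Lemma dil_dist N q y : dil N q y -> `|y - corner R q| <= N.+1%:R * side R q.1.
Proof.
move=> /dilPs H; apply: norm_le_coord => [|i]; first by rewrite mulr_ge0// ltW// side_gt0.
rewrite !mxE; have := H i; set m := _%:~R; rewrite !mulrDl mulNr mul1r -natr1 => /andP[h1 h2].
have := side_gt0 R q.1; rewrite ler_norml; lra.
Qed.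

Lemma cell_dist q y : cell q y -> `|y - corner R q| <= side R q.1.
Proof. by rewrite cell_dil0 => /dil_dist; rewrite mul1r. Qed.

Lemma ndil_dist N q y : ~ dil N q y -> N%:R * side R q.1 <= `|y - corner R q|.
Proof.
move=> H; rewrite leNgt; apply/negP => h; apply: H; apply/dilPs => i.
have := le_lt_trans (coord_le_norm (y - corner R q) i) h.
rewrite !mxE; set m := _%:~R; rewrite ltr_norml !mulrDl mulNr mul1r.
have := side_gt0 R q.1; lra.
Qed.

Lemma side_small (e : R) : 0 < e -> exists k : nat, side R k%:Z < e.
Proof.
move=> e0; exists (Num.bound e^-1).
have h : e^-1 < (Num.bound e^-1)%:R.
  by apply: le_lt_trans (archi_boundP _) => //; rewrite invr_ge0 ltW.
rewrite /side -invr_expz /exprz/= invf_plt ?posrE ?exprn_gt0//.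
by rewrite (lt_trans h)// -natrX ltr_nat ltn_expl.
Qed.

(** An open set is the union of the countably many cells it contains, since cells around a point
    shrink to it. This links the topology to the sigma-algebra generated by the coordinates. *)
Lemma rV_open_measurable (U : set 'rV[R]_n) : open U -> measurable U.
Proof.
move=> oU.
rewrite (_ : U = \bigcup_(q in [set q | cell q `<=` U]) cell q).
  by apply: measurable_bigcup_count => q; exact: measurable_cell.
apply/seteqP; split=> x; last by move=> [q]; exact.
move=> Ux; have /nbhs_ballP[e /= e0 xU] := oU _ Ux.
have [|k hk] := @side_small (e / 2); first by rewrite divr_gt0.
exists (k%:Z, gen k%:Z x) => // y yx; apply: xU.
rewrite mx_norm_ball /ball_/=.
have h1 := cell_dist yx; have h2 := cell_dist (cell_gen k%:Z x).
apply: (le_lt_trans (ler_distD (corner R (k%:Z, gen k%:Z x)) _ _)).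
by rewrite [X in _ + X]distrC; move: h1 h2; rewrite /=; lra.
Qed.

Lemma dil_exhaust (p : int) (m : 'rV[int]_n) y : exists N, dil N (p, m) y.
Proof.
exists (\sum_(i < n) `|gen p y ord0 i - m ord0 i|)%N => i /=.
by rewrite -abszE lez_nat (bigD1 i)//= leq_addr.
Qed.

End sup_norm.

Section kernel.
Context (R : realType) (n : nat).
Local Notation mu := (lebesgue_rV R n).
Implicit Types (x y z : 'rV[R]_n) (q : int * 'rV[int]_n).

(** The kernel conditions in the sup norm. Since the Euclidean norm is at most n times the sup norm,
    [2 * n%:R] implies the Euclidean smallness condition; this is where N > 2n comes from. *)
Definition sup_kernel (K : 'rV[R]_n -> 'rV[R]_n -> R) (eps CK : R) :=
  [/\ 0 < eps, 0 <= CK,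
      forall x y, x != y -> `|K x y| <= CK * `|x - y| ^- n &
      forall x y z, 2 * n%:R * `|z| < `|x - y| ->
        `|K (x + z) y - K x y| <= CK * `|z| `^ eps * `|x - y| `^ (- n%:R - eps) /\
        `|K x (y + z) - K x y| <= CK * `|z| `^ eps * `|x - y| `^ (- n%:R - eps)].

Lemma CZ_sup_kernel K : CZ_kernel K -> exists eps CK, sup_kernel K eps CK.
Proof.
move=> [eps [C [eps0 H]]].
(* The factor n^eps comes from bounding the Euclidean norm of z; in the negative powers of the
   distance, passing to the smaller sup norm only enlarges the bound. *)
pose c := n%:R `^ eps; have c0 : 0 <= c by exact: powR_ge0.
exists eps, (`|C| * (1 + c)); split => //.
- by rewrite mulr_ge0// addr_ge0.
- move=> x y xy; have xy0 : 0 < `|x - y| by rewrite normr_gt0 subr_eq0.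
  have e0 := lt_le_trans xy0 (norm_le_enorm (x - y)).
  apply: (le_trans (H x y xy).1); apply: (@le_trans _ _ (`|C| * enorm (x - y) ^- n)).
    by rewrite ler_wpM2r ?ler_norm// invr_ge0 exprn_ge0// ltW.
  rewrite -mulrA ler_wpM2l// -[leLHS]mul1r ler_pM//; first by rewrite invr_ge0 exprn_ge0// ltW.
    by rewrite lerDl.
  by rewrite lef_pV2 ?posrE ?exprn_gt0// lerXn2r ?nnegrE ?norm_le_enorm// ltW.
- move=> x y z zxy; have xy0 : 0 < `|x - y|.
    by apply: le_lt_trans zxy; rewrite !mulr_ge0.
  have xy : x != y by rewrite -subr_eq0 -normr_gt0.
  have e0 := lt_le_trans xy0 (norm_le_enorm (x - y)).
  have hz : 2 * enorm z < enorm (x - y).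
    apply: (le_lt_trans _ (lt_le_trans zxy (norm_le_enorm _))).
    by rewrite -mulrA ler_pM2l// enorm_le_norm.
  have := (H x y xy).2 z hz; set A := `|K (x + z) y - _|; set B := `|K x (y + z) - _|.
  move=> h.
  have h2 : C * enorm z `^ eps * enorm (x - y) `^ (- n%:R - eps) <=
     `|C| * (1 + c) * `|z| `^ eps * `|x - y| `^ (- n%:R - eps).
    apply: (@le_trans _ _ (`|C| * enorm z `^ eps * enorm (x - y) `^ (- n%:R - eps))).
      by rewrite ler_wpM2r ?powR_ge0// ler_wpM2r ?powR_ge0// ler_norm.
    rewrite ler_pM ?mulr_ge0 ?powR_ge0//.
      rewrite -!mulrA ler_wpM2l//.
      apply: (@le_trans _ _ ((n%:R * `|z|) `^ eps)).
        by rewrite ge0_ler_powR ?nnegrE ?enorm_ge0 ?mulr_ge0 ?enorm_le_norm// ltW.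
      by rewrite powRM// ler_wpM2r ?powR_ge0// lerDr.
    rewrite -opprD !powRN lef_pV2 ?posrE ?powR_gt0//.
    by rewrite ge0_ler_powR ?nnegrE ?norm_le_enorm ?addr_ge0 ?enorm_ge0// ltW.
  have A0 : 0 <= A by rewrite /A.
  have B0 : 0 <= B by rewrite /B.
  by split; apply: le_trans h2; apply: le_trans h; rewrite ?lerDl ?lerDr.
Qed.

(** For an increment of size s, the side of q, and distance s N 2^i, kernel regularity gives s^eps
    (s N 2^i)^(-n-eps); this is that bound with the factor N^(-eps) <= 1 dropped. *)
Definition wcoef (eps : R) (N : nat) q (i : nat) : R :=
  (side R q.1 * (N * 2 ^ i)%:R) ^- n * (2 `^ (- eps)) ^+ i.

(* Up to a constant, the decay of K x y - K x z for x, z in the cell q and y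
   outside [dil N q], as a sum over the dyadic shells around q. *)
Definition weight (eps : R) (N : nat) q y : \bar R :=
  (\sum_(i <oo) (wcoef eps N q i * \1_(dil (N * 2 ^ i.+1) q) y)%:E)%E.

Lemma wcoef_ge0 eps N q i : 0 <= wcoef eps N q i.
Proof.
rewrite /wcoef mulr_ge0 ?exprn_ge0 ?powR_ge0// invr_ge0 exprn_ge0// mulr_ge0//.
by rewrite ltW// side_gt0.
Qed.

Let term_ge0 eps N q i y :
  (0 <= (wcoef eps N q i * \1_(dil (N * 2 ^ i.+1) q) y)%:E)%E.
Proof. by rewrite lee_fin mulr_ge0// wcoef_ge0. Qed.

Lemma weight_ge0 eps N q y : (0 <= weight eps N q y)%E.
Proof. exact: nneseries_ge0. Qed.

Lemma weight_ge_term eps N q i y : dil (N * 2 ^ i.+1) q y ->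
  ((wcoef eps N q i)%:E <= weight eps N q y)%E.
Proof.
move=> h; rewrite /weight (@nneseriesD1 _ _ i)//.
by rewrite indicE mem_set// mulr1 leeDl// nneseries_ge0.
Qed.

Lemma measurable_weight eps N q : measurable_fun setT (weight eps N q).
Proof.
rewrite (_ : weight _ _ _ = fun y => (\sum_(i <oo | i \in xpredT)
    (wcoef eps N q i * \1_(dil (N * 2 ^ i.+1) q) y)%:E)%E)//.
apply: ge0_emeasurable_sum => // i _; apply/measurable_EFinP.
apply: measurable_funM => //; apply: measurable_indic; exact: measurable_dil.
Qed.

Lemma shell N q y : (0 < N)%N -> ~ dil N q y ->
  exists i, dil (N * 2 ^ i.+1) q y /\ ~ dil (N * 2 ^ i) q y.
Proof.
move=> N0 nN.
have ex : exists i, `[< dil (N * 2 ^ i) q y >].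
  have [M hM] := dil_exhaust q.1 q.2 y; exists M; apply/asboolP.
  apply: (@dil_sub R n M); last by case: q nN hM.
  by rewrite (leq_trans (ltnW (ltn_expl M (isT : (1 < 2)%N))))// leq_pmull.
have [i /asboolP hi imin] := ex_minnP ex.
case: i hi imin => [|i] hi imin; first by move: hi; rewrite muln1.
by exists i; split=> // /asboolP /imin; rewrite ltnn.
Qed.

Let powR_shell eps k (M : R) : 0 < M ->
  side R k `^ eps * (M * side R k) `^ (- n%:R - eps) =
  (side R k * M) ^- n * M `^ (- eps).
Proof.
move=> M0; have s0 := side_gt0 R k; set s := side R k in s0 *.
have sM0 : 0 < s * M by rewrite mulr_gt0.
rewrite [M * s]mulrC (@powRD _ (s * M) (- n%:R) (- eps)); last first.
  by apply/implyP => _; rewrite gt_eqF.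
rewrite (@powRN _ (s * M) n%:R) powR_mulrn ?(ltW sM0)//.
rewrite powRM ?ltW// mulrCA; congr (_ * _).
by rewrite (@powRN _ s eps) mulrA mulfV ?mul1r// gt_eqF// powR_gt0.
Qed.

Section bounds.
Variables (K : 'rV[R]_n -> 'rV[R]_n -> R) (eps CK : R).
Hypothesis HK : sup_kernel K eps CK.
Variable N : nat.
Hypothesis N2n : (2 * n < N)%N.

Lemma kernel_weight q x y : cell q x -> ~ dil N q y ->
  (`|K x y - K (corner R q) y|%:E <= CK%:E * weight eps N q y)%E /\
  (`|K y x - K y (corner R q)|%:E <= CK%:E * weight eps N q y)%E.
Proof.
case: HK => eps0 CK0 _ Kreg qx qy.
have N0 : (0 < N)%N by exact: leq_trans N2n.
have [i [hi nhi]] := shell N0 qy.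
have s0 := side_gt0 R q.1.
pose M : R := (N * 2 ^ i)%:R.
have M0 : 0 < M by rewrite ltr0n muln_gt0 N0 expn_gt0.
have My : M * side R q.1 <= `|y - corner R q| by exact: ndil_dist.
have key : CK * `|x - corner R q| `^ eps * `|y - corner R q| `^ (- n%:R - eps)
    <= CK * wcoef eps N q i.
  rewrite -mulrA ler_wpM2l//.
  apply: (@le_trans _ _ (side R q.1 `^ eps * (M * side R q.1) `^ (- n%:R - eps))).
    rewrite ler_pM ?powR_ge0//.
      by rewrite ge0_ler_powR ?nnegrE ?cell_dist// ltW.
    have Ms : 0 < M * side R q.1 by rewrite mulr_gt0.
    rewrite -opprD !powRN lef_pV2 ?posrE ?powR_gt0//; last exact: lt_le_trans My.
    by rewrite ge0_ler_powR ?nnegrE ?addr_ge0// ltW.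
  rewrite powR_shell// /wcoef ler_wpM2l ?invr_ge0 ?exprn_ge0 ?mulr_ge0 ?(ltW M0) ?(ltW s0)//.
  have -> : (2 `^ (- eps)) ^+ i = (2 ^+ i) `^ (- eps) :> R.
    by rewrite -!powR_mulrn ?powR_ge0// -!powRrM mulrC.
  rewrite (@powRN _ M) (@powRN _ (2 ^+ i)) lef_pV2 ?posrE ?powR_gt0 ?exprn_gt0//.
  rewrite ge0_ler_powR ?nnegrE ?exprn_ge0 ?(ltW M0) ?(ltW eps0)//.
  by rewrite -natrX ler_nat leq_pmull.
(* The single use of N > 2n: the displacement from the corner is at most one side, the distance to y
   at least N sides. *)
have hz : 2 * n%:R * `|x - corner R q| < `|y - corner R q|.
  apply: (@le_lt_trans _ _ ((2 * n)%:R * side R q.1)).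
    by rewrite natrM ler_wpM2l// cell_dist.
  apply: lt_le_trans My; rewrite ltr_pM2r// ltr_nat.
  by rewrite (leq_trans N2n)// leq_pmulr// expn_gt0.
have le_w := weight_ge_term eps hi.
have fin (a : R) : a <= CK * wcoef eps N q i -> (a%:E <= CK%:E * weight eps N q y)%E.
  move=> a_le; apply: (@le_trans _ _ (CK%:E * (wcoef eps N q i)%:E)%E).
    by rewrite -EFinM lee_fin.
  by rewrite lee_wpmul2l.
split; apply: fin; apply: le_trans key.
  have := (Kreg (corner R q) y (x - corner R q)).
  by rewrite [`|corner R q - y|]distrC subrKC => /(_ hz)[].
have := (Kreg y (corner R q) (x - corner R q) hz).
by rewrite subrKC => -[].
Qed.

End bounds.

(** 5^n bounds the volume of the i-th dilate against (side N 2^i)^n, as 4 N 2^i + 1 <= 5 N 2^i; the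
    denominator sums the geometric series of ratio 2^(-eps). *)
Definition Cweight (eps : R) : R := 5 ^+ n / (1 - 2 `^ (- eps)).

Lemma ratio_lt1 (eps : R) : 0 < eps -> 0 < (2 : R) `^ (- eps) < 1.
Proof.
move=> e0; rewrite powR_gt0//= powRN invf_lt1 ?powR_gt0//.
have : (1 : R) `^ eps < 2 `^ eps.
  by apply: gt0_ltr_powR => //; rewrite ?nnegrE ?ltr1n.
by rewrite powR1.
Qed.

(** Each shell coefficient is an inverse volume times 2^(-eps i), so bounded averages over all
    dilates leave a convergent geometric series. *)
Lemma integral_weight (eps : R) N q (h : 'rV[R]_n -> R) (B : R) :
  0 < eps -> (0 < N)%N -> measurable_fun setT h -> 0 <= B ->
  (forall i, \int[mu]_(y in dil (N * 2 ^ i.+1) q) `|h y|%:E <=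
     B%:E * mu (dil (N * 2 ^ i.+1) q))%E ->
  (\int[mu]_y (weight eps N q y * `|h y|%:E) <= (Cweight eps * B)%:E)%E.
Proof.
move=> e0 N0 mh B0 H.
have mah : measurable_fun setT (fun y => `|h y|%:E).
  by apply/measurable_EFinP; exact: measurableT_comp.
rewrite (eq_integral (fun y => \sum_(i <oo) (`|h y|%:E *
    (wcoef eps N q i * \1_(dil (N * 2 ^ i.+1) q) y)%:E)))%E; last first.
  by move=> y _; rewrite muleC -nneseriesZl.
rewrite integral_nneseries//; last 2 first.
- move=> i; apply: emeasurable_funM => //; apply/measurable_EFinP.
  apply: measurable_funM => //; apply: measurable_indic; exact: measurable_dil.
- by move=> i y _; rewrite mule_ge0// term_ge0.
have [r0 r1] := andP (ratio_lt1 e0); set r := 2 `^ (- eps) in r0 r1 *.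
apply: (@le_trans _ _ (\sum_(i <oo) (5 ^+ n * B * r ^+ i)%:E)%E).
  apply: lee_nneseries => [i _ _|i _].
    by apply: integral_ge0 => y _; rewrite mule_ge0// term_ge0.
  apply: (@le_trans _ _ ((wcoef eps N q i)%:E *
      \int[mu]_(y in dil (N * 2 ^ i.+1) q) `|h y|%:E)%E).
    rewrite [in leRHS]integral_mkcond -ge0_integralZl//; last 3 first.
    - by apply/(measurable_restrictT _ (@measurable_dil R n _ q)); exact: measurable_funTS.
    - by move=> y _; rewrite /patch; case: ifP.
    - by rewrite lee_fin wcoef_ge0.
    rewrite le_eqVlt; apply/orP; left; apply/eqP; apply: eq_integral => y _.
    rewrite /patch indicE; case: ifP => _; last by rewrite mulr0 mule0 mule0.
    by rewrite mulr1 muleC.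
  apply: (@le_trans _ _ ((wcoef eps N q i)%:E * (B%:E * mu (dil (N * 2 ^ i.+1) q)))%E).
    by rewrite lee_wpmul2l// lee_fin wcoef_ge0.
  rewrite mu_dil -!EFinM lee_fin /wcoef -/r.
  have s0 := side_gt0 R q.1; set s := side R q.1 in s0 *.
  have M0 : (0 : R) < (N * 2 ^ i)%:R by rewrite ltr0n muln_gt0 N0 expn_gt0.
  rewrite [leRHS](_ : _ = (5 ^+ n * (s * (N * 2 ^ i)%:R) ^+ n) *
      ((s * (N * 2 ^ i)%:R) ^- n * r ^+ i * B)); last first.
    have : (s * (N * 2 ^ i)%:R) ^+ n != 0 by rewrite expf_neq0// gt_eqF// mulr_gt0.
    by move: (_ ^+ n) => t t0; move: (_ ^+ i) (_ ^+ n) => u v; field.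
  rewrite mulrA [leRHS]mulrC ler_wpM2l//.
    by rewrite !mulr_ge0 ?invr_ge0 ?exprn_ge0 ?mulr_ge0 ?(ltW s0) ?(ltW r0).
  rewrite -exprMn lerXn2r ?nnegrE ?mulr_ge0 ?(ltW s0)//.
  rewrite [5 * _]mulrCA mulrC ler_wpM2l ?(ltW s0)// -natrM ler_nat.
  have : (0 < N * 2 ^ i)%N by rewrite muln_gt0 N0 expn_gt0.
  by rewrite expnS; lia.
apply: lime_le; first by apply: is_cvg_nneseries => i _ _; rewrite lee_fin !mulr_ge0 ?exprn_ge0// ltW.
apply: nearW => m; rewrite sumEFin lee_fin.
have : \sum_(0 <= k < m) 5 ^+ n * B * r ^+ k <= 5 ^+ n * B / (1 - r).
  apply: (@geometric_le_lim R m (5 ^+ n * B) r) => //.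
  - by rewrite mulr_ge0// exprn_ge0.
  - by rewrite ger0_norm// ltW.
by rewrite /Cweight mulrAC.
Qed.

End kernel.

(** * Square integrable functions and the operator *)

Section square_integrable.
Context d (T : measurableType d) (R : realType).
Variable mu : {measure set T -> \bar R}.
Local Open Scope ereal_scope.
Implicit Types (f g : T -> R) (A : set T).

Definition sqnorm f : \bar R := \int[mu]_x (f x ^+ 2)%:E.

Lemma measurable_sq f : measurable_fun setT f ->
  measurable_fun setT (fun x => (f x ^+ 2)%:E).
Proof. by move=> mf; apply/measurable_EFinP; exact: measurable_funX. Qed.

Lemma measurable_absE f : measurable_fun setT f ->
  measurable_fun setT (fun x => `|f x|%:E).
Proof. by move=> mf; apply/measurable_EFinP; exact: measurableT_comp. Qed.

Lemma sqE_ge0 f x : 0 <= (f x ^+ 2)%:E.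
Proof. by rewrite lee_fin sqr_ge0. Qed.

Lemma absE_ge0 f x : 0 <= `|f x|%:E.
Proof. by rewrite lee_fin. Qed.

Lemma sqnorm_ge0 f : 0 <= sqnorm f.
Proof. by apply: integral_ge0 => x _; exact: sqE_ge0. Qed.

Lemma Lnorm2 f : 'N[mu]_2%:E[EFin \o f] = sqnorm f `^ 2^-1.
Proof.
rewrite unlock /Lnorm; congr (_ `^ _); apply: eq_integral => x _.
by rewrite /= powR_mulrn// -normrX ger0_norm// sqr_ge0.
Qed.

Lemma L2P f : (f \in Lfun mu 2%:E) <-> measurable_fun setT f /\ sqnorm f < +oo.
Proof.
split=> [/andP[mf /[!inE]/= lf]|[mf lf]].
  split; first by rewrite inE in mf.
  by move: lf; rewrite /finite_norm Lnorm2; apply: lty_poweRy; rewrite invr_eq0.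
apply/andP; split; first by rewrite inE.
by rewrite inE /= /finite_norm Lnorm2 poweR_lty.
Qed.

Lemma L2_meas f : f \in Lfun mu 2%:E -> measurable_fun setT f.
Proof. by move=> /L2P[]. Qed.

Lemma L2_le f g (c : R) : g \in Lfun mu 2%:E -> measurable_fun setT f ->
  (forall x, (f x ^+ 2 <= c * g x ^+ 2)%R) -> f \in Lfun mu 2%:E.
Proof.
move=> /L2P[mg lg] mf fg; apply/L2P; split=> //.
apply: (@le_lt_trans _ _ (\int[mu]_x (`|c|%:E * (g x ^+ 2)%:E))).
  apply: ge0_le_integral => //.
  - by move=> x _; exact: sqE_ge0.
  - exact: measurable_sq.
  - by apply: emeasurable_funM => //; exact: measurable_sq.
  - move=> x _; rewrite -EFinM lee_fin (le_trans (fg x))// ler_wpM2r ?sqr_ge0//.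
    exact: ler_norm.
rewrite ge0_integralZl//; first by rewrite lte_mul_pinfty.
- exact: measurable_sq.
- by move=> x _; exact: sqE_ge0.
Qed.

Lemma L2_lin f g (a : R) : f \in Lfun mu 2%:E -> g \in Lfun mu 2%:E ->
  (fun x => (a * f x + g x)%R) \in Lfun mu 2%:E.
Proof.
move=> /L2P[mf lf] /L2P[mg lg]; apply/L2P.
have mafg : measurable_fun setT (fun x => (a * f x + g x)%R).
  by apply: measurable_funD => //; apply: measurable_funM.
split=> //.
apply: (@le_lt_trans _ _
   (\int[mu]_x ((2 * a ^+ 2)%:E * (f x ^+ 2)%:E + 2%:E * (g x ^+ 2)%:E))).
  apply: ge0_le_integral => //.
  - by move=> x _; rewrite lee_fin sqr_ge0.
  - exact: measurable_sq.
  - apply: emeasurable_funD; apply: emeasurable_funM => //; exact: measurable_sq.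
  - move=> x _; rewrite -!EFinM -EFinD lee_fin.
    have : (0 <= (a * f x - g x) ^+ 2)%R by exact: sqr_ge0.
    rewrite !expr2; lra.
have a0 : (0 <= 2 * a ^+ 2)%R by rewrite mulr_ge0// sqr_ge0.
rewrite ge0_integralD//; first last.
- by apply: emeasurable_funM => //; exact: measurable_sq.
- by move=> x _; rewrite mule_ge0// sqE_ge0.
- by apply: emeasurable_funM => //; exact: measurable_sq.
- by move=> x _; rewrite mule_ge0// ?sqE_ge0.
rewrite !ge0_integralZl//; first last.
- by move=> x _; rewrite sqE_ge0.
- exact: measurable_sq.
- by move=> x _; rewrite sqE_ge0.
- exact: measurable_sq.
by rewrite lte_add_pinfty// lte_mul_pinfty.
Qed.

Lemma L2_0 : (fun=> 0%R) \in Lfun mu 2%:E.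
Proof.
by apply/L2P; split=> //; rewrite /sqnorm integral0_eq// => x _; rewrite expr0n.
Qed.

Lemma L2_mull f (a : R) : f \in Lfun mu 2%:E ->
  (fun x => (a * f x)%R) \in Lfun mu 2%:E.
Proof.
move=> Lf; rewrite (_ : (fun x => _) = fun x => (a * f x + (fun=> 0) x)%R).
  exact: L2_lin Lf L2_0.
by apply/funext => x; rewrite addr0.
Qed.

Lemma L2_sum (I : Type) (s : seq I) (F : I -> T -> R) :
  (forall i, F i \in Lfun mu 2%:E) ->
  (fun y => \sum_(i <- s) F i y)%R \in Lfun mu 2%:E.
Proof.
move=> LF; elim: s => [|i s IH].
  rewrite (_ : (fun y => _) = fun=> 0%R); first exact: L2_0.
  by apply/funext => y; rewrite big_nil.
rewrite (_ : (fun y => _) = fun y => (1 * F i y + (fun y => \sum_(i <- s) F i y) y)%R).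
  exact: L2_lin.
by apply/funext => y; rewrite big_cons mul1r.
Qed.

Lemma L2_indic A : measurable A -> mu A < +oo -> \1_A \in Lfun mu 2%:E.
Proof.
move=> mA Aoo; apply/L2P; split; first exact: measurable_indic.
rewrite /sqnorm (eq_integral (fun x => (\1_A x)%:E)); last first.
  by move=> x _; rewrite indicE; case: (_ \in _); rewrite ?expr1n ?expr0n.
by rewrite integral_indic// setIT.
Qed.

Lemma L2_mulI f A : f \in Lfun mu 2%:E -> measurable A ->
  (fun x => (f x * \1_A x)%R) \in Lfun mu 2%:E.
Proof.
move=> Lf mA; apply: (L2_le (c := 1) Lf).
  by apply: measurable_funM; [exact: L2_meas|exact: measurable_indic].
move=> x; rewrite mul1r indicE; case: (_ \in _); rewrite ?mulr1 ?mulr0//.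
by rewrite expr0n/= sqr_ge0.
Qed.

Lemma L2_integrable f A : f \in Lfun mu 2%:E -> measurable A -> mu A < +oo ->
  mu.-integrable A (EFin \o f).
Proof.
move=> /L2P[mf lf] mA Aoo; apply/integrableP; split.
  by apply/measurable_EFinP; exact: measurable_funTS.
apply: (@le_lt_trans _ _ (\int[mu]_(x in A) ((f x ^+ 2)%:E + 1))).
  apply: ge0_le_integral => //.
  - by apply: measurable_funTS; exact: measurable_absE.
  - by apply: measurable_funTS; apply: emeasurable_funD => //; exact: measurable_sq.
  - move=> x _ /=; rewrite -EFinD lee_fin.
    have : (0 <= (`|f x| - 1) ^+ 2)%R by exact: sqr_ge0.
    have -> : (f x ^+ 2 = `|f x| ^+ 2)%R by rewrite real_normK// num_real.
    have : (0 <= `|f x|)%R by [].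
    by rewrite !expr2; lra.
rewrite ge0_integralD//; last 2 first.
- by move=> x _; exact: sqE_ge0.
- by apply: measurable_funTS; exact: measurable_sq.
rewrite integral_cst// mul1e lte_add_pinfty//.
apply: le_lt_trans lf; apply: ge0_subset_integral => //; first exact: measurable_sq.
by move=> x _; exact: sqE_ge0.
Qed.

Lemma markov_set A (f : T -> \bar R) (t : R) : measurable A ->
  measurable_fun setT f -> (forall x, 0 <= f x) -> (0 <= t)%R ->
  (forall x, A x -> t%:E <= f x) -> t%:E * mu A <= \int[mu]_(x in A) f x.
Proof.
move=> mA mf f0 t0 H; rewrite -integral_cst//.
by apply: ge0_le_integral => //; exact: measurable_funTS.
Qed.

Lemma markov_setT A (f : T -> \bar R) (t : R) : measurable A ->
  measurable_fun setT f -> (forall x, 0 <= f x) -> (0 <= t)%R ->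
  (forall x, A x -> t%:E <= f x) -> t%:E * mu A <= \int[mu]_x f x.
Proof.
move=> mA mf f0 t0 H; apply: (le_trans (markov_set mA mf f0 t0 H)).
exact: ge0_subset_integral.
Qed.

Lemma measurable_gt f (t : R) : measurable_fun setT f ->
  measurable [set x | (t < `|f x|)%R].
Proof.
move=> mf; rewrite (_ : [set x | _] = (fun x => `|f x|%R) @^-1` `]t, +oo[).
  have mg : measurable_fun setT (fun x => `|f x|%R) by exact: measurableT_comp.
  by rewrite -[X in measurable X]setTI; exact: mg.
by apply/seteqP; split=> x /=; rewrite in_itv/= andbT.
Qed.

(** The device that picks comparison points: it turns almost-sure bounds into bounds at one actual
    point avoiding an exceptional set. *)
Lemma ae_exists (P : T -> Prop) A E : {ae mu, forall x, P x} ->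
  measurable A -> measurable E -> mu (A `&` E) < mu A ->
  exists x, [/\ A x, ~ E x & P x].
Proof.
move=> [N [mN N0 HN]] mA mE AE; apply: contrapT => /forallNP H.
move: AE; apply/negP; rewrite -leNgt.
apply: (@le_trans _ _ (mu ((A `&` E) `|` N))).
  apply: le_measure; rewrite ?inE//.
    by apply: measurableU => //; exact: measurableI.
  move=> x Ax; have [Ex|nE] := pselect (E x); first by left.
  by right; apply: HN => /= Px; apply: (H x).
apply: (le_trans (measureU2 _ _ _)) => //; first exact: measurableI.
rewrite -[leRHS]adde0; apply: leeD => //.
by rewrite le_eqVlt; apply/orP; left; apply/eqP; exact: N0.
Qed.

(** Intersecting exceptional sets of measure at most 1/(k+1) leaves a null set. Smallness in measure
    thus yields an almost-everywhere bound without extracting subsequences. *)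
Lemma ae_of_small A (P : T -> Prop) :
  (forall e : R, (0 < e)%R -> exists E, [/\ measurable E, mu E <= e%:E &
     {ae mu, forall x, A x -> ~ E x -> P x}]) ->
  {ae mu, forall x, A x -> P x}.
Proof.
move=> H.
have /choice[E HE] : forall k : nat, exists E, [/\ measurable E, mu E <= (k.+1%:R^-1)%:E &
     {ae mu, forall x, A x -> ~ E x -> P x}].
  by move=> k; apply: H.
have mE k : measurable (E k) by case: (HE k).
have aeE : {ae mu, forall x k, A x -> ~ E k x -> P x}.
  by apply: ae_foralln => k; case: (HE k).
have : mu.-negligible (\bigcap_k E k).
  exists (\bigcap_k E k); split => //; first exact: bigcapT_measurable.
  apply/eqP; rewrite eq_le measure_ge0 andbT; apply/lee_addgt0Pr => e e0.
  rewrite add0e; pose k := Num.bound e^-1.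
  apply: (@le_trans _ _ (mu (E k))).
    by apply: le_measure; rewrite ?inE//; [exact: bigcapT_measurable|exact: bigcap_inf].
  have [_ h _] := HE k; apply: (le_trans h); rewrite lee_fin.
  rewrite invf_ple ?posrE// (@le_trans _ _ k%:R)%R ?ler_nat//.
  by apply: ltW; apply: le_lt_trans (archi_boundP _) => //; rewrite invr_ge0 ltW.
move=> negl; apply: (@negligibleS _ _ _ _ (~` [set x | forall k, A x -> ~ E k x -> P x] `|`
    \bigcap_k E k)); last exact: negligibleU.
move=> x /= nP; have [h|h] := pselect (forall k, A x -> ~ E k x -> P x); last by left.
right => k _; apply: contrapT => nE; apply: nP => Ax; exact: (h k).
Qed.

End square_integrable.

(** * Consequences of the L^2 bound *)

Section operator.
Context (R : realType) (n : nat).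
Local Open Scope ereal_scope.
Local Notation mu := (lebesgue_rV R n).
Local Notation L2 := (Lfun mu 2%:E).
Variable T : ('rV[R]_n -> R) -> 'rV[R]_n -> R.
Hypothesis HT : L2_bounded_linear T.

Lemma T_L2 f : f \in L2 -> T f \in L2.
Proof. by case: HT => H _ _; exact: H. Qed.

Lemma T_meas f : f \in L2 -> measurable_fun setT (T f).
Proof. by move=> /T_L2/L2_meas. Qed.

Lemma T_bound : exists M : R, (0 <= M)%R /\
  forall f, f \in L2 -> sqnorm mu (T f) <= M%:E * sqnorm mu f.
Proof.
case: HT => _ _ [m H]; exists (m ^+ 2)%R; split; first exact: sqr_ge0.
move=> f Lf; have /L2P[_ Tfoo] := T_L2 Lf; have /L2P[_ foo] := Lf.
have := H f Lf; rewrite !Lnorm2.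
have fin g : sqnorm mu g < +oo -> sqnorm mu g = (fine (sqnorm mu g))%:E.
  by move=> h; rewrite fineK// ge0_fin_numE// sqnorm_ge0.
have ge0 g : (0 <= fine (sqnorm mu g))%R by rewrite fine_ge0// sqnorm_ge0.
rewrite (fin _ foo) (fin _ Tfoo) !poweR_EFin -!EFinM !lee_fin.
rewrite !powR12_sqrt// => h.
rewrite -[leLHS]sqr_sqrtr// -[X in (_ * X)%R]sqr_sqrtr// -exprMn.
by rewrite -ler_sqrt ?sqr_ge0// !sqrtr_sqr ger0_norm ?sqrtr_ge0// (le_trans h)// ler_norm.
Qed.

(** Chebyshev on the square of [T f]; the quantitative L^2 bound serves below only in this form. *)
Lemma T_cheb : exists M : R, (0 <= M)%R /\ forall f (t : R), f \in L2 -> (0 <= t)%R ->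
  (t ^+ 2)%:E * mu [set x | (t < `|T f x|)%R] <= M%:E * sqnorm mu f.
Proof.
have [M [M0 HM]] := T_bound; exists M; split=> // f t Lf t0.
apply: le_trans (HM f Lf).
apply: markov_setT.
- exact: measurable_gt (T_meas Lf).
- exact: measurable_sq (T_meas Lf).
- by move=> x; exact: sqE_ge0.
- exact: sqr_ge0.
move=> x /= h; rewrite lee_fin -[leRHS]real_normK ?num_real//.
by rewrite lerXn2r ?nnegrE// ltW.
Qed.

Lemma T_lin (a : R) f g : f \in L2 -> g \in L2 ->
  {ae mu, forall x, T (fun y => a * f y + g y)%R x = (a * T f x + T g x)%R}.
Proof. by move=> Lf Lg; case: HT => _ H _; exact: H. Qed.

Lemma T_add f g : f \in L2 -> g \in L2 ->
  {ae mu, forall x, T (fun y => f y + g y)%R x = (T f x + T g x)%R}.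
Proof.
move=> Lf Lg; have := T_lin 1 Lf Lg.
rewrite (_ : (fun y => _) = (fun y => f y + g y)%R); last by apply/funext => y; rewrite mul1r.
by apply: filterS => x ->; rewrite mul1r.
Qed.

(** The level sets above 1/(k+1) are null by Chebyshev. As [T] sees functions and not classes, this
    is also what discards functions vanishing almost everywhere and starts the induction for finite
    sums. *)
Lemma T_ae0 f : f \in L2 -> sqnorm mu f = 0 -> {ae mu, forall x, T f x = 0%R}.
Proof.
move=> Lf f0; have [M [_ HM]] := T_cheb.
suff : {ae mu, forall x, True -> T f x = 0%R} by apply: filterS => x /(_ I).
have h k : mu [set x | (k.+1%:R^-1 < `|T f x|)%R] = 0.
  have := HM f k.+1%:R^-1%R Lf; rewrite f0 mule0 invr_ge0 => /(_ (ler0n _ _)) h.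
  have /eqP : ((k.+1%:R^-1 : R) ^+ 2)%:E * mu [set x | (k.+1%:R^-1 < `|T f x|)%R] = 0.
    by apply/eqP; rewrite eq_le h mule_ge0// lee_fin sqr_ge0.
  rewrite mule_eq0 => /orP[|/eqP//].
  by rewrite eqe expf_eq0/= invr_eq0 pnatr_eq0.
have hk : {ae mu, forall x k, ~ (k.+1%:R^-1 < `|T f x|)%R}.
  apply: ae_foralln => k; exists [set x | (k.+1%:R^-1 < `|T f x|)%R]; split.
  - exact: measurable_gt (T_meas Lf).
  - exact: h.
  - by move=> x /= /contrapT.
apply: filterS hk => x hx _; apply/eqP; rewrite -normr_eq0; apply: contrapT => /negP Tn0.
have Tpos : (0 < `|T f x|)%R by rewrite lt0r Tn0/=.
apply: (hx (Num.bound `|T f x|^-1)).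
rewrite invf_plt ?posrE// (@lt_le_trans _ _ (Num.bound `|T f x|^-1)%:R)%R ?ler_nat//.
by apply: le_lt_trans (archi_boundP _) => //; rewrite invr_ge0 ltW.
Qed.

Lemma T_sum (I : Type) (s : seq I) (F : I -> 'rV[R]_n -> R) :
  (forall i, F i \in L2) ->
  {ae mu, forall x, T (fun y => \sum_(i <- s) F i y)%R x = (\sum_(i <- s) T (F i) x)%R}.
Proof.
move=> LF; elim: s => [|i s IH].
  rewrite (_ : (fun y => _) = fun=> 0%R); last by apply/funext => y; rewrite big_nil.
  have := @T_ae0 _ (L2_0 mu); rewrite /sqnorm integral0_eq => [/(_ erefl)|x _]; last first.
    by rewrite expr0n.
  by apply: filterS => x ->; rewrite big_nil.
rewrite (_ : (fun y => _) = fun y => (F i y + (fun y => \sum_(i <- s) F i y) y)%R); last first.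
  by apply/funext => y; rewrite big_cons.
have := T_add (LF i) (L2_sum s LF); apply: filterS2 IH => x h1 ->.
by rewrite big_cons h1.
Qed.

End operator.

Lemma continuous_dist (R : realType) (n : nat) (c : 'rV[R]_n) :
  continuous (fun y : 'rV[R]_n => `|y - c|).
Proof.
move=> y; apply: (@continuous_comp _ _ _ (fun y : 'rV[R]_n => y - c) Num.norm).
  by apply: continuousB; [exact: id|exact: cst_continuous].
exact: norm_continuous.
Qed.

Lemma closed_dist_le (R : realType) (n : nat) (c : 'rV[R]_n) (r : R) :
  closed [set y | `|y - c| <= r].
Proof.
rewrite (_ : [set y | _] = (fun y => `|y - c|) @^-1` [set t | t <= r])//.
by apply: closed_comp; [move=> y _; exact: continuous_dist|exact: closed_le].
Qed.

Lemma closed_dist_ge (R : realType) (n : nat) (c : 'rV[R]_n) (r : R) :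
  closed [set y | r <= `|y - c|].
Proof.
rewrite (_ : [set y | _] = (fun y => `|y - c|) @^-1` [set t | r <= t])//.
by apply: closed_comp; [move=> y _; exact: continuous_dist|exact: closed_ge].
Qed.

(** * Representation of T by its kernel on separated sets *)

Section kernel_operator.
Context (R : realType) (n : nat).
Local Notation mu := (lebesgue_rV R n).
Local Notation L2 := (Lfun mu 2%:E).
Local Notation "'rv'" := ('rV[R]_n).
Variables (T : (rv -> R) -> rv -> R) (K : rv -> rv -> R).
Hypothesis HT : L2_bounded_linear T.
Hypothesis HTK : associated_kernel T K.
Variables (eps CK : R).
Hypothesis HK : sup_kernel K eps CK.
Variable N : nat.
Implicit Types (x y : rv) (q : int * 'rV[int]_n).
Hypothesis N2n : (2 * n < N)%N.
Hypothesis N1 : (1 < N)%N.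

Let CK0 : 0 <= CK. Proof. by case: HK. Qed.
Let eps0 : 0 < eps. Proof. by case: HK. Qed.

(** Regularity in the second variable makes [K x] continuous away from x. Its measurability there,
    which is not part of the kernel hypotheses, follows. *)
Lemma kernel_open x a : open [set y | x != y /\ a < K x y].
Proof.
rewrite openE => y [xy ay]; apply/nbhs_ballP.
have d0 : 0 < `|x - y| by rewrite normr_gt0 subr_eq0.
pose c := CK * `|x - y| `^ (- n%:R - eps) + 1.
have c0 : 0 < c by rewrite ltr_wpDl// mulr_ge0// powR_ge0.
pose t := (K x y - a) / c.
have t0 : 0 < t by rewrite divr_gt0// subr_gt0.
(* The first term keeps the variation of K below K x y - a; the second ensures the smallness
   condition and keeps z different from x. *)
pose d := Num.min (t `^ eps^-1) (`|x - y| / (2 * n%:R + 1)).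
have n0 : (0 : R) < 2 * n%:R + 1 by rewrite ltr_wpDl// mulr_ge0.
have dpos : 0 < d by rewrite lt_min powR_gt0//= divr_gt0.
exists d => // z; rewrite mx_norm_ball /ball_/= => yz.
have zd : `|z - y| < d by rewrite distrC.
have z1 : `|z - y| `^ eps <= t.
  have -> : t = (t `^ eps^-1) `^ eps by rewrite -powRrM mulVf ?gt_eqF// powRr1// ltW.
  rewrite ge0_ler_powR ?nnegrE ?powR_ge0//; first exact: ltW.
  by rewrite ltW// (lt_le_trans zd)// /d ge_min lexx.
have z2 : (2 * n%:R + 1) * `|z - y| < `|x - y|.
  rewrite mulrC -ltr_pdivlMr// (lt_le_trans zd)// /d ge_min lexx orbT//.
have z3 : 2 * n%:R * `|z - y| < `|x - y|.
  by apply: le_lt_trans z2; rewrite ler_wpM2r// lerDl.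
split.
  apply/eqP => xz; move: z2; rewrite xz ltNge ler_peMl//.
  by rewrite lerDr mulr_ge0.
case: HK => _ _ _ /(_ x y (z - y) z3)[_]; rewrite subrKC => h.
have h2 : CK * `|z - y| `^ eps * `|x - y| `^ (- n%:R - eps) < K x y - a.
  apply: (@le_lt_trans _ _ ((CK * `|x - y| `^ (- n%:R - eps)) * t)).
    by rewrite mulrAC ler_wpM2l// mulr_ge0// powR_ge0.
  have -> : K x y - a = c * t by rewrite /t mulrCA mulfV ?mulr1// gt_eqF.
  by rewrite ltr_pM2r// /c ltrDl.
have := le_lt_trans h h2; rewrite ltr_norml => /andP[]; lra.
Qed.

Lemma measurable_CZ_kernel x : measurable_fun [set y | x != y] (K x).
Proof.
apply: (measurability _ (RGenOInfty.measurableE R)) => _ [_ [a ->] <-].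
apply: (@rV_open_measurable R n).
rewrite (_ : _ `&` _ = [set y | x != y /\ a < K x y]); first exact: kernel_open.
by apply/seteqP; split=> y /=; rewrite in_itv/= andbT.
Qed.

Lemma cell_ndil_dist q x y : cell q x -> ~ dil N q y -> side R q.1 <= `|x - y|.
Proof.
move=> /cell_dist hx /ndil_dist hy.
have := le_trans hy (ler_distD x y (corner R q)) => h.
have : 2 * side R q.1 <= N%:R * side R q.1.
  by rewrite ler_pM2r ?side_gt0// ler_nat.
by move: h hx; rewrite [`|y - x|]distrC; lra.
Qed.

Lemma kernel_integrable (s : R) x (h : rv -> R) : 0 < s ->
  mu.-integrable setT (EFin \o h) -> (forall y, h y != 0 -> s <= `|x - y|) ->
  mu.-integrable setT (EFin \o (fun y => K x y * h y)).
Proof.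
move=> s0 ih hs; have mh : measurable_fun setT h.
  by apply/measurable_EFinP; case/integrableP: ih.
(* The value of K on the diagonal is uncontrolled but meets only a zero of h, so it may be replaced
   by 0. *)
have E : (fun y => K x y * h y) = (fun y => (K x \_ [set y | x != y]) y * h y).
  apply/funext => y; rewrite patchE; case: ifPn => //; rewrite notin_setE/= => /negP.
  rewrite negbK => /eqP <-; have [->|/hs] := eqVneq (h x) 0; first by rewrite !mulr0.
  by rewrite subrr normr0 leNgt s0.
have mxy : measurable [set y | x != y].
  apply: rV_open_measurable; rewrite (_ : [set y | _] = ~` [set y | `|y - x| <= 0]).
    by rewrite openC; exact: closed_dist_le.
  apply/seteqP; split => y /=; rewrite normr_le0 subr_eq0 eq_sym.
    by move/negP.
  by move/negP.
have mK : measurable_fun setT (fun y => K x y * h y).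
  rewrite E; apply: measurable_funM => //.
  by apply/(measurable_restrictT _ mxy); exact: measurable_CZ_kernel.
apply: (le_integrable measurableT _ _
    (integrableZl measurableT (CK * s ^- n) ih)).
  exact/measurable_EFinP.
move=> y _ /=; rewrite lee_fin !normrM.
have [->|hy] := eqVneq (h y) 0; first by rewrite normr0 !mulr0.
have sxy := hs _ hy; have xy0 := lt_le_trans s0 sxy.
rewrite ler_wpM2r// -normrM; apply: le_trans (ler_norm _).
case: HK => _ _ /(_ x y) hK _; apply: (le_trans (hK _)).
  by rewrite -subr_eq0 -normr_gt0.
rewrite ler_wpM2l// lef_pV2 ?posrE ?exprn_gt0// lerXn2r ?nnegrE// ltW//.
Qed.

Lemma bounded_support_compact M q (h : rv -> R) :
  (forall y, ~ dil M q y -> h y = 0) -> compact (closure [set y | h y != 0]).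
Proof.
move=> hM; apply: bounded_closed_compact; last exact: closed_closure.
pose r := M.+1%:R * side R q.1.
have sub : closure [set y | h y != 0] `<=` [set y | `|y - corner R q| <= r].
  rewrite [X in _ `<=` X]((closure_id _).1 (@closed_dist_le R n _ _)).
  apply: closure_subset => y /= /eqP hy; apply: dil_dist.
  by apply: contrapT => /hM.
exists (`|corner R q| + r); split; first exact: num_real.
move=> t rt y /sub /= hy; apply: le_trans (ltW rt).
by rewrite -[y](subrK (corner R q)) (le_trans (ler_normD _ _))// addrC lerD2l.
Qed.

(** Points of q lie within one side of the corner, while the closure of the support of h stays at
    least N > 1 sides away; so x is off the closed support, as the representation demands. *)
Lemma T_kernel_off q (h : rv -> R) M : h \in L2 ->
  (forall y, dil N q y -> h y = 0) -> (forall y, ~ dil M q y -> h y = 0) ->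
  {ae mu, forall x, cell q x -> T h x = \int[mu]_y (K x y * h y)}.
Proof.
move=> Lh h0 hM; have := HTK Lh (bounded_support_compact hM).
apply: filterS => x H qx; apply: H => cl.
have /= h1 : [set y | N%:R * side R q.1 <= `|y - corner R q|] x.
  rewrite ((closure_id _).1 (@closed_dist_ge R n _ _)).
  apply: closure_subset cl => y /= /eqP hy.
  by apply: ndil_dist => /h0.
have h2 := le_trans h1 (cell_dist qx).
have := side_gt0 R q.1; move: h2; rewrite -[leRHS]mul1r ler_pM2r ?side_gt0// lern1.
by rewrite leqNgt N1.
Qed.

Lemma T_kernel_out q (h : rv -> R) : h \in L2 ->
  (forall y, ~ cell q y -> h y = 0) ->
  {ae mu, forall x, ~ dil N q x -> T h x = \int[mu]_y (K x y * h y)}.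
Proof.
move=> Lh h0; have hM : forall y, ~ dil 0 q y -> h y = 0.
  by move=> y; rewrite -cell_dil0; exact: h0.
have := HTK Lh (bounded_support_compact hM).
apply: filterS => x H qx; apply: H => cl.
have /= h1 : [set y | `|y - corner R q| <= side R q.1] x.
  rewrite ((closure_id _).1 (@closed_dist_le R n _ _)).
  apply: closure_subset cl => y /= /eqP hy; apply: cell_dist.
  by apply: contrapT => /h0.
have h2 := le_trans (ndil_dist qx) h1.
move: h2; rewrite -[leRHS]mul1r ler_pM2r ?side_gt0// lern1.
by rewrite leqNgt N1.
Qed.

End kernel_operator.

Section integrals.
Context d (T : measurableType d) (R : realType).
Variable mu : {measure set T -> \bar R}.

Lemma L2_integrable_supp (h : T -> R) (A : set T) : h \in Lfun mu 2%:E ->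
  measurable A -> (mu A < +oo)%E -> (forall y, ~ A y -> h y = 0) ->
  mu.-integrable setT (EFin \o h).
Proof.
move=> Lh mA Aoo hA; have := L2_integrable Lh mA Aoo.
move/(integrable_mkcond _ mA); apply: eq_integrable => // x _.
rewrite patchE; case: ifPn => //; rewrite notin_setE => /hA /= ->//.
Qed.

Lemma Rintegral_abs_le (f : T -> R) : mu.-integrable setT (EFin \o f) ->
  (`|\int[mu]_y f y|%:E <= \int[mu]_y `|f y|%:E)%E.
Proof.
move=> intf; rewrite EFin_normr_Rintegral//.
by apply: le_abse_integral => //; case/integrableP: intf.
Qed.

End integrals.

Section kernel_operator.
Context (R : realType) (n : nat).
Local Notation mu := (lebesgue_rV R n).
Local Notation L2 := (Lfun mu 2%:E).
Local Notation "'rv'" := ('rV[R]_n).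
Variables (T : (rv -> R) -> rv -> R) (K : rv -> rv -> R).
Hypothesis HT : L2_bounded_linear T.
Hypothesis HTK : associated_kernel T K.
Variables (eps CK : R).
Hypothesis HK : sup_kernel K eps CK.
Variable N : nat.
Implicit Types (x y : rv) (q : int * 'rV[int]_n).
Hypothesis N2n : (2 * n < N)%N.
Hypothesis N1 : (1 < N)%N.

Let CK0 : 0 <= CK. Proof. by case: HK. Qed.
Let eps0 : 0 < eps. Proof. by case: HK. Qed.
Let N0 : (0 < N)%N. Proof. exact: ltn_trans N1. Qed.

(** The centre [v] is the kernel integral at the corner, not a value of [T h], which is known only
    almost everywhere. Kernel differences are dominated by [weight], whose integral against h is
    controlled by the averages of h. *)
Lemma T_osc q (h : rv -> R) M B : h \in L2 ->
  (forall y, dil N q y -> h y = 0) -> (forall y, ~ dil M q y -> h y = 0) ->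
  0 <= B ->
  (forall i, \int[mu]_(y in dil (N * 2 ^ i.+1) q) `|h y|%:E <=
     B%:E * mu (dil (N * 2 ^ i.+1) q))%E ->
  exists v, {ae mu, forall x, cell q x -> `|T h x - v| <= CK * (Cweight n eps * B)}.
Proof.
move=> Lh h0 hM B0 H; exists (\int[mu]_y (K (corner R q) y * h y)).
have ih : mu.-integrable setT (EFin \o h).
  apply: (L2_integrable_supp Lh _ _ hM); [exact: measurable_dil|exact: mu_dil_lty].
have mh := L2_meas Lh.
have := T_kernel_off HTK N1 Lh h0 hM; apply: filterS => x Hx qx; rewrite (Hx qx).
have iK z : cell q z -> mu.-integrable setT (EFin \o (fun y => K z y * h y)).
  move=> qz; apply: (kernel_integrable HK (side_gt0 R q.1) ih) => y hy.
  by apply: (cell_ndil_dist N1 qz) => /h0 /eqP; rewrite (negbTE hy).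
rewrite -RintegralB//; [|exact: iK|by apply: iK; exact: corner_cell].
rewrite -lee_fin EFinM.
apply: le_trans (Rintegral_abs_le _) _.
  have := integrableB measurableT (iK _ qx) (iK _ (corner_cell R q)).
  by apply: eq_integrable.
apply: (@le_trans _ _ (\int[mu]_y (CK%:E * (weight eps N q y * `|h y|%:E)))%E); last first.
  rewrite ge0_integralZl//.
  - by rewrite lee_wpmul2l ?lee_fin//; exact: integral_weight.
  - by apply: emeasurable_funM; [exact: measurable_weight|exact: measurable_absE].
  - by move=> y _; rewrite mule_ge0 ?weight_ge0 ?absE_ge0.
apply: ge0_le_integral => //.
- apply: measurable_absE; apply: measurable_funB.
    by apply/measurable_EFinP; case/integrableP: (iK _ qx).
  by apply/measurable_EFinP; case/integrableP: (iK _ (corner_cell R q)).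
- apply: emeasurable_funM => //.
  by apply: emeasurable_funM; [exact: measurable_weight|exact: measurable_absE].
move=> y _; rewrite -mulrBl normrM EFinM muleA.
have [qy|nqy] := pselect (dil N q y); first by rewrite h0// normr0 !mule0.
by apply: lee_wpmul2r => //; case: (kernel_weight HK N2n qx nqy).
Qed.

(** Mean zero allows [K x (corner R q)] to be subtracted under the integral; regularity in the
    second variable then leaves an integrable majorant with the L^1 norm of b in front. *)
Lemma T_atom q (b : rv -> R) : b \in L2 -> (forall y, ~ cell q y -> b y = 0) ->
  \int[mu]_y b y = 0 ->
  {ae mu, forall x, ~ dil N q x ->
    (`|T b x|%:E <= CK%:E * \int[mu]_y `|b y|%:E * weight eps N q x)%E}.
Proof.
move=> Lb b0 intb.
have ib : mu.-integrable setT (EFin \o b).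
  apply: (L2_integrable_supp Lb _ _ b0); [exact: measurable_cell|exact: mu_cell_lty].
have mb := L2_meas Lb.
have := T_kernel_out HTK N1 Lb b0; apply: filterS => x Hx qx; rewrite (Hx qx).
have iK : mu.-integrable setT (EFin \o (fun y => K x y * b y)).
  apply: (kernel_integrable HK (side_gt0 R q.1) ib) => y by0.
  rewrite distrC; apply: (cell_ndil_dist N1 _ qx).
  by apply: contrapT => /b0 /eqP; rewrite (negbTE by0).
have iC : mu.-integrable setT (EFin \o (fun y => K x (corner R q) * b y)).
  by apply: (integrableZl measurableT (K x (corner R q)) ib).
have -> : \int[mu]_y (K x y * b y) = \int[mu]_y (K x y * b y - K x (corner R q) * b y).
  by rewrite RintegralB// RintegralZl// intb mulr0 subr0.
apply: le_trans (Rintegral_abs_le _) _.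
  by have := integrableB measurableT iK iC; apply: eq_integrable.
apply: (@le_trans _ _ (\int[mu]_y ((CK%:E * weight eps N q x) * `|b y|%:E))%E).
  apply: ge0_le_integral => //.
  - apply: measurable_absE; apply: measurable_funB.
      by apply/measurable_EFinP; case/integrableP: iK.
    by apply/measurable_EFinP; case/integrableP: iC.
  - by apply: emeasurable_funM => //; exact: measurable_absE.
  move=> y _; rewrite -mulrBl normrM EFinM.
  have [qy|nqy] := pselect (cell q y); last by rewrite b0// normr0 !mule0.
  by apply: lee_wpmul2r => //; case: (kernel_weight HK N2n qy qx).
rewrite ge0_integralZl//; first by rewrite muleAC.
- exact: measurable_absE.
- by rewrite mule_ge0 ?weight_ge0 ?lee_fin.
Qed.

End kernel_operator.

(** * Boundedness of T on enlarged cells *)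

Section T1.
Context (R : realType) (n : nat).
Local Notation mu := (lebesgue_rV R n).
Local Notation L2 := (Lfun mu 2%:E).
Local Notation "'rv'" := ('rV[R]_n).
Variables (T : (rv -> R) -> rv -> R) (K : rv -> rv -> R).
Hypothesis n_gt0 : (0 < n)%N.
Hypothesis HT : L2_bounded_linear T.
Hypothesis HTK : associated_kernel T K.
Variables (eps CK : R).
Hypothesis HK : sup_kernel K eps CK.
Variable N : nat.
Implicit Types (x y : rv) (q : int * 'rV[int]_n).
Hypothesis N2n : (2 * n < N)%N.
Hypothesis N1 : (1 < N)%N.

Let CK0 : 0 <= CK. Proof. by case: HK. Qed.
Let eps0 : 0 < eps. Proof. by case: HK. Qed.
Let N0 : (0 < N)%N. Proof. exact: ltn_trans N1. Qed.

Lemma measurable_eball (c : rv) (r : R) : 0 < r -> measurable (eball c r).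
Proof.
move=> r0; pose S (x : rv) : R := \sum_(i < n) (rV_coord i x - c ord0 i) ^+ 2.
have mS : measurable_fun setT S.
  apply: measurable_sum => i; apply: measurable_funX.
  by apply: measurable_funB => //; exact: measurable_rV_coord.
rewrite (_ : eball c r = S @^-1` `]-oo, r ^+ 2[).
  by rewrite -[X in measurable X]setTI; exact: mS.
have E x : (enorm (x - c) < r) = (S x < r ^+ 2).
  rewrite -[in LHS](ger0_norm (ltW r0)) -sqrtr_sqr ltr_sqrt ?exprn_gt0//.
  by congr (_ < _); apply: eq_bigr => i _; rewrite !mxE.
by apply/seteqP; split=> x; rewrite /eball /= in_itv/= E.
Qed.

(** The shell bound with constant density 1; it controls the far integral in the definition of T(1)
    uniformly over q. *)
Lemma integral_off_weight q (U : set rv) x : cell q x -> measurable U ->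
  U `<=` ~` dil N q ->
  `|\int[mu]_(y in U) (K x y - K (corner R q) y)| <= CK * Cweight n eps.
Proof.
move=> qx mU Uq.
have mK z : cell q z -> measurable_fun U (K z).
  move=> qz; apply: (measurable_funS _ _ (@measurable_CZ_kernel _ _ _ _ _ HK z)).
    apply: rV_open_measurable; rewrite (_ : [set y | _] = ~` [set y | `|y - z| <= 0]).
      by rewrite openC; exact: closed_dist_le.
    apply/seteqP; split => y /=; rewrite normr_le0 subr_eq0 eq_sym.
      by move/negP.
    by move/negP.
  move=> y /Uq nqy /=; rewrite -subr_eq0 -normr_gt0.
  exact: lt_le_trans (side_gt0 R q.1) (cell_ndil_dist N1 qz nqy).
have mD : measurable_fun U (fun y => K x y - K (corner R q) y).
  by apply: measurable_funB; apply: mK => //; exact: corner_cell.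
have mU' : measurable_fun U (fun y => `|K x y - K (corner R q) y|%:E).
  by apply/measurable_EFinP; exact: measurableT_comp.
have le_int : (\int[mu]_(y in U) `|K x y - K (corner R q) y|%:E <=
   (CK * Cweight n eps)%:E)%E.
  apply: (@le_trans _ _ (\int[mu]_(y in U) (CK%:E * (weight eps N q y * `|(1 : R)|%:E)))%E).
    apply: ge0_le_integral => //.
    - apply: emeasurable_funM => //; apply: emeasurable_funM => //.
      by apply: measurable_funTS; exact: measurable_weight.
    - move=> y /Uq nqy; rewrite normr1 mule1.
      by case: (kernel_weight HK N2n qx nqy).
  apply: (@le_trans _ _ (\int[mu]_y (CK%:E * (weight eps N q y * `|(1 : R)|%:E)))%E).
    apply: ge0_subset_integral => //.
      by apply: emeasurable_funM => //; apply: emeasurable_funM => //; exact: measurable_weight.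
    by move=> y _; rewrite !mule_ge0 ?weight_ge0 ?lee_fin.
  rewrite ge0_integralZl//; last 2 first.
  - by apply: emeasurable_funM => //; exact: measurable_weight.
  - by move=> y _; rewrite mule_ge0 ?weight_ge0.
  rewrite EFinM lee_wpmul2l ?lee_fin//.
  have := @integral_weight R n eps N q (cst 1) 1 eps0 N0.
  rewrite mulr1; apply => // i.
  by rewrite /= normr1 integral_cst//; exact: measurable_dil.
rewrite -lee_fin EFin_normr_Rintegral//.
  by apply: le_trans le_int; apply: le_abse_integral => //; exact/measurable_EFinP.
apply/integrableP; split; first exact/measurable_EFinP.
exact: le_lt_trans le_int (ltry _).
Qed.

(** In the representation of T(1) on a ball around q, the far integral is bounded and T of the part
    of the ball off [dil N q] varies little on q. As T(1) is constant, T of the indicator of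
    [dil N q] is within [c1] of an unknown constant on q; Chebyshev bounds it at one point of q,
    hence on all of q. *)
Lemma T1_bounded : T1_eq0_BMO T K -> exists C1 : R, 0 <= C1 /\
  forall q, {ae mu, forall x, cell q x -> `|T (\1_(dil N q)) x| <= C1}.
Proof.
move=> [g [Hg [c0 gc0]]].
have [M [M0 HM]] := T_cheb HT.
pose c1 := CK * Cweight n eps * 2.
(* Chosen so that M (2N+1)^n < s <= s^2: the set where the value exceeds s cannot fill q. *)
pose s := M * (2 * N).+1%:R ^+ n + 1.
have Cw0 : 0 <= Cweight n eps.
  rewrite /Cweight divr_ge0 ?exprn_ge0// subr_ge0.
  by have /andP[_ /ltW] := ratio_lt1 eps0.
have c10 : 0 <= c1 by exact: mulr_ge0 (mulr_ge0 CK0 Cw0) (ler0n _ _).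
have s1 : 1 <= s by rewrite /s lerDr mulr_ge0// exprn_ge0.
exists (c1 + c1 + s); split; first by apply: addr_ge0; [exact: addr_ge0|exact: le_trans s1].
move=> q; set c := corner R q; set l := side R q.1.
have l0 : 0 < l by exact: side_gt0.
(* The factor n converts sup-norm distances: q lies in the Euclidean ball of radius r and [dil N q]
   in the doubled one. *)
pose r := n%:R * (N.+1%:R * l).
have n0 : (0 : R) < n%:R by rewrite ltr0n.
have r0 : 0 < r by rewrite /r !mulr_gt0.
pose U := eball c (2 * r).
have mU : measurable U by apply: measurable_eball; rewrite mulr_gt0.
have qU : dil N q `<=` U.
  move=> y /dil_dist yq; rewrite /U /eball/=.
  apply: (le_lt_trans (enorm_le_norm _)); apply: (@le_lt_trans _ _ r).
    by rewrite ler_pM2l.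
  by rewrite ltr_pMl// ltr1n.
pose M' := (2 * (n * N.+1))%N.
have UM : U `<=` dil M' q.
  move=> y; rewrite /U /eball/= => yr; apply: contrapT => /ndil_dist.
  rewrite leNgt => /negP; apply; apply: (le_lt_trans (norm_le_enorm _)).
  by apply: (lt_le_trans yr); rewrite /r /M' 2!natrM !mulrA.
have mq : measurable (dil N q : set rv) by exact: measurable_dil.
have Ufin : (mu U < +oo)%E.
  apply: le_lt_trans (@mu_dil_lty R n M' q).
  by apply: le_measure; rewrite ?inE//; exact: measurable_dil.
have L1 : (\1_(dil N q) : rv -> R) \in L2 by apply: L2_indic => //; exact: mu_dil_lty.
have mUq : measurable (U `\` dil N q) by exact: measurableD.
have Lh : \1_(U `\` dil N q) \in L2.
  apply: L2_indic => //; apply: le_lt_trans Ufin.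
  by apply: le_measure; rewrite ?inE//; exact: subDsetl.
have [v Hv] : exists v, {ae mu, forall x, cell q x ->
    `|T (\1_(U `\` dil N q)) x - v| <= CK * (Cweight n eps * 1)}.
  apply: (T_osc HTK HK N2n N1 (M := M') (q := q) Lh) => //.
  - by move=> y qy; rewrite indicE memNset// => -[].
  - by move=> y qy; rewrite indicE memNset// => -[/UM].
  move=> i; rewrite mul1e.
  have mi : measurable (dil (N * 2 ^ i.+1) q : set rv) by exact: measurable_dil.
  apply: (@le_trans _ _ (\int[mu]_(y in dil (N * 2 ^ i.+1) q) (cst 1 y))%E); last first.
    by rewrite integral_cst// mul1e.
  apply: ge0_le_integral => //.
    by apply: measurable_funTS; apply: measurable_absE; exact: measurable_indic.
  by move=> y _; rewrite lee_fin indicE; case: (_ \in _); rewrite ?normr1 ?normr0.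
have [a Ha] := Hg c r r0.
have Tsum : {ae mu, forall x, T (fun y => cst 1 y * \1_U y) x =
    T (\1_(dil N q)) x + T (\1_(U `\` dil N q)) x}.
  have := T_add HT L1 Lh.
  rewrite (_ : (fun y => _ + _) = fun y => cst 1 y * \1_U y)//.
  apply/funext => y; rewrite mul1r !indicE in_setD.
  have [yq|yq] := boolP (y \in dil N q); last by rewrite andbT add0r.
  by rewrite andbF addr0 (mem_set (qU _ (set_mem yq))).
pose w := c0 - a - v.
have Hw : {ae mu, forall x, cell q x -> `|T (\1_(dil N q)) x - w| <= c1}.
  have H2 : {ae mu, forall x, g x = c0 /\ T (fun y => cst 1 y * \1_U y) x =
      T (\1_(dil N q)) x + T (\1_(U `\` dil N q)) x}.
    by apply: filterS2 gc0 Tsum.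
  apply: filterS3 Hv Ha H2 => x Hv Ha [{}gc0 {}Tsum] qx.
  have xr : eball c r x.
    apply: (le_lt_trans (enorm_le_norm _)); rewrite /r ltr_pM2l//.
    by apply: (le_lt_trans (cell_dist qx)); rewrite ltr_pMl// ltr1n.
  have {}Hv := Hv qx; have {}Ha := Ha xr.
  rewrite gc0 Tsum in Ha.
  have := @integral_off_weight q (~` U) x qx (measurableC mU).
  have E : \int[mu]_(y in ~` U) (K x y - K (corner R q) y) =
      \int[mu]_(y in ~` U) ((K x y - K c y) * cst 1 y).
    by apply: eq_Rintegral => y _; rewrite mulr1.
  rewrite E => /(_ (subsetC qU)).
  move: Ha Hv; rewrite mulr1 /w /c1; set I := Rintegral _ _ _.
  move=> -> Hv HI.
  set t := T (\1_(dil N q)) x; set h := T (\1_(U `\` dil N q)) x in Hv *.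
  have -> : t - (t + h + I + a - a - v) = - (h - v) - I by ring.
  by rewrite (le_trans (ler_normB _ _))// normrN mulr2n mulrDr mulr1 lerD.
have [x [qx nE xw]] : exists x, [/\ cell q x,
    ~ [set x | s < `|T (\1_(dil N q)) x|] x &
    cell q x -> `|T (\1_(dil N q)) x - w| <= c1].
  apply: (ae_exists Hw); [exact: measurable_cell|exact: measurable_gt (T_meas HT L1)|].
  have mE : measurable [set x | s < `|T (\1_(dil N q)) x|].
    exact: measurable_gt (T_meas HT L1).
  have mc := @measurable_cell R n q.
  apply: (@le_lt_trans _ _ (mu [set x | s < `|T (\1_(dil N q)) x|])).
    by apply: le_measure; rewrite ?inE//; exact: measurableI.
  have := HM _ s L1 (le_trans ler01 s1).
  have -> : sqnorm mu (\1_(dil N q)) = mu (dil N q).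
    rewrite /sqnorm (eq_integral (fun x => (\1_(dil N q) x)%:E)).
      by rewrite integral_indic// setIT.
    by move=> y _; rewrite indicE; case: (_ \in _); rewrite ?expr1n ?expr0n.
  rewrite mu_dil_cell muleA -EFinM => h.
  have s20 : 0 < s ^+ 2 by rewrite exprn_gt0// (lt_le_trans ltr01).
  rewrite -(@lte_pmul2l _ (s ^+ 2)%:E)// (le_lt_trans h)//.
  rewrite lte_pmul2r ?mu_cell_gt0 ?fin_numE_mu//.
    rewrite lte_fin (@lt_le_trans _ _ s)//; first by rewrite ltrDl.
    by rewrite expr2 ler_peMl// (le_trans ler01).
  by rewrite ge0_fin_numE// mu_cell_lty.
apply: filterS Hw => y Hy qy; have {}Hy := Hy qy; have {}xw := xw qx.
have hx : `|T (\1_(dil N q)) x| <= s by rewrite leNgt; exact/negP.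
move: hx xw Hy; rewrite !ler_norml => /andP[? ?] /andP[? ?] /andP[? ?].
apply/andP; split; lra.
Qed.

End T1.

Lemma lee_divr (R : realType) (t b : R) (a : \bar R) : 0 < t ->
  (t%:E * a <= b%:E)%E -> (a <= (b / t)%:E)%E.
Proof.
by move=> t0; rewrite EFinM lee_pdivlMr// muleC.
Qed.

Section disjoint_sums.
Context (T : Type) (R : realType).

Lemma sum_indic_in (E : nat -> set T) (F : nat -> R) (J i : nat) (x : T) :
  trivIset setT E -> (i < J)%N -> E i x -> \sum_(j < J) F j * \1_(E j) x = F i.
Proof.
move=> tE iJ Ex; rewrite (bigD1 (Ordinal iJ))//= big1.
  by rewrite addr0 indicE mem_set// mulr1.
move=> j ji; rewrite indicE memNset ?mulr0// => Ej; move/eqP: ji; apply.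
by apply: val_inj => /=; apply: tE => //; exists x.
Qed.

Lemma sum_indic_out (E : nat -> set T) (F : nat -> R) (J : nat) (x : T) :
  (forall i, (i < J)%N -> ~ E i x) -> \sum_(j < J) F j * \1_(E j) x = 0.
Proof.
move=> nE; rewrite big1// => j _; rewrite indicE memNset ?mulr0//.
exact: nE.
Qed.

End disjoint_sums.

(** * Calderon-Zygmund decomposition and weak type bound *)

Section stopping_cells.
Context (R : realType) (n : nat).
Local Notation mu := (lebesgue_rV R n).
Local Notation "'rv'" := ('rV[R]_n).
Local Notation dil := (@dil R n).
Local Notation cell := (@cell R n).
Implicit Types (x y : rv) (q : int * 'rV[int]_n).
Hypothesis n_gt0 : (0 < n)%N.
Variables (N : nat) (h : rv -> R) (l : R).
Hypothesis ih : mu.-integrable setT (EFin \o h).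
Hypothesis l0 : 0 < l.
Local Open Scope ereal_scope.

Definition absint (A : set rv) : \bar R := \int[mu]_(y in A) `|h y|%:E.

Let mh : measurable_fun setT h.
Proof. by apply/measurable_EFinP; case/integrableP: ih. Qed.

Let mah := measurable_absE mh.

Lemma absint_ge0 A : 0 <= absint A.
Proof. by apply: integral_ge0 => y _; exact: absE_ge0. Qed.

Lemma absintT_fin : absint setT = (fine (absint setT))%:E.
Proof.
rewrite fineK// ge0_fin_numE ?absint_ge0//.
by case/integrableP: ih.
Qed.

Lemma absint_le A B : measurable A -> measurable B -> A `<=` B -> absint A <= absint B.
Proof.
move=> mA mB AB; apply: ge0_subset_integral => //; first exact: measurable_funTS.
Qed.

Definition heavy : set (int * 'rV[int]_n) :=
  [set q | l%:E * mu (cell q) < absint (cell q)].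

Definition Omega : set rv := \bigcup_(q in maxcell R heavy) cell q.
Definition Omega_star : set rv := \bigcup_(q in maxcell R heavy) dil N q.

Lemma measurable_Omega : measurable Omega.
Proof. by apply: measurable_bigcup_count => q; exact: measurable_cell. Qed.

Lemma measurable_Omega_star : measurable Omega_star.
Proof. by apply: measurable_bigcup_count => q; exact: measurable_dil. Qed.

(** A heavy cell has volume below the L^1 norm over l, while volumes of coarse cells grow without
    bound since n > 0. Hence every heavy cell lies in a maximal one. *)
Lemma heavy_bounded x : exists k0 : int, forall j, (j < k0)%R -> ~ heavy (j, gen j x).
Proof.
set H := fine (absint setT).
have H0 : (0 <= H)%R by rewrite fine_ge0// absint_ge0.
exists (- (Num.bound (H / l))%:Z)%R => j jk.
rewrite /heavy/= => hj.
have : absint (cell (j, gen j x)) <= H%:E.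
  by rewrite -absintT_fin; apply: absint_le => //; exact: measurable_cell.
apply/negP; rewrite -ltNge; apply: le_lt_trans hj.
rewrite mu_cell -EFinM lee_fin -ler_pdivrMl// mulrC.
have h1 : (H / l < (Num.bound (H / l))%:R)%R.
  by apply: le_lt_trans (archi_boundP _) => //; rewrite divr_ge0// ltW.
apply: (le_trans (ltW h1)) => /=.
apply: (@le_trans _ _ (side R (- (Num.bound (H / l))%:Z))%R).
  by rewrite /side opprK /exprz/= -natrX ler_nat ltnW// ltn_expl.
apply: (@le_trans _ _ (side R j)); first by apply: le_side; exact: ltW.
apply: ler_eXnr => //.
apply: (@le_trans _ _ (side R 0)); first by rewrite /side oppr0 expr0z.
by apply: le_side; apply: ltW; apply: (lt_le_trans jk); lia.
Qed.

Lemma heavy_Omega x k : heavy (k, gen k x) -> exists j,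
  [/\ (j <= k)%R, maxcell R heavy (j, gen j x) & cell (k, gen k x) `<=` Omega].
Proof.
move=> hk; have [j jk mj] := maxcell_exists hk (heavy_bounded x).
exists j; split=> // y yk; exists (j, gen j x) => //.
exact: (cell_sub jk).
Qed.

Lemma mu_Omega : l%:E * mu Omega <= absint setT.
Proof.
apply: (@le_trans _ _ (absint Omega)); last first.
  by apply: absint_le => //; exact: measurable_Omega.
rewrite -integral_cst; last exact: measurable_Omega.
apply: le_integral_bigcup => //; first exact: maxcell_triv.
- by move=> q; exact: measurable_cell.
- by move=> x; rewrite lee_fin ltW.
- by move=> q [/ltW hq _]; rewrite integral_cst//; exact: measurable_cell.
Qed.

Lemma mu_Omega_star : l%:E * mu Omega_star <= ((2 * N).+1%:R ^+ n)%:E * absint setT.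
Proof.
apply: (@le_trans _ _ (l%:E * (((2 * N).+1%:R ^+ n)%:E * mu Omega))).
  rewrite lee_wpmul2l ?lee_fin ?(ltW l0)//; apply: measure_bigcup_le.
  - exact: maxcell_triv.
  - by move=> q; exact: measurable_cell.
  - by move=> q; exact: measurable_dil.
  - by rewrite exprn_ge0.
  - by move=> q _; rewrite le_eqVlt; apply/orP; left; apply/eqP; exact: mu_dil_cell.
by rewrite muleCA lee_wpmul2l ?lee_fin ?exprn_ge0//; exact: mu_Omega.
Qed.

(** If the average over the enlargement exceeded l, one of its cells would be heavy and lie in a
    maximal heavy cell. Nearness being symmetric and inherited by coarser generations, the
    enlargement of that cell would contain x. *)
Lemma Omega_star_average x k : ~ Omega_star x ->
  absint (dil N (k, gen k x)) <= l%:E * mu (dil N (k, gen k x)).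
Proof.
move=> nx.
have E : dil N (k, gen k x) = \bigcup_(m in [set m | exists2 y,
    dil N (k, gen k x) y & gen k y = m]) cell (k, m).
  apply/seteqP; split=> y; first by move=> yx; exists (gen k y) => //; exists y.
  by move=> [_ [z zx <-]] yz i; rewrite /= yz; exact: zx.
rewrite -integral_cst; last exact: measurable_dil.
rewrite /absint E; apply: le_integral_bigcup => //; first exact: gset_triv.
- by move=> m; exact: measurable_cell.
- by move=> y; rewrite lee_fin ltW.
move=> _ [y yx <-]; rewrite integral_cst; last exact: measurable_cell.
rewrite leNgt; apply/negP => hy.
have [j [jk mj _]] := @heavy_Omega y k hy.
apply: nx; exists (j, gen j y) => //.
by apply: (gen_le_near jk); exact: dil_sym.
Qed.

(** The parent, 2^n times larger, is not heavy by maximality. *)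
Lemma heavy_le q : maxcell R heavy q -> absint (cell q) <= (2 ^+ n * l)%:E * mu (cell q).
Proof.
move=> [_ mq]; have cq := corner_cell R q.
have := mq _ (q.1 - 1)%R cq; rewrite ltrBlDr ltrDl => /(_ isT) nh.
have {}nh : absint (cell (q.1 - 1, gen (q.1 - 1) (corner R q))%R) <=
    l%:E * mu (cell (q.1 - 1, gen (q.1 - 1) (corner R q))%R).
  by rewrite leNgt; exact/negP.
have sub : cell q `<=` cell (q.1 - 1, gen (q.1 - 1) (corner R q))%R.
  rewrite {1}(cell_inj cq); apply: cell_sub; lia.
apply: (le_trans (absint_le _ _ sub)); [exact: measurable_cell|exact: measurable_cell|].
apply: (le_trans nh); rewrite !mu_cell/= -!EFinM lee_fin.
by rewrite (sideB R q.1 1) exprMn expr1; lra.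
Qed.

(** The factor 2 pays for a density of only 1/2: a cell more than half filled by points off [Omega]
    with |h| > 2l would itself be heavy, hence inside [Omega]. *)
Lemma Omega_density : {ae mu, forall x, ~ Omega x -> (`|h x| <= 2 * l)%R}.
Proof.
pose A := ~` Omega `&` [set x | (2 * l < `|h x|)%R].
have mA : measurable A.
  apply: measurableI; first by apply: measurableC; exact: measurable_Omega.
  exact: measurable_gt mh.
have [A0|A0] := eqVneq (mu A) 0.
  exists A; split => // x /= /not_implyP[nx /negP]; rewrite -ltNge => hx.
  by split.
have {}A0 : 0 < mu A by rewrite lt0e A0 measure_ge0.
have [q hq] := density mA A0.
have mq : measurable (cell q : set rv) by exact: measurable_cell.
have [x [[nx hx] qx]] : A `&` cell q !=set0.
  apply/set0P/eqP => AE; move: hq; rewrite AE measure0 mule0 ltNge.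
  by rewrite measure_ge0.
exfalso; apply: nx.
have heavyq : heavy (q.1, gen q.1 x).
  rewrite -(cell_inj qx) /heavy/=.
  apply: (@lt_le_trans _ _ ((2 * l)%:E * mu (A `&` cell q))).
    by rewrite [(2 * l)%R]mulrC EFinM -muleA lte_pmul2l.
  apply: (@le_trans _ _ (absint (A `&` cell q))).
    apply: markov_set => //; first exact: measurableI.
      by rewrite mulr_ge0// ltW.
    by move=> y [[_ /= hy] _]; rewrite lee_fin ltW.
  by apply: absint_le => //; exact: measurableI.
have [j [_ _ sub]] := heavy_Omega heavyq.
by apply: sub; exact: cell_gen.
Qed.

End stopping_cells.

(** * Means and oscillations *)

Section means.
Context (R : realType) (n : nat).
Local Notation mu := (lebesgue_rV R n).
Local Notation "'rv'" := ('rV[R]_n).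
Implicit Types (A B : set rv) (f : rv -> R).

Lemma mean_sub A f (c : R) : measurable A -> (0 < mu A < +oo)%E ->
  mu.-integrable A (EFin \o f) ->
  (`|mean A f - c|%:E * mu A <= \int[mu]_(x in A) `|f x - c|%:E)%E.
Proof.
move=> mA /andP[A0 Aoo] iA.
have muE : mu A = (fine (mu A))%:E by rewrite fineK// ge0_fin_numE.
have a0 : 0 < fine (mu A) by rewrite fine_gt0// A0 Aoo.
have ic : mu.-integrable A (EFin \o cst c).
  apply: measurable_bounded_integrable => //.
  by exists `|c|; split; [exact: num_real|move=> t ct x _ /=; exact: ltW].
have iD : mu.-integrable A (EFin \o (fun x => f x - c)).
  by have := integrableB mA iA ic; apply: eq_integrable.
have -> : mean A f - c = (fine (mu A))^-1 * \int[mu]_(x in A) (f x - c).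
  rewrite RintegralB// Rintegral_cst// mulrBr /mean; congr (_ - _).
  by rewrite mulrCA mulVf ?mulr1// gt_eqF.
rewrite normrM gtr0_norm ?invr_gt0// muE -EFinM mulrAC mulVf ?gt_eqF// mul1r.
rewrite EFin_normr_Rintegral//; apply: le_abse_integral => //.
by case/integrableP: iD.
Qed.

(** The mean differs from any c by at most the average of |f - c|, so replacing it by c costs a
    factor 2. *)
Lemma mean_osc A f (c : R) : measurable A -> (0 < mu A < +oo)%E ->
  mu.-integrable A (EFin \o f) ->
  (\int[mu]_(x in A) `|f x - mean A f|%:E <=
   2%:E * \int[mu]_(x in A) `|f x - c|%:E)%E.
Proof.
move=> mA A0 iA; have mf : measurable_fun A f.
  by apply/measurable_EFinP; case/integrableP: iA.
have mfc (a : R) : measurable_fun A (fun x => `|f x - a|%:E).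
  by apply/measurable_EFinP; apply: measurableT_comp => //; exact: measurable_funB.
apply: (@le_trans _ _ (\int[mu]_(x in A) (`|f x - c|%:E + `|mean A f - c|%:E))%E).
  apply: ge0_le_integral => //; first by apply: emeasurable_funD.
  move=> x _; rewrite -EFinD lee_fin [`|mean A f - c|]distrC.
  exact: ler_distD.
rewrite ge0_integralD// integral_cst//.
have -> (z : \bar R) : (2%:E * z = z + z)%E.
  by rewrite -[2]/(1 + 1) EFinD ge0_muleDl ?mul1e ?lee_fin.
by apply: leeD => //; exact: mean_sub.
Qed.

Lemma oscE A f : measurable A -> (0 < mu A < +oo)%E ->
  mu.-integrable A (EFin \o f) ->
  ((osc A f)%:E * mu A = \int[mu]_(x in A) `|f x - mean A f|%:E)%E.
Proof.
move=> mA A0 iA; have /andP[Agt0 Aoo] := A0.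
have muE : (mu A = (fine (mu A))%:E)%E by rewrite fineK// ge0_fin_numE.
have a0 : 0 < fine (mu A) by rewrite fine_gt0// A0.
rewrite /osc {1}/mean muE -EFinM mulrAC mulVf ?gt_eqF// mul1r.
rewrite /Rintegral fineK// ge0_fin_numE; last first.
  by apply: integral_ge0 => y _; exact: absE_ge0.
apply: (le_lt_trans (mean_osc 0 mA A0 iA)).
rewrite lte_mul_pinfty//; case/integrableP: iA => _ h; apply: le_lt_trans h.
rewrite le_eqVlt; apply/orP; left; apply/eqP.
by apply: eq_integral => x _; rewrite /= subr0.
Qed.

Lemma osc_ge0 A f : 0 <= osc A f.
Proof.
rewrite /osc /mean; apply: mulr_ge0; last by apply: Rintegral_ge0.
by rewrite invr_ge0 fine_ge0.
Qed.

End means.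

Section weak_type.
Context (R : realType) (n : nat).
Local Notation mu := (lebesgue_rV R n).
Local Notation L2 := (Lfun mu 2%:E).
Local Notation "'rv'" := ('rV[R]_n).
Local Notation dil := (@dil R n).
Local Notation cell := (@cell R n).
Implicit Types (x y : rv) (q : int * 'rV[int]_n).
Hypothesis n_gt0 : (0 < n)%N.

Section decomposition.
Variables (h : rv -> R) (l : R).
Hypothesis Lh : h \in L2.
Hypothesis ih : mu.-integrable setT (EFin \o h).
Hypothesis l0 : 0 < l.

Let P := maxcell R (heavy h l).
Let mh : measurable_fun setT h := L2_meas Lh.

Definition czcell (j : nat) : set rv := enum_fam P cell j.
Local Notation E := czcell.

Lemma czcell_cases j : E j = set0 \/ exists q, P q /\ E j = cell q.
Proof.
rewrite /E /enum_fam; case: pickle_inv => [q|]; last by left.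
by case: asboolP => Pq; [right; exists q|left].
Qed.

Lemma measurable_czcell j : measurable (E j).
Proof. by apply: measurable_enum_fam => q; exact: measurable_cell. Qed.

Lemma czcell_triv : trivIset setT E.
Proof. by apply: trivIset_enum_fam; exact: maxcell_triv. Qed.

Lemma czcell_bigcup : \bigcup_j E j = Omega h l.
Proof. exact: bigcup_enum_fam. Qed.

Lemma mu_czcell j : (mu (E j) < +oo)%E.
Proof.
by have [->|[q [_ ->]]] := czcell_cases j; [rewrite measure0|exact: mu_cell_lty].
Qed.

Let ihE j : mu.-integrable (E j) (EFin \o h).
Proof. by apply: L2_integrable => //; [exact: measurable_czcell|exact: mu_czcell]. Qed.

Definition czmean j : R := mean (E j) h.

Definition czbad j y : R := (h y - czmean j) * \1_(E j) y.

Definition cztail J : set rv := \bigcup_(j in [set j | (J <= j)%N]) E j.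

Lemma czmean_le j : `|czmean j| <= 2 ^+ n * l.
Proof.
have [E0|[q [Pq Eq]]] := czcell_cases j.
  by rewrite /czmean /mean E0 Rintegral_set0 mulr0 normr0 mulr_ge0 ?exprn_ge0// ltW.
have : (`|czmean j - 0|%:E * mu (cell q) <= (2 ^+ n * l)%:E * mu (cell q))%E.
  apply: le_trans (heavy_le n_gt0 ih l0 Pq).
  rewrite /czmean Eq (le_trans (mean_sub 0 _ _ _))//.
  - exact: measurable_cell.
  - by rewrite mu_cell_gt0 mu_cell_lty.
  - by rewrite -Eq.
  - by under eq_integral do rewrite subr0.
rewrite subr0 lee_pmul2r ?mu_cell_gt0//; last first.
  by rewrite ge0_fin_numE// mu_cell_lty.
Qed.

Lemma czbad_L2 j : czbad j \in L2.
Proof.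
rewrite (_ : czbad j = fun y => - czmean j * \1_(E j) y + h y * \1_(E j) y).
  apply: L2_lin; last exact: L2_mulI Lh (measurable_czcell j).
  by apply: L2_indic; [exact: measurable_czcell|exact: mu_czcell].
by apply/funext => y; rewrite /czbad mulrBl addrC mulNr.
Qed.

Lemma czbad_int0 j : \int[mu]_y czbad j y = 0.
Proof.
have -> : \int[mu]_y czbad j y = \int[mu]_(y in E j) (h y - czmean j).
  rewrite [RHS]Rintegral_mkcond; apply: eq_Rintegral => y _.
  rewrite /czbad patchE indicE.
  by case: ifP; rewrite ?mulr1 ?mulr0.
have [->|[q [Pq Eq]]] := czcell_cases j; first by rewrite Rintegral_set0.
have ic : mu.-integrable (E j) (EFin \o cst (czmean j)).
  apply: measurable_bounded_integrable => //.
  - exact: measurable_czcell.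
  - exact: mu_czcell.
  - by exists `|czmean j|; split; [exact: num_real|move=> t ct x _ /=; exact: ltW].
rewrite RintegralB//; last exact: measurable_czcell.
rewrite Rintegral_cst ?/czmean ?/mean; last exact: measurable_czcell.
rewrite mulrAC mulVf ?mul1r ?subrr//.
by rewrite Eq mu_cell/= expf_neq0// side_neq0.
Qed.

Lemma czbad_abs j : (\int[mu]_y `|czbad j y|%:E <= 2%:E * absint h (E j))%E.
Proof.
have -> : (\int[mu]_y `|czbad j y|%:E = \int[mu]_(y in E j) `|h y - czmean j|%:E)%E.
  rewrite [RHS]integral_mkcond; apply: eq_integral => y _.
  rewrite /czbad patchE indicE.
  by case: ifP; rewrite ?mulr1 ?mulr0 ?normr0.
have [->|[q [Pq Eq]]] := czcell_cases j.
  by rewrite integral_set0 mule_ge0 ?absint_ge0.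
have <- : (\int[mu]_(y in E j) `|h y - 0|%:E = absint h (E j))%E.
  by apply: eq_integral => y _; rewrite subr0.
apply: mean_osc (ihE j); first exact: measurable_czcell.
by rewrite mu_czcell Eq mu_cell_gt0.
Qed.

(** Means replace h on the first J stopping cells only, so that T is applied to a finite sum; what
    is left on the other cells goes to [cztail] and is small in L^2. *)
Definition czgood J y : R :=
  h y * \1_(~` Omega h l) y + \sum_(j < J) czmean j * \1_(E j) y.

Lemma cz_decomposition J y :
  h y = czgood J y + (\sum_(j < J) czbad j y + h y * \1_(cztail J) y).
Proof.
rewrite /czgood /czbad.
have [Oy|nO] := pselect (Omega h l y); last first.
  have nE j : ~ E j y by move=> Ej; apply: nO; rewrite -czcell_bigcup; exists j.
  rewrite (@sum_indic_out _ _ E)// (@sum_indic_out _ _ E (fun j => h y - czmean j))//.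
  rewrite !indicE mem_set// memNset; last by move=> [j _]; exact: nE.
  by rewrite mulr1 mulr0 !addr0.
rewrite [\1_(~` _) y]indicE memNset; last exact.
move: Oy; rewrite -czcell_bigcup => -[i _ Ei].
have [iJ|Ji] := ltnP i J.
  rewrite (sum_indic_in _ czcell_triv iJ Ei).
  rewrite (sum_indic_in (fun j => h y - czmean j) czcell_triv iJ Ei).
  rewrite indicE memNset; first by rewrite !mulr0; ring.
  move=> [j /= Jj Ej]; have ij : i = j by apply: czcell_triv => //; exists y.
  by move: iJ; rewrite ij ltnNge Jj.
have nE j : (j < J)%N -> ~ E j y.
  move=> jJ Ej; have ij : i = j by apply: czcell_triv => //; exists y.
  by move: jJ; rewrite -ij ltnNge Ji.
rewrite (@sum_indic_out _ _ E)// (@sum_indic_out _ _ E (fun j => h y - czmean j))//.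
rewrite indicE mem_set; last by exists i.
by rewrite mulr1 mulr0 !add0r.
Qed.

Lemma czgood_L2 J : czgood J \in L2.
Proof.
rewrite (_ : czgood J = fun y => 1 * (h y * \1_(~` Omega h l) y) +
    (\sum_(j < J) (fun y => czmean j * \1_(E j) y) y)); last first.
  by apply/funext => y; rewrite mul1r.
apply: L2_lin.
  by apply: L2_mulI => //; apply: measurableC; exact: measurable_Omega.
apply: L2_sum => j; apply: L2_mull.
by apply: L2_indic; [exact: measurable_czcell|exact: mu_czcell].
Qed.

(** Off [Omega], |h| <= 2l gives h^2 <= 2l |h|; inside, the square is at most (2^n l)^2, and l times
    the measure of [Omega] is at most the L^1 norm. *)
Lemma sqnorm_czgood J :
  (sqnorm mu (czgood J) <= ((2 * l + 2 ^+ n * l * 2 ^+ n)%:E * absint h setT))%E.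
Proof.
have mO := measurable_Omega h l.
have mah := measurable_absE mh.
pose c := 2 ^+ n * l.
have c0 : 0 <= c by rewrite /c mulr_ge0 ?exprn_ge0// ltW.
have mg := L2_meas (czgood_L2 J).
apply: (@le_trans _ _ (\int[mu]_y ((2 * l)%:E * `|h y|%:E +
    (c ^+ 2)%:E * (\1_(Omega h l) y)%:E))%E).
  have ml : measurable_fun setT (fun y => (2 * l)%:E * `|h y|%:E)%E.
    exact: emeasurable_funM.
  have mr : measurable_fun setT (fun y => (c ^+ 2)%:E * (\1_(Omega h l) y)%:E)%E.
    by apply: emeasurable_funM => //; apply/measurable_EFinP; exact: measurable_indic.
  apply: ae_ge0_le_integral => //.
  - by move=> y _; exact: sqE_ge0.
  - exact: measurable_sq.
  - move=> y _; rewrite adde_ge0 ?mule_ge0 ?lee_fin ?sqr_ge0// mulr_ge0// ltW//.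
  - exact: emeasurable_funD.
  apply: filterS (Omega_density n_gt0 ih l0) => y Hy _.
  rewrite -!EFinM -EFinD lee_fin.
  have [Oy|nO] := pselect (Omega h l y); last first.
    have nE j : ~ E j y by move=> Ej; apply: nO; rewrite -czcell_bigcup; exists j.
    rewrite /czgood (@sum_indic_out _ _ E)// !indicE mem_set// memNset//.
    rewrite mulr1 mulr0 !addr0 -real_normK ?num_real// expr2 ler_wpM2r//.
    exact: Hy.
  rewrite /czgood !indicE memNset; last exact.
  rewrite mem_set// mulr0 add0r mulr1.
  apply: (@le_trans _ _ (c ^+ 2)); last by rewrite lerDr !mulr_ge0// ltW.
  rewrite -real_normK ?num_real// lerXn2r ?nnegrE//.
  move: Oy; rewrite -czcell_bigcup => -[i _ Ei].
  have [iJ|Ji] := ltnP i J.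
    by rewrite (sum_indic_in _ czcell_triv iJ Ei) czmean_le.
  rewrite (@sum_indic_out _ _ E) ?normr0// => j jJ Ej.
  have ij : i = j by apply: czcell_triv => //; exists y.
  by move: jJ; rewrite -ij ltnNge Ji.
rewrite ge0_integralD//; first last.
- by apply: emeasurable_funM => //; apply/measurable_EFinP; exact: measurable_indic.
- by move=> y _; rewrite mule_ge0 ?lee_fin ?sqr_ge0.
- exact: emeasurable_funM.
- by move=> y _; rewrite mule_ge0 ?lee_fin ?mulr_ge0// ltW.
rewrite ge0_integralZl//; last by rewrite lee_fin mulr_ge0// ltW.
rewrite ge0_integralZl//; first last.
- by rewrite lee_fin sqr_ge0.
- by apply/measurable_EFinP; exact: measurable_indic.
rewrite integral_indic// setIT EFinD ge0_muleDl ?lee_fin ?mulr_ge0 ?exprn_ge0 ?(ltW l0)//.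
apply: leeD => //.
rewrite (_ : c ^+ 2 = (c * 2 ^+ n) * l); last by rewrite /c; ring.
rewrite EFinM -muleA lee_wpmul2l ?lee_fin ?mulr_ge0 ?exprn_ge0 ?(ltW l0)//.
exact: mu_Omega.
Qed.

Lemma sqnorm_cztail (e : R) : 0 < e -> exists J,
  (sqnorm mu (fun y => (h y * \1_(cztail J) y)%R) <= e%:E)%E.
Proof.
move=> e0; have /L2P[_ hoo] := Lh.
pose u j := (\int[mu]_(y in E j) (h y ^+ 2)%:E)%E.
have u0 j : (0 <= u j)%E by apply: integral_ge0 => y _; exact: sqE_ge0.
have msq := measurable_sq mh.
have usum : (\sum_(j <oo) u j < +oo)%E.
  rewrite /u -(@ge0_integral_bigcup _ _ _ mu E); last 4 first.
  - exact: measurable_czcell.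
  - exact: measurable_funTS.
  - by move=> y _; exact: sqE_ge0.
  - exact: czcell_triv.
  apply: le_lt_trans hoo; apply: ge0_subset_integral => //.
    by apply: bigcupT_measurable; exact: measurable_czcell.
  by move=> y _; exact: sqE_ge0.
have := @nneseries_tail_cvg _ u xpredT usum (fun k _ => u0 k).
move/fine_cvgP => [_ /cvgrPdist_lt/(_ _ e0)[J _ HJ]].
exists J; have := HJ J (leqnn J); rewrite sub0r normrN /= => /ltW.
have s0 : (0 <= \sum_(J <= k <oo) u k)%E by apply: nneseries_ge0.
have sJ : (\sum_(J <= k <oo) u k \is a fin_num)%E.
  rewrite ge0_fin_numE//; apply: le_lt_trans usum.
  rewrite [leRHS](nneseries_split 0 J)//= add0n.
  by rewrite leeDr// sume_ge0.
rewrite ger0_norm ?fine_ge0// -lee_fin fineK// => h1; apply: le_trans h1.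
have -> : (sqnorm mu (fun y => (h y * \1_(cztail J) y)%R) =
    \int[mu]_(y in cztail J) (h y ^+ 2)%:E)%E.
  rewrite /sqnorm [RHS]integral_mkcond; apply: eq_integral => y _.
  rewrite patchE indicE; case: ifP => _; rewrite ?mulr1 ?mulr0 ?expr0n//.
have -> : cztail J = \bigcup_k E (k + J)%N.
  apply/seteqP; split=> y [j].
    by move=> /= Jj Ej; exists (j - J)%N => //; rewrite subnK.
  by move=> _ Ej; exists (j + J)%N => //=; rewrite leq_addl.
rewrite (@ge0_integral_bigcup _ _ _ mu (fun k => E (k + J)%N)); last 4 first.
- by move=> k; exact: measurable_czcell.
- exact: measurable_funTS.
- by move=> y _; exact: sqE_ge0.
- move=> i j _ _ ij; apply/eqP; rewrite -(eqn_add2r J); apply/eqP.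
  exact: (czcell_triv _ _ ij).
by rewrite -[leRHS]nneseries_addn.
Qed.

Lemma czbad_sum J : (\sum_(j < J) absint h (E j) <= absint h setT)%E.
Proof.
have mah := measurable_absE mh.
apply: (@le_trans _ _ (\sum_(j <oo) absint h (E j))%E).
  rewrite -(big_mkord xpredT (fun j => absint h (E j))).
  by apply: nneseries_lim_ge => j _ _; exact: absint_ge0.
rewrite /absint -(@ge0_integral_bigcup _ _ _ mu E); last 4 first.
- exact: measurable_czcell.
- exact: measurable_funTS.
- by move=> y _; exact: absE_ge0.
- exact: czcell_triv.
apply: ge0_subset_integral => //.
by apply: bigcupT_measurable; exact: measurable_czcell.
Qed.

End decomposition.
End weak_type.

Lemma measure_ae_le d (T : measurableType d) (R : realType)
    (mu : {measure set T -> \bar R}) (S B : set T) :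
  measurable S -> measurable B -> {ae mu, forall x, S x -> B x} ->
  (mu S <= mu B)%E.
Proof.
move=> mS mB [Z [mZ Z0 HZ]].
apply: (@le_trans _ _ (mu (B `|` Z))).
  apply: le_measure; rewrite ?inE//; first exact: measurableU.
  move=> x Sx; have [Bx|nB] := pselect (B x); first by left.
  by right; apply: HZ => /= /(_ Sx).
apply: (le_trans (measureU2 _ _ _)) => //.
rewrite -[leRHS]adde0; apply: leeD => //.
by rewrite le_eqVlt; apply/orP; left; apply/eqP; exact: Z0.
Qed.

Section weak_type.
Context (R : realType) (n : nat).
Local Notation mu := (lebesgue_rV R n).
Local Notation L2 := (Lfun mu 2%:E).
Local Notation "'rv'" := ('rV[R]_n).
Local Notation dil := (@dil R n).
Local Notation cell := (@cell R n).
Variables (T : (rv -> R) -> rv -> R) (K : rv -> rv -> R).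
Implicit Types (x y : rv) (q : int * 'rV[int]_n).
Hypothesis n_gt0 : (0 < n)%N.
Hypothesis HT : L2_bounded_linear T.
Hypothesis HTK : associated_kernel T K.
Variables (eps CK : R).
Hypothesis HK : sup_kernel K eps CK.
Variable N : nat.
Hypothesis N2n : (2 * n < N)%N.
Hypothesis N1 : (1 < N)%N.

Let CK0 : 0 <= CK. Proof. by case: HK. Qed.
Let eps0 : 0 < eps. Proof. by case: HK. Qed.
Let N0 : (0 < N)%N. Proof. exact: ltn_trans N1. Qed.
Let Cw0 : 0 <= Cweight n eps.
Proof.
rewrite /Cweight divr_ge0 ?exprn_ge0// subr_ge0.
by have /andP[_ /ltW] := ratio_lt1 eps0.
Qed.

Lemma weight_int q : (\int[mu]_y weight eps N q y <= (Cweight n eps)%:E)%E.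
Proof.
have -> : (\int[mu]_y weight eps N q y =
    \int[mu]_y (weight eps N q y * `|cst (1 : R) y|%:E))%E.
  by apply: eq_integral => y _; rewrite /= normr1 mule1.
rewrite -[Cweight _ _]mulr1; apply: integral_weight => // i.
rewrite (eq_integral (cst 1%E)); last by move=> y _; rewrite /= normr1.
by rewrite integral_cst//; exact: measurable_dil.
Qed.

Section czbad_bound.
Variables (h : rv -> R) (l : R).
Hypothesis Lh : h \in L2.
Hypothesis ih : mu.-integrable setT (EFin \o h).
Hypothesis l0 : 0 < l.

(** The existential over [W] treats uniformly the indices padded by the empty set, where the bad
    part vanishes, and the genuine cells, where [W] is [weight]. *)
Lemma czbad_weight j : exists W : rv -> \bar R, [/\ measurable_fun setT W,
  forall x, (0 <= W x)%E, (\int[mu]_x W x <= (Cweight n eps)%:E)%E &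
  {ae mu, forall x, ~ Omega_star N h l x -> (`|T (czbad h l j) x|%:E <=
     CK%:E * \int[mu]_y `|czbad h l j y|%:E * W x)%E}].
Proof.
have [E0|[q [Pq Eq]]] := czcell_cases h l j.
  exists (cst 0%E); split=> //; first by rewrite integral0_eq// lee_fin.
  have b0 : sqnorm mu (czbad h l j) = 0%E.
    apply: integral0_eq => y _.
    by rewrite /czbad E0 indicE memNset// mulr0 expr0n.
  have := T_ae0 HT (czbad_L2 l Lh j) b0; apply: filterS => x -> _.
  by rewrite normr0 mule0.
exists (weight eps N q); split.
- exact: measurable_weight.
- exact: weight_ge0.
- exact: weight_int.
have b0 y : ~ cell q y -> czbad h l j y = 0.
  by move=> qy; rewrite /czbad Eq indicE memNset// mulr0.
have := T_atom HTK HK N2n N1 (czbad_L2 l Lh j) b0 (czbad_int0 l Lh j).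
apply: filterS => x Hx nO; apply: Hx => qx; apply: nO; by exists q.
Qed.

End czbad_bound.

(** The level is split in thirds between the good part, the finitely many bad parts outside
    [Omega_star], and the tail; [C1] and [C3] carry the resulting 9 and 3, while [C2] pays for
    [Omega_star]. The tail contributes an arbitrary e. *)
Lemma weak_type : exists C : R, 0 <= C /\ forall (h : rv -> R) (l : R),
  h \in L2 -> mu.-integrable setT (EFin \o h) -> 0 < l ->
  (l%:E * mu [set x | (l < `|T h x|)%R] <= C%:E * absint h setT)%E.
Proof.
have [M [M0 HM]] := T_cheb HT.
pose C1 : R := 9 * M * (2 + 2 ^+ n * 2 ^+ n).
pose C2 : R := (2 * N).+1%:R ^+ n.
pose C3 : R := 6 * CK * Cweight n eps.
have C10 : 0 <= C1 by rewrite /C1 !mulr_ge0// addr_ge0// mulr_ge0// exprn_ge0.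
have C20 : 0 <= C2 by rewrite /C2 exprn_ge0.
have C30 : 0 <= C3 by rewrite /C3; exact: mulr_ge0 (mulr_ge0 _ CK0) Cw0.
have CKCw0 : 0 <= CK * Cweight n eps by exact: mulr_ge0.
exists (C1 + C2 + C3); split; first by rewrite !addr_ge0.
move=> h l Lh ih l0.
have HE := absintT_fin ih; set H := fine (absint h setT) in HE *.
have H0 : 0 <= H by rewrite fine_ge0// absint_ge0.
rewrite HE -EFinM; apply/lee_addgt0Pr => e e0.
have l30 : 0 < l / 3 by rewrite divr_gt0.
(* Makes the Chebyshev bound for the tail at level l/3 at most e / l; the added 1 covers M = 0. *)
pose e' := e * l / (9 * M + 1).
have M90 : 0 < 9 * M + 1 by rewrite ltr_wpDl// mulr_ge0.
have e'0 : 0 < e' by rewrite /e' !divr_gt0 ?mulr_gt0.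
have [J HJ] := sqnorm_cztail l Lh e'0.
have [W HW] := choice (czbad_weight l Lh).
have mW j : measurable_fun setT (W j) by case: (HW j).
have W0 j x : (0 <= W j x)%E by case: (HW j).
pose g := czgood h l J.
pose tl y := h y * \1_(cztail h l J) y.
have Lg : g \in L2 by exact: czgood_L2.
have mtail : measurable (cztail h l J).
  by apply: bigcup_measurable => j _; exact: measurable_czcell.
have Ltl : tl \in L2 by exact: L2_mulI.
have Lb j : czbad h l j \in L2 by exact: czbad_L2.
pose a (j : nat) := (\int[mu]_y `|czbad h l j y|%:E)%E.
have a0 j : (0 <= a j)%E by apply: integral_ge0.
pose Phi x : \bar R := (\sum_(j < J) (CK%:E * a j * W j x))%E.
have Ca0 j : (0 <= CK%:E * a j)%E by rewrite mule_ge0.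
have mt j : measurable_fun setT (fun x => CK%:E * a j * W j x)%E.
  by apply: emeasurable_funM.
have mPhi : measurable_fun setT Phi by apply: emeasurable_sum => j.
have Phi0 x : (0 <= Phi x)%E by apply: sume_ge0 => j _; rewrite mule_ge0.
have intPhi : (\int[mu]_x Phi x <= (2 * CK * Cweight n eps * H)%:E)%E.
  rewrite ge0_integral_sum//; last by move=> j x _; rewrite mule_ge0.
  apply: (@le_trans _ _ (\sum_(j < J) ((CK * Cweight n eps * 2)%:E *
      absint h (czcell h l j)))%E).
    apply: lee_sum => j _; rewrite ge0_integralZl//.
    have [_ _ hW _] := HW j.
    apply: (@le_trans _ _ (CK%:E * a j * (Cweight n eps)%:E)%E).
      by rewrite lee_wpmul2l.
    rewrite muleAC -EFinM [X in (_ <= X * _)%E]EFinM -[leRHS]muleA.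
    by rewrite lee_wpmul2l ?lee_fin//; exact: czbad_abs.
  rewrite -ge0_sume_distrr; last by move=> j _; exact: absint_ge0.
  rewrite (_ : 2 * CK * Cweight n eps * H = CK * Cweight n eps * 2 * H); last by ring.
  rewrite [leRHS]EFinM -HE lee_wpmul2l//; last exact: czbad_sum.
  by rewrite lee_fin; exact: mulr_ge0 CKCw0 _.
pose A1 := [set x | l / 3 < `|T g x|].
pose A2 := Omega_star N h l.
pose A3 := [set x | ((l / 3)%:E <= Phi x)%E].
pose A4 := [set x | l / 3 < `|T tl x|].
have mA1 : measurable A1 by exact: measurable_gt (T_meas HT Lg).
have mA2 : measurable A2 by exact: measurable_Omega_star.
have mA3 : measurable A3.
  by rewrite -[A3]setTI; exact: emeasurable_fun_c_infty.
have mA4 : measurable A4 by exact: measurable_gt (T_meas HT Ltl).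
have cover : (mu [set x | (l < `|T h x|)%R] <= mu A1 + mu A2 + mu A3 + mu A4)%E.
  apply: (@le_trans _ _ (mu (A1 `|` A2 `|` A3 `|` A4))); last first.
    apply: (le_trans (measureU2 _ _ _)) => //; first by do 2 apply: measurableU => //.
    apply: leeD => //; apply: (le_trans (measureU2 _ _ _)) => //.
      exact: measurableU.
    by apply: leeD => //; exact: measureU2.
  apply: measure_ae_le; first exact: measurable_gt (T_meas HT Lh).
    by do 3 apply: measurableU => //.
  have aeb : {ae mu, forall x (j : nat), ~ Omega_star N h l x ->
      (`|T (czbad h l j) x|%:E <= CK%:E * a j * W j x)%E}.
    by apply: ae_foralln => j; case: (HW j).
  have Lsum : (fun y => \sum_(j < J) czbad h l j y) \in L2 by exact: L2_sum.
  have aeT : {ae mu, forall x, T h x = T g x + (\sum_(j < J) T (czbad h l j) x + T tl x)}.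
    have E1 := T_sum HT (index_enum 'I_J) (fun j : 'I_J => Lb j).
    have Lst : (fun y => (\sum_(j < J) czbad h l j y) + tl y) \in L2.
      rewrite (_ : (fun y => _) = fun y => 1 * (\sum_(j < J) czbad h l j y) + tl y).
        exact: L2_lin.
      by apply/funext => y; rewrite mul1r.
    have E2 := T_add HT Lsum Ltl.
    have E3 := T_add HT Lg Lst.
    have hE : (fun y => g y + (\sum_(j < J) czbad h l j y + tl y)) = h.
      by apply/funext => y; rewrite -cz_decomposition.
    rewrite hE in E3.
    by apply: filterS3 E1 E2 E3 => x e1 e2 e3; rewrite e3 e2 e1.
  apply: filterS2 aeb aeT => x Hb HTx /= lx.
  apply: contrapT => /not_orP[/not_orP[/not_orP[n1 n2] n3] n4].
  have {}n1 : `|T g x| <= l / 3 by rewrite leNgt; exact/negP.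
  have {}n4 : `|T tl x| <= l / 3 by rewrite leNgt; exact/negP.
  have {}n3 : (Phi x < (l / 3)%:E)%E by rewrite ltNge; exact/negP.
  have n3' : `|\sum_(j < J) T (czbad h l j) x| < l / 3.
    rewrite -lte_fin; apply: le_lt_trans n3.
    apply: (@le_trans _ _ (\sum_(j < J) `|T (czbad h l j) x|)%:E).
      by rewrite lee_fin ler_norm_sum.
    by rewrite -sumEFin; apply: lee_sum => j _; exact: Hb.
  move: lx; rewrite HTx ltNge => /negP; apply.
  rewrite (le_trans (ler_normD _ _))//.
  have := ler_normD (\sum_(j < J) T (czbad h l j) x) (T tl x).
  move: n1 n4 n3'; lra.
have c1 : (mu A1 <= (C1 * H / l)%:E)%E.
  have := HM g (l / 3) Lg (ltW l30).
  have := sqnorm_czgood n_gt0 Lh ih l0 J; rewrite HE -EFinM => hg h1.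
  have {h1}: (((l / 3) ^+ 2)%:E * mu A1 <= (M * ((2 * l + 2 ^+ n * l * 2 ^+ n) * H))%:E)%E.
    by apply: (le_trans h1); rewrite EFinM lee_wpmul2l// lee_fin.
  move=> /lee_divr -/(_ (exprn_gt0 _ l30)) /le_trans; apply.
  by rewrite lee_fin le_eqVlt; apply/orP; left; apply/eqP; rewrite /C1; field; rewrite gt_eqF.
have c2 : (mu A2 <= (C2 * H / l)%:E)%E.
  by apply: lee_divr => //; rewrite EFinM -HE; exact: mu_Omega_star.
have c3 : (mu A3 <= (C3 * H / l)%:E)%E.
  have : ((l / 3)%:E * mu A3 <= (2 * CK * Cweight n eps * H)%:E)%E.
    by apply: le_trans intPhi; apply: markov_setT => //; exact: ltW.
  move=> /lee_divr -/(_ l30) /le_trans; apply.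
  by rewrite lee_fin le_eqVlt; apply/orP; left; apply/eqP; rewrite /C3; field; rewrite gt_eqF.
have c4 : (mu A4 <= (e / l)%:E)%E.
  have := HM tl (l / 3) Ltl (ltW l30) => h1.
  have {h1}: (((l / 3) ^+ 2)%:E * mu A4 <= (M * e')%:E)%E.
    by apply: (le_trans h1); rewrite EFinM lee_wpmul2l// lee_fin.
  move=> /lee_divr -/(_ (exprn_gt0 _ l30)) /le_trans; apply.
  rewrite lee_fin /e'.
  have -> : M * (e * l / (9 * M + 1)) / (l / 3) ^+ 2 = (9 * M / (9 * M + 1)) * (e / l).
    by field; rewrite !gt_eqF.
  rewrite ler_piMl ?divr_ge0 ?(ltW e0) ?(ltW l0)// ler_pdivrMr// mul1r.
  by rewrite lerDl.
have : (mu [set x | (l < `|T h x|)%R] <= (((C1 + C2 + C3) * H + e) / l)%:E)%E.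
  apply: (le_trans cover).
  rewrite (_ : ((C1 + C2 + C3) * H + e) / l =
      C1 * H / l + C2 * H / l + C3 * H / l + e / l); last by field; rewrite gt_eqF.
  by rewrite !EFinD !leeD.
move=> hfin; apply: (@le_trans _ _ (l%:E * (((C1 + C2 + C3) * H + e) / l)%:E)%E).
  by rewrite lee_wpmul2l// lee_fin ltW.
by rewrite -EFinM -EFinD lee_fin mulrCA mulfV ?mulr1// gt_eqF.
Qed.

End weak_type.

(** * One step of the stopping-time argument *)

Section local_step.
Context (R : realType) (n : nat).
Local Notation mu := (lebesgue_rV R n).
Local Notation L2 := (Lfun mu 2%:E).
Local Notation "'rv'" := ('rV[R]_n).
Local Notation dil := (@dil R n).
Local Notation cell := (@cell R n).
Variables (T : (rv -> R) -> rv -> R) (K : rv -> rv -> R).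
Implicit Types (x y : rv) (q P Q : int * 'rV[int]_n) (f h : rv -> R).
Hypothesis n_gt0 : (0 < n)%N.
Hypothesis HT : L2_bounded_linear T.
Hypothesis HTK : associated_kernel T K.
Variables (eps CK : R).
Hypothesis HK : sup_kernel K eps CK.
Variable N : nat.
Hypothesis N2n : (2 * n < N)%N.
Hypothesis N1 : (1 < N)%N.

Let CK0 : 0 <= CK. Proof. by case: HK. Qed.
Let eps0 : 0 < eps. Proof. by case: HK. Qed.
Let N0 : (0 < N)%N. Proof. exact: ltn_trans N1. Qed.
Let Cw0 : 0 <= Cweight n eps.
Proof.
rewrite /Cweight divr_ge0 ?exprn_ge0// subr_ge0.
by have /andP[_ /ltW] := ratio_lt1 eps0.
Qed.

Lemma exceptional_set (delta : R) : 0 < delta -> exists A : R, 0 < A /\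
  forall h (l m : R), h \in L2 -> mu.-integrable setT (EFin \o h) ->
  0 <= l -> 0 <= m -> (absint h setT <= (l * m)%:E)%E ->
  exists E : set rv, [/\ measurable E, (mu E <= (delta * m)%:E)%E,
    {ae mu, forall x, ~ E x -> `|T h x| <= A * l} &
    forall x k, ~ E x ->
     (absint h (dil N (k, gen k x)) <= (A * l)%:E * mu (dil N (k, gen k x)))%E].
Proof.
move=> d0; have [C [C0 HC]] := weak_type n_gt0 HT HTK HK N2n N1.
pose C2 : R := (2 * N).+1%:R ^+ n.
have C20 : 0 <= C2 by rewrite /C2 exprn_ge0.
pose A := (C + C2 + 1) / delta.
have A0 : 0 < A by rewrite divr_gt0// ltr_wpDl// addr_ge0.
(* The weak bound needs a positive level. If l = 0 then h vanishes almost everywhere and so does T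
   h, and the empty exceptional set works. *)
exists A; split=> // h l m Lh ih; rewrite le_eqVlt => /orP[/eqP <-|l0] m0 Hh.
  have h0 : (absint h setT = 0)%E.
    by apply/eqP; rewrite eq_le absint_ge0 andbT (le_trans Hh)// mul0r.
  exists set0; split => //.
  - by rewrite measure0 lee_fin mulr_ge0// ltW.
  - have ae0 : {ae mu, forall x, setT x -> `|h x|%:E = 0%E}.
      have := (ae_eq_integral_abs mu measurableT (measurable_int mu ih)).1.
      move=> /(_ h0); apply: filterS => x /(_ I) /= [] ->; by rewrite normr0.
    have : sqnorm mu h = 0%E.
      rewrite /sqnorm (ae_eq_integral (cst 0%E))//; first by rewrite integral0.
        exact: measurable_sq (L2_meas Lh).
      apply: filterS ae0 => x + _ => /(_ I) [] /eqP; rewrite normr_eq0 => /eqP ->.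
      by rewrite expr0n.
    move=> /(T_ae0 HT Lh); apply: filterS => x -> _; by rewrite normr0 mulr0.
  - move=> x k _; rewrite mulr0 mul0e -h0.
    by apply: absint_le => //; exact: measurable_dil.
have Al0 : 0 < A * l by rewrite mulr_gt0.
have small c : 0 <= c -> c <= C + C2 -> forall S : set rv,
    ((A * l)%:E * mu S <= c%:E * absint h setT)%E ->
    (mu S <= (c / (C + C2 + 1) * (delta * m))%:E)%E.
  move=> c0 cC S HS.
  have : ((A * l)%:E * mu S <= (c * (l * m))%:E)%E.
    by apply: (le_trans HS); rewrite EFinM lee_wpmul2l// lee_fin.
  move=> /lee_divr -/(_ Al0) /le_trans; apply.
  rewrite lee_fin le_eqVlt; apply/orP; left; apply/eqP; rewrite /A.
  by field; rewrite !gt_eqF// ltr_wpDl// addr_ge0.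
exists ([set x | A * l < `|T h x|] `|` Omega_star N h (A * l)); split.
- by apply: measurableU; [exact: measurable_gt (T_meas HT Lh)|exact: measurable_Omega_star].
- apply: (le_trans (measureU2 _ _ _)).
  + exact: measurable_gt (T_meas HT Lh).
  + exact: measurable_Omega_star.
  apply: (@le_trans _ _ ((C / (C + C2 + 1) * (delta * m)) +
      (C2 / (C + C2 + 1) * (delta * m)))%:E).
    rewrite EFinD; apply: leeD; apply: small => //.
    * by rewrite lerDl.
    * exact: HC.
    * by rewrite lerDr.
    * exact: mu_Omega_star.
  rewrite lee_fin -mulrDl -mulrDl ler_piMl ?mulr_ge0 ?(ltW d0)//.
  rewrite ler_pdivrMr ?mul1r ?lerDl//.
  by rewrite ltr_wpDl// addr_ge0.
- by apply/aeW => x /not_orP[h1 _]; rewrite leNgt; exact/negP.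
- by move=> x k /not_orP[_ h2]; exact: Omega_star_average.
Qed.

Definition cmean f q : R := mean (dil N q) f.
Definition locf f q y : R := (f y - cmean f q) * \1_(dil N q) y.
Definition oscN f q : R := osc (dil N q) f.

Section fixed_f.
Variable f : rv -> R.
Hypothesis Lf : f \in L2.

Let mf : measurable_fun setT f := L2_meas Lf.

Lemma dil_mu_bounds q : (0 < mu (dil N q) < +oo)%E.
Proof.
by rewrite mu_dil_lty andbT mu_dil lte_fin exprn_gt0// mulr_gt0// side_gt0.
Qed.

Lemma int_dil q : mu.-integrable (dil N q) (EFin \o f).
Proof. by apply: L2_integrable => //; [exact: measurable_dil|exact: mu_dil_lty]. Qed.

Lemma locf_L2 q : locf f q \in L2.
Proof.
rewrite (_ : locf f q = fun y => - cmean f q * \1_(dil N q) y + f y * \1_(dil N q) y).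
  apply: L2_lin; last exact: L2_mulI Lf (@measurable_dil R n N q).
  by apply: L2_indic; [exact: measurable_dil|exact: mu_dil_lty].
by apply/funext => y; rewrite /locf mulrBl addrC mulNr.
Qed.

Lemma locf_out q y : ~ dil N q y -> locf f q y = 0.
Proof. by move=> nq; rewrite /locf indicE memNset// mulr0. Qed.

Lemma locf_in q y : dil N q y -> locf f q y = f y - cmean f q.
Proof. by move=> hq; rewrite /locf indicE mem_set// mulr1. Qed.

Lemma locf_int q : mu.-integrable setT (EFin \o locf f q).
Proof.
apply: (L2_integrable_supp (locf_L2 q) _ _ (@locf_out q)).
  exact: measurable_dil.
exact: mu_dil_lty.
Qed.

Lemma absint_locf q A : A `<=` dil N q ->
  (absint (locf f q) A = \int[mu]_(y in A) `|f y - cmean f q|%:E)%E.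
Proof.
by move=> Aq; apply: eq_integral => y /set_mem /Aq yq; rewrite locf_in.
Qed.

Lemma oscNE q : ((oscN f q)%:E * mu (dil N q) =
  \int[mu]_(y in dil N q) `|f y - cmean f q|%:E)%E.
Proof.
apply: oscE; [exact: measurable_dil|exact: dil_mu_bounds|exact: int_dil].
Qed.

Lemma oscN_ge0 q : 0 <= oscN f q.
Proof. exact: osc_ge0. Qed.

Lemma absint_locfT q : (absint (locf f q) setT = (oscN f q)%:E * mu (dil N q))%E.
Proof.
rewrite oscNE -absint_locf// /absint [RHS]integral_mkcond; apply: eq_integral => y _.
rewrite patchE; case: ifPn => //; rewrite notin_setE => /locf_out ->.
by rewrite normr0.
Qed.

Lemma dil_bounded P Q : exists M, dil N Q `<=` dil M P.
Proof.
pose r := N.+1%:R * side R Q.1 + `|corner R Q - corner R P|.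
have s0 := side_gt0 R P.1.
exists (Num.bound (r / side R P.1)) => y /dil_dist yQ.
apply: contrapT => /ndil_dist; apply/negP; rewrite -ltNge.
have := le_lt_trans (ler_distD (corner R Q) y (corner R P)).
apply; apply: (@le_lt_trans _ _ r); first by rewrite lerD2r.
rewrite -ltr_pdivrMr//; apply: le_lt_trans (archi_boundP _); first by [].
by rewrite divr_ge0 ?(ltW s0)// addr_ge0// mulr_ge0// ltW// side_gt0.
Qed.

(** One average bound serves twice: it makes the jump between the two means at most c and, through
    [mean_osc], bounds the oscillation on the smaller enlargement. *)
Lemma cmean_near P Q (c : R) : dil N P `<=` dil N Q ->
  (absint (locf f Q) (dil N P) <= c%:E * mu (dil N P))%E ->
  `|cmean f P - cmean f Q| <= c /\ oscN f P <= 2 * c.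
Proof.
move=> PQ; rewrite absint_locf// => H.
have mP : measurable (dil N P) by exact: measurable_dil.
have [d0 doo] := andP (dil_mu_bounds P).
have dfin : mu (dil N P) \is a fin_num by rewrite ge0_fin_numE.
split.
  have := le_trans (mean_sub (cmean f Q) mP (dil_mu_bounds P) (int_dil P)) H.
  by rewrite lee_pmul2r// lee_fin.
have := mean_osc (cmean f Q) mP (dil_mu_bounds P) (int_dil P).
rewrite -/(cmean f P) -oscNE => /le_trans.
move=> /(_ ((2 * c)%:E * mu (dil N P))%E); rewrite lee_pmul2r// lee_fin; apply.
by rewrite EFinM -muleA lee_wpmul2l.
Qed.

Lemma locf_split P Q : dil N P `<=` dil N Q -> locf f Q =
  (fun y => (cmean f P - cmean f Q) * \1_(dil N P) y +
     (locf f P y + locf f Q y * \1_(~` dil N P) y)).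
Proof.
move=> PQ; apply/funext => y; rewrite !indicE.
have [yP|yP] := pselect (dil N P y).
  rewrite (mem_set yP) memNset; last exact.
  by rewrite /= mulr1 mulr0 !locf_in//; [ring|exact: PQ].
by rewrite (memNset yP) mem_set// (locf_out yP) /= mulr0 mulr1 !add0r.
Qed.

End fixed_f.

Hypothesis HT1 : T1_eq0_BMO T K.

Let step_constant (a b o c : R) :
  (a + a * (2 * a) + a * c + b + b + a * c + a) * o =
  a * o + a * (2 * (a * o)) + a * o * c + b * o + b * o + a * o * c + a * o.
Proof. ring. Qed.

Let step_bound (t z w b c : R) : 0 <= z ->
  z * c + (t + (b + (b + (z + w + z * c)))) <= t + (z + w + z * c + b + b + z * c + z).
Proof. lra. Qed.

Lemma local_step (delta : R) : 0 < delta <= 4^-1 -> exists C : R, 0 <= C /\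
  forall f, f \in L2 -> exists E : int * 'rV[int]_n -> set rv,
  [/\ forall q, measurable (E q), forall q, (mu (E q) <= delta%:E * mu (cell q))%E,
    forall q, {ae mu, forall x, ~ E q x -> `|T (locf f q) x| <= C * oscN f q} &
    forall P Q, Q.1 <= P.1 -> cell P `<=` cell Q ->
      (mu (cell P `&` E Q) <= (4^-1)%:E * mu (cell P))%E ->
      {ae mu, forall x, cell P x ->
        `|T (locf f Q) x| <= `|T (locf f P) x| + C * oscN f Q}].
Proof.
move=> /andP[d0 d4]; have [A [A0 HA]] := exceptional_set d0.
have [C1 [C10 HC1]] := T1_bounded n_gt0 HT HTK HK N2n N1 HT1.
pose a : R := A * (2 * N).+1%:R ^+ n.
have a0 : 0 <= a by rewrite /a mulr_ge0 ?exprn_ge0// ltW.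
pose b : R := CK * (Cweight n eps * (2 ^+ n * a)).
have b0 : 0 <= b.
  by apply: mulr_ge0 => //; apply: mulr_ge0 => //; rewrite mulr_ge0 ?exprn_ge0.
pose C := (a + a * (2 * a) + a * C1 + b) + b + a * C1 + a.
have aC0 : 0 <= a * C1 by exact: mulr_ge0.
have aa0 : 0 <= a * (2 * a) by apply: mulr_ge0 => //; exact: mulr_ge0.
have C0 : 0 <= C by rewrite /C !addr_ge0.
have aC : a <= C by rewrite /C lerDr !addr_ge0.
exists C; split => // f Lf.
have HE q : exists E : set rv, [/\ measurable E, (mu E <= delta%:E * mu (cell q))%E,
    {ae mu, forall x, ~ E x -> `|T (locf f q) x| <= a * oscN f q} &
    forall x k, ~ E x -> (absint (locf f q) (dil N (k, gen k x)) <=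
      (a * oscN f q)%:E * mu (dil N (k, gen k x)))%E].
  (* The L^1 norm of [locf f q] is the oscillation times the volume of [dil N q]. Taking m to be the
     volume of q moves the ratio (2N+1)^n into the level, hence into [a]. *)
  have [|||E [mE muE E1 E2]] := HA (locf f q) ((2 * N).+1%:R ^+ n * oscN f q)
      (side R q.1 ^+ n) (locf_L2 Lf q) (locf_int Lf q).
  - by rewrite mulr_ge0 ?exprn_ge0// oscN_ge0.
  - by rewrite exprn_ge0// ltW// side_gt0.
  - rewrite absint_locfT// mu_dil -EFinM exprMn lee_fin; lra.
  exists E; split => //.
  - by rewrite mu_cell -EFinM.
  - by apply: filterS E1 => x; rewrite mulrA.
  - by move=> x k /E2 => /(_ k); rewrite mulrA.
clearbody a.
have [E {}HE] := choice HE.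
exists E; split.
- by move=> q; case: (HE q).
- by move=> q; case: (HE q).
- move=> q; case: (HE q) => _ _ h _; apply: filterS h => x h /h /le_trans; apply.
  by rewrite ler_wpM2r ?oscN_ge0.
move=> P Q QP PQ HPE.
have [mEQ muEQ aeQ avQ] := HE Q; have [mEP muEP aeP avP] := HE P.
set o := oscN f Q; have o0 : 0 <= o by exact: oscN_ge0.
have mP : measurable (cell P) by exact: measurable_cell.
pose h' y := locf f Q y * \1_(~` dil N P) y.
have mdP : measurable (dil N P) by exact: measurable_dil.
have Lh' : h' \in L2 by apply: L2_mulI; [exact: locf_L2|exact: measurableC].
(* At most 1/4 of P lies in E Q and at most 1/4 in E P, so points outside both exist. Avoiding E P
   is needed to bound T of [locf f P] at the comparison point. *)
have small : (mu (cell P `&` (E Q `|` E P)) < mu (cell P))%E.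
  apply: (@le_lt_trans _ _ ((4^-1)%:E * mu (cell P) + delta%:E * mu (cell P))%E).
    rewrite setIUr; apply: (le_trans (measureU2 _ _ _)); [exact: measurableI..|].
    apply: leeD => //; apply: le_trans muEP.
    by apply: le_measure; rewrite ?inE//; exact: measurableI.
  rewrite mu_cell -!EFinM -EFinD lte_fin -mulrDl.
  have sn : 0 < side R P.1 ^+ n by rewrite exprn_gt0// side_gt0.
  by rewrite gtr_pMl//; move: d4; lra.
have [x0 [Px0 nEx0 _]] : exists x, [/\ cell P x, ~ (E Q `|` E P) x & True].
  by apply: (@ae_exists _ _ _ mu (fun=> True)) => //; [exact: aeW|exact: measurableU].
have Q_x0 : Q = (Q.1, gen Q.1 x0) by exact/cell_inj/PQ.
have P_x0 : P = (P.1, gen P.1 x0) by exact/cell_inj.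
have dPQ : dil N P `<=` dil N Q.
  by move=> y yP; rewrite Q_x0; apply: (gen_le_near QP); rewrite -P_x0.
have nEQ : ~ E Q x0 by move=> h; apply: nEx0; left.
have [cPQ oP] : `|cmean f P - cmean f Q| <= a * o /\ oscN f P <= 2 * (a * o).
  by apply: cmean_near => //; rewrite P_x0; exact: avQ.
have [M QM] := dil_bounded P Q.
have [v Hv] : exists v, {ae mu, forall x, cell P x ->
    `|T h' x - v| <= CK * (Cweight n eps * (2 ^+ n * (a * o)))}.
  apply: (T_osc HTK HK N2n N1 (M := M)) => //.
  - by move=> y yP; rewrite /h' indicE memNset ?mulr0//; exact.
  - by move=> y nM; rewrite /h' locf_out ?mul0r// => /QM.
  - by apply: mulr_ge0; [rewrite exprn_ge0|exact: mulr_ge0].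
  move=> i; have mLQ := L2_meas (locf_L2 Lf Q).
  have mi : measurable (dil (N * 2 ^ i.+1) P) by exact: measurable_dil.
  apply: (@le_trans _ _ (absint (locf f Q) (dil (N * 2 ^ i.+1) P))).
    apply: ge0_le_integral => //.
    - by apply: measurable_funTS; apply: measurable_absE; exact: (L2_meas Lh').
    - by apply: measurable_funTS; exact: measurable_absE.
    - move=> y _; rewrite lee_fin /h' normrM ler_piMr// indicE.
      by case: (_ \in _); rewrite ?normr1 ?normr0.
  (* The shell lies in the enlargement of this ancestor, which may exceed Q: the averages at x0 are
     controlled at every generation. The factor 2^n comes from (2N+1) p <= 2 (2Np + 1) for p =
     2^(i+1). *)
  pose P' := (P.1 - i.+1%:Z, gen (P.1 - i.+1%:Z) x0).
  apply: (@le_trans _ _ (absint (locf f Q) (dil N P'))).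
    apply: absint_le => //; [exact: locf_int|exact: measurable_dil|].
    by rewrite [X in dil _ X]P_x0; exact: dil_parent.
  apply: (le_trans (avQ _ _ nEQ)); rewrite !mu_dil -!EFinM lee_fin sideB.
  rewrite -/o [2 ^+ n * (a * o)]mulrC -[leRHS]mulrA -exprMn.
  apply: ler_wpM2l; first exact: mulr_ge0.
  have s0 := side_gt0 R P.1; rewrite lerXn2r ?nnegrE ?mulr_ge0 ?(ltW s0)//.
  rewrite !mulrA ler_wpM2r ?(ltW s0)// -natrX -!natrM ler_nat.
  move: (2 ^ i.+1)%N => p; have h : (p <= N * p)%N by rewrite leq_pmull.
  rewrite mulSn -mulnA; move: (N * p)%N h => z h; clear -h; lia.
pose B := CK * (Cweight n eps * (2 ^+ n * (a * o))).
have bB : b * o = B by rewrite /b /B; ring.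
have L1P : (\1_(dil N P) : rv -> R) \in L2 by apply: L2_indic => //; exact: mu_dil_lty.
have aeT : {ae mu, forall x, T (locf f Q) x = (cmean f P - cmean f Q) * T (\1_(dil N P)) x +
    (T (locf f P) x + T h' x)}.
  have LP := locf_L2 Lf P.
  have LPh : (fun y => locf f P y + h' y) \in L2.
    rewrite (_ : (fun y => _) = fun y => 1 * locf f P y + h' y); first exact: L2_lin.
    by apply/funext => y; rewrite mul1r.
  have E1 := T_lin HT (cmean f P - cmean f Q) L1P LPh.
  have E2 := T_add HT LP Lh'.
  rewrite (locf_split f dPQ).
  by apply: filterS2 E1 E2 => x -> ->.
have aeD : {ae mu, forall x, cell P x ->
    `|T (locf f Q) x - (T (locf f P) x + T h' x)| <= a * o * C1}.
  apply: filterS2 aeT (HC1 P) => x -> H1 Px; rewrite addrK normrM ler_pM//.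
  exact: H1.
(* A second point is needed: [v] was obtained from the averages at x0, and the bounds relating it to
   T hold only almost everywhere. *)
have [x1 [Px1 nEx1 [aeQ1 aeP1 aeD1 Hv1]]] : exists x, [/\ cell P x, ~ (E Q `|` E P) x &
    [/\ ~ E Q x -> `|T (locf f Q) x| <= a * oscN f Q,
        ~ E P x -> `|T (locf f P) x| <= a * oscN f P,
        cell P x -> `|T (locf f Q) x - (T (locf f P) x + T h' x)| <= a * o * C1 &
        cell P x -> `|T h' x - v| <= B]].
  apply: (ae_exists _ mP (measurableU _ _ mEQ mEP) small).
  have a1 : {ae mu, forall x, (~ E Q x -> `|T (locf f Q) x| <= a * oscN f Q) /\
      (~ E P x -> `|T (locf f P) x| <= a * oscN f P)} by apply: filterS2 aeQ aeP.
  by apply: filterS3 a1 aeD Hv => x [].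
have {}aeQ1 := aeQ1 (fun ex => nEx1 (or_introl ex)).
have {}aeP1 := aeP1 (fun ex => nEx1 (or_intror ex)).
have {}aeD1 := aeD1 Px1; have {}Hv1 := Hv1 Px1.
have aP : a * oscN f P <= a * (2 * (a * o)) := ler_wpM2l a0 oP.
apply: filterS2 aeD Hv => x aeDx Hvx Px; have {}aeDx := aeDx Px; have {}Hvx := Hvx Px.
have B0 : 0 <= a * o by exact: mulr_ge0.
have n1 := ler_normD (T (locf f Q) x - (T (locf f P) x + T h' x)) (T (locf f P) x + T h' x).
rewrite subrK in n1.
have n2 := ler_normD (T (locf f P) x) (T h' x).
have n3 := ler_normD (T h' x - v) v; rewrite subrK in n3.
have n4 := ler_normD (v - T h' x1) (T h' x1); rewrite subrK distrC in n4.
(* The far part is never estimated directly: its value at x1 is the difference of two local terms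
   bounded there, up to the multiple of T of the indicator. *)
have n5 : `|T h' x1| <= `|T (locf f Q) x1| + `|T (locf f P) x1| + a * o * C1.
  have -> : T h' x1 = T (locf f Q) x1 - T (locf f P) x1 -
     (T (locf f Q) x1 - (T (locf f P) x1 + T h' x1)) by rewrite opprB addrCA; ring.
  apply: (le_trans (ler_normB _ _)); apply: lerD => //.
  exact: ler_normB.
rewrite -/o in aeQ1; rewrite -/B in Hvx.
have CE : C * o = (a * o + a * (2 * (a * o)) + a * o * C1 + B) + B + a * o * C1 + a * o.
  by rewrite -bB /C step_constant.
apply: (le_trans n1); apply: (le_trans (lerD aeDx (le_trans n2 (lerD (lexx _) n3)))).
have h1 := lerD Hvx (le_trans n4 (lerD Hv1 (le_trans n5 (lerD (lerD aeQ1 (le_trans aeP1 aP)) (lexx _))))).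
apply: (le_trans (lerD (lexx _) (lerD (lexx _) h1))).
by rewrite CE; exact: step_bound.
Qed.

End local_step.

(** * The tree of stopping cells *)

Section chains.
Context (R : realType) (n : nat).
Implicit Types (x : 'rV[R]_n) (q : int * 'rV[int]_n).

(* The cells whose closure contains the origin. Those with a given index m are
   nested and exhaust one orthant, so cells of distinct m never meet. *)
Definition chain q : Prop := forall i, q.2 ord0 i = 0 \/ q.2 ord0 i = -1.

(** 0 and -1 are the fixed points of halving followed by floor, so an index equal to one of them
    persists at all coarser generations. *)
Lemma floor_chain (j k : int) (t : R) : j <= k ->
  Num.floor (2 ^ k * t) = 0 \/ Num.floor (2 ^ k * t) = -1 ->
  Num.floor (2 ^ j * t) = Num.floor (2 ^ k * t).
Proof.
move=> jk.
have [p ->] : exists p : nat, k = j + p%:Z by exists `|k - j|%N; lia.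
rewrite exp2D; set a := 2 ^ j * t.
have -> : 2 ^ j * 2 ^+ p * t = 2 ^+ p * a by rewrite /a; ring.
have p1 : (1 : R) <= 2 ^+ p by rewrite exprn_ege1// ler1n.
case=> e; rewrite e; apply/eqP; move/eqP: e; rewrite !floor_eq /= => /andP[h1 h2].
  apply/andP; split.
    by move: h1; rewrite pmulr_rge0// (lt_le_trans ltr01).
  rewrite ltNge; apply/negP => a1; move: h2; rewrite ltNge => /negP; apply.
  by rewrite (le_trans a1)// ler_peMl// (le_trans ler01).
apply/andP; split.
  rewrite leNgt; apply/negP => a1; move: h1; rewrite leNgt => /negP; apply.
  have a0 : a < 0 by apply: (lt_trans a1); rewrite ltrz0.
  by apply: le_lt_trans a1; rewrite ler_neMl// ltW.
by move: h2; rewrite !mulr0z pmulr_rlt0// (lt_le_trans ltr01).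
Qed.

Lemma chain_gen (j k : int) x : j <= k -> chain (k, gen k x) -> gen j x = gen k x.
Proof.
move=> jk ck; apply/rowP => i; rewrite !genE; apply: floor_chain => //.
by have := ck i; rewrite /= genE.
Qed.

Lemma chain_anc (j k : int) x : j <= k -> chain (k, gen k x) -> chain (j, gen j x).
Proof. by move=> jk ck i; rewrite /= (chain_gen jk ck); exact: ck. Qed.

Lemma chain_cell (j k : int) (m : 'rV[int]_n) : j <= k -> chain (k, m) ->
  @cell R n (k, m) `<=` cell (j, m).
Proof.
move=> jk cm x xm; rewrite -[m]xm; rewrite /cell/=.
by rewrite (chain_gen jk)//=; move: xm; rewrite /cell/= => ->.
Qed.

End chains.

Section stopping_tree.
Context (R : realType) (n : nat).
Local Notation mu := (lebesgue_rV R n).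
Local Notation "'rv'" := ('rV[R]_n).
Local Notation cell := (@cell R n).
Local Notation cube := (int * 'rV[int]_n)%type.
Implicit Types (x y : rv) (q P Q : cube).
Hypothesis n_gt0 : (0 < n)%N.

(* The parent of a stopping cell has density at most theta, hence the cell
   itself at most 2^n theta = 1/4. *)
Definition theta : R := (2 ^+ n)^-1 / 4.
Definition delta : R := theta / 4.

Lemma theta_gt0 : 0 < theta.
Proof. by rewrite /theta divr_gt0// invr_gt0 exprn_gt0. Qed.

Lemma delta_gt0 : 0 < delta.
Proof. by rewrite /delta divr_gt0// theta_gt0. Qed.

Lemma theta2n : theta * 2 ^+ n = 4^-1.
Proof. by rewrite /theta mulrAC mulVf ?mul1r// expf_neq0. Qed.

Lemma theta_le : theta <= 4^-1.
Proof.
by rewrite -theta2n ler_peMr ?(ltW theta_gt0)// exprn_ege1// ler1n.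
Qed.

Variable E : cube -> set rv.
Hypothesis mE : forall q, measurable (E q).
Hypothesis muE : forall q, (mu (E q) <= delta%:E * mu (cell q))%E.

Definition subcell Q P : Prop := Q.1 < P.1 /\ cell P `<=` cell Q.

(* The disjunct [chain P] makes the tree grown from a chain cell contain the
   trees grown from all smaller cells of the same chain. *)
Definition candidate Q : set cube := [set P | subcell Q P /\
  ((theta%:E * mu (cell P) < mu (cell P `&` E Q))%E \/ chain P)].

Definition stop Q : set cube := maxcell R (candidate Q).

Lemma candidate_bounded Q x : exists k0 : int, forall j, j < k0 ->
  ~ candidate Q (j, gen j x).
Proof.
exists Q.1 => j jQ [[/= Qj _] _].
by move: jQ; rewrite ltNge (ltW Qj).
Qed.

Lemma stop_sub Q P : stop Q P -> subcell Q P.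
Proof. by move=> [[]]. Qed.

Lemma mu_parent (k : int) x :
  (mu (cell (k - 1, gen (k - 1) x)%R) = (2 ^+ n)%:E * mu (cell (k, gen k x)))%E.
Proof. by rewrite !mu_cell/= (sideB R k 1) exprMn expr1 EFinM. Qed.

Let mcell P : measurable (cell P). Proof. exact: measurable_cell. Qed.

Lemma le_mu (A B : set rv) : measurable A -> measurable B -> A `<=` B ->
  (mu A <= mu B)%E.
Proof. by move=> mA mB AB; apply: le_measure; rewrite ?inE. Qed.

(** The parent of P either is Q, where the density is at most delta, or is a rejected candidate,
    where it is at most theta. Passing to P costs 2^n. The argument covers also cells stopped only
    for being in a chain. *)
Lemma stop_small Q P : stop Q P ->
  (mu (cell P `&` E Q) <= (4^-1)%:E * mu (cell P))%E.
Proof.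
move=> [[[QP PQ] _] maxP]; have cP := corner_cell R P; set x := corner R P in cP *.
have EP := cell_inj cP; have EQ := cell_inj (PQ _ cP).
have mPE : measurable (cell P `&` E Q) by exact: measurableI.
pose P' : cube := (P.1 - 1, gen (P.1 - 1) x).
have muP' : mu (cell P') = ((2 ^+ n)%:E * mu (cell P))%E by rewrite mu_parent -EP.
have [e|ne] := eqVneq (P.1 - 1) Q.1.
  apply: (@le_trans _ _ (mu (E Q))); first by apply: le_mu => //; exact: subIsetr.
  apply: (le_trans (muE Q)); rewrite EQ -e muP' muleA -EFinM lee_wpmul2r// lee_fin.
  rewrite /delta mulrAC theta2n; lra.
have QP' : Q.1 < P'.1 by move: QP ne; rewrite /P' /=; lia.
have sP : cell P `<=` cell P' by rewrite {1}EP; apply: cell_sub; lia.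
have sQ : cell P' `<=` cell Q by rewrite EQ; apply: cell_sub; exact: ltW.
have : ~ (theta%:E * mu (cell P') < mu (cell P' `&` E Q))%E.
  move=> h; apply: (maxP x P'.1 cP); first by rewrite /P' /=; lia.
  by split; [split|left].
move/negP; rewrite -leNgt => h.
apply: (@le_trans _ _ (mu (cell P' `&` E Q))).
  by apply: le_mu => //; [exact: measurableI|exact: setSI].
by apply: (le_trans h); rewrite muP' muleA -EFinM theta2n.
Qed.

(** Ancestors of a chain cell are chain cells, so maximality forces a stopping chain cell to be a
    child of Q, with the same index. There is thus at most one per Q. *)
Lemma stop_chain Q P : stop Q P -> chain P -> P = (Q.1 + 1, Q.2).
Proof.
move=> [[[QP PQ] _] maxP] chP; have cP := corner_cell R P; set x := corner R P in cP *.
have EP := cell_inj cP; have EQ := cell_inj (PQ _ cP).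
have e1 : P.1 = Q.1 + 1.
  apply: contrapT => ne; have lt1 : Q.1 + 1 < P.1 by lia.
  apply: (maxP x (Q.1 + 1) cP lt1); split.
    by split; [rewrite /=; lia|rewrite [X in _ `<=` cell X]EQ; apply: cell_sub; lia].
  by right; apply: (chain_anc (ltW lt1)); rewrite -EP.
rewrite EP e1; congr pair; rewrite [in RHS]EQ /=.
apply/esym; apply: chain_gen; first by lia.
by rewrite -e1 -EP.
Qed.

Definition stopU Q : set rv := \bigcup_(P in stop Q) cell P.

Lemma measurable_stopU Q : measurable (stopU Q).
Proof. by apply: measurable_bigcup_count. Qed.

Lemma stopU_sub Q : stopU Q `<=` cell Q.
Proof. by move=> x [P /stop_sub[_ +]]; exact. Qed.

(** Dense stopping cells occupy at most delta / theta = 1/4 of Q; the chain child adds 2^-n <=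
    1/2. *)
Lemma mu_stopU Q : (mu (stopU Q) <= (3 / 4)%:E * mu (cell Q))%E.
Proof.
pose H := [set P | stop Q P /\ (theta%:E * mu (cell P) < mu (cell P `&` E Q))%E].
pose X := \bigcup_(P in H) cell P.
have mX : measurable X by apply: measurable_bigcup_count.
have X1 : (mu X <= (4^-1)%:E * mu (cell Q))%E.
  have h : (theta%:E * mu X <= mu (E Q))%E.
    rewrite -integral_cst//.
    apply: (@le_trans _ _ (\int[mu]_(x in X) (\1_(E Q) x)%:E)%E).
      apply: le_integral_bigcup => //.
      - by apply: sub_trivIset (@maxcell_triv R n (candidate Q)) => P [].
      - by apply/measurable_EFinP; exact: measurable_indic.
      - by move=> x; rewrite lee_fin ltW// theta_gt0.
      - move=> P [_ /ltW hP]; rewrite integral_cst// integral_indic//.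
        by rewrite setIC.
    rewrite integral_indic//; apply: le_mu => //; first exact: measurableI.
  have /lee_divr -/(_ theta_gt0) : (theta%:E * mu X <= (delta * side R Q.1 ^+ n)%:E)%E.
    by apply: (le_trans h); rewrite EFinM -mu_cell.
  move=> /le_trans; apply; rewrite mu_cell -EFinM lee_fin.
  have t0 := theta_gt0; rewrite /delta le_eqVlt; apply/orP; left; apply/eqP.
  by field; rewrite gt_eqF.
have sub : stopU Q `<=` X `|` cell (Q.1 + 1, Q.2).
  move=> x [P sP Px]; have [_ [hP|cP]] := sP.1; first by left; exists P.
  by right; rewrite -(stop_chain sP cP).
have hc : (mu (cell (Q.1 + 1, Q.2)%R) <= (2^-1)%:E * mu (cell Q))%E.
  rewrite !mu_cell -EFinM lee_fin /=.
  have -> : side R Q.1 = 2 * side R (Q.1 + 1).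
    by rewrite -[in LHS](addrK 1 Q.1) (sideB R _ 1) expr1.
  rewrite exprMn mulrA ler_peMl ?exprn_ge0 ?(ltW (side_gt0 _ _))//.
  rewrite -ler_pdivrMl ?invr_gt0// invrK mulr1.
  by rewrite -[leLHS]expr1 ler_weXn2l// ler1n.
apply: (le_trans (le_mu (measurable_stopU Q) (measurableU _ _ mX (mcell _)) sub)).
apply: (le_trans (measureU2 _ _ _)) => //.
apply: (@le_trans _ _ ((4^-1)%:E * mu (cell Q) + (2^-1)%:E * mu (cell Q))%E).
  exact: leeD.
rewrite -ge0_muleDl ?lee_fin// -EFinD lee_wpmul2r// lee_fin; lra.
Qed.

(** An uncovered part of E Q of positive measure would more than half fill some cell q. Then q is
    strictly finer than Q, because E Q fills too little of Q, and q is a candidate, 1/2 exceeding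
    theta, so it lies in a stopping cell. *)
Lemma stop_cover Q : {ae mu, forall x, cell Q x -> E Q x -> stopU Q x}.
Proof.
pose A := (cell Q `&` E Q) `\` stopU Q.
have mA : measurable A by apply: measurableD; [exact: measurableI|exact: measurable_stopU].
have [A0|A0] := eqVneq (mu A) 0%E.
  exists A; split => // x /= /not_implyP[Qx /not_implyP[Ex nx]]; split => //.
have {}A0 : (0 < mu A)%E by rewrite lt0e A0 measure_ge0.
have [q hq] := density mA A0.
have [x [[[Qx Ex] nx] qx]] : A `&` cell q !=set0.
  apply/set0P/eqP => AE; move: hq; rewrite AE measure0 mule0 ltNge.
  by rewrite measure_ge0.
exfalso; apply: nx.
have Eq := cell_inj qx; have EQ := cell_inj Qx.
have [qQ|Qq] := leP q.1 Q.1.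
  move: hq; rewrite ltNge => /negP[].
  apply: (@le_trans _ _ (2%:E * mu (E Q))%E).
    rewrite lee_wpmul2l ?lee_fin//; apply: le_mu => //; first exact: measurableI.
    by move=> y [[[]]].
  apply: (@le_trans _ _ (mu (cell Q))).
    apply: (@le_trans _ _ (2%:E * (delta%:E * mu (cell Q)))%E).
      by rewrite lee_wpmul2l// lee_fin.
    rewrite muleA -EFinM -[leRHS]mul1e lee_wpmul2r// lee_fin /delta.
    have := theta_le; lra.
  by apply: le_mu => //; rewrite EQ Eq; exact: cell_sub.
have cq : candidate Q (q.1, gen q.1 x).
  rewrite -Eq; split; first by split=> //; rewrite [X in cell X `<=` _]Eq [X in _ `<=` cell X]EQ; apply: cell_sub; exact: ltW.
  left; have hq2 : (mu (A `&` cell q) <= mu (cell q `&` E Q))%E.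
    apply: le_mu; [exact: measurableI|exact: measurableI|].
    by move=> y [[[_ Ey] _] qy].
  apply: lt_le_trans hq2.
  have fA : mu (A `&` cell q) \is a fin_num.
    rewrite ge0_fin_numE//; apply: le_lt_trans (@mu_cell_lty R n q).
    by apply: le_mu => //; exact: measurableI.
  move: hq; rewrite mu_cell -(fineK fA) -!EFinM !lte_fin => hq.
  have s0 : 0 < side R q.1 ^+ n by rewrite exprn_gt0// side_gt0.
  apply: (@le_lt_trans _ _ (4^-1 * side R q.1 ^+ n)).
    by rewrite ler_wpM2r ?theta_le// ltW.
  lra.
have [j _ mj] := maxcell_exists cq (candidate_bounded Q x).
by exists (j, gen j x).
Qed.

Inductive reach : cube -> cube -> Prop :=
| reach_refl Q : reach Q Q
| reach_step Q P P' : stop Q P -> reach P P' -> reach Q P'.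

Lemma reach_sub Q P : reach Q P -> Q.1 <= P.1 /\ cell P `<=` cell Q.
Proof.
elim=> [{}Q|{}Q {}P P' /stop_sub[QP sub] _ [PP' sub']]; first by split.
by split; [exact: le_trans (ltW QP) PP'|exact: subset_trans sub].
Qed.

Lemma reach_trans Q P P' : reach Q P -> reach P P' -> reach Q P'.
Proof.
by elim=> [//|{}Q {}P P1 QP _ IH /IH]; exact: reach_step.
Qed.

(** Following the two branches down from Q, the first steps are stopping cells of the same cell
    sharing x, hence equal; so one branch continues the other. *)
Lemma reach_cmp Q P P' x : reach Q P -> reach Q P' -> cell P x -> cell P' x ->
  reach P P' \/ reach P' P.
Proof.
move=> QP; elim: QP P' => [{}Q P' h _ _|{}Q P1 {}P sP P1P IH P' QP' Px P'x]; first by left.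
case: {-1}Q P' / QP' (erefl Q) P'x => [{}Q' e _|{}Q' P1' P' sP' P1P' e P'x].
  by right; rewrite -e; exact: reach_step P1P.
rewrite e in sP.
have P1x := (reach_sub P1P).2 _ Px; have P1'x := (reach_sub P1P').2 _ P'x.
have e1 : P1 = P1'.
  by apply: (@maxcell_triv R n (candidate Q')) => //; exists x.
by apply: IH => //; rewrite e1.
Qed.

Lemma chain_stop c : chain c -> stop c (c.1 + 1, c.2).
Proof.
move=> cc; split.
  split; last by right.
  split; first by rewrite /=; lia.
  case: c cc => k m /= cm; apply: chain_cell => //; lia.
by move=> x k _ /= k1 [[/= ck _] _]; lia.
Qed.

Lemma chain_reach (k : int) (p : nat) (m : 'rV[int]_n) : chain (k, m) ->
  reach (k, m) (k + p%:Z, m).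
Proof.
elim: p k => [|p IH] k cm; first by rewrite addr0; exact: reach_refl.
apply: reach_step (chain_stop cm) _ => /=.
have -> : k + p.+1%:Z = (k + 1) + p%:Z by lia.
exact: IH.
Qed.

Definition family : set cube := [set P | exists c, chain c /\ reach c P].

(** Both roots contain x, so they belong to the same chain, and the finer one is reached from the
    coarser by steps along it. Disjointness over the whole family reduces to a single tree. *)
Lemma chain_common P P' x : family P -> family P' -> cell P x -> cell P' x ->
  exists c, [/\ chain c, reach c P & reach c P'].
Proof.
move=> [c [cc cP]] [c' [cc' cP']] Px P'x.
have cx := cell_inj ((reach_sub cP).2 _ Px).
have c'x := cell_inj ((reach_sub cP').2 _ P'x).
wlog le : P P' c c' cc cP cc' cP' Px P'x cx c'x / c.1 <= c'.1.
  move=> H; have [|/ltW] := leP c.1 c'.1; first exact: (H P P' c c').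
  by move=> /(H P' P c' c) -/(_ cc' cP' cc cP P'x Px c'x cx)[d [? ? ?]]; exists d.
exists c; split=> //; apply: reach_trans cP'.
have e : c'.2 = c.2.
  rewrite c'x cx /=; apply/esym; apply: chain_gen => //.
  by rewrite -c'x.
have [p pE] : exists p : nat, c'.1 = c.1 + p%:Z by exists `|c'.1 - c.1|%N; lia.
have -> : c' = (c.1 + p%:Z, c.2) by rewrite -pE -e; case: (c').
by move: cc; case: (c) => k m /= cc; exact: chain_reach.
Qed.

Definition core Q : set rv := cell Q `\` stopU Q.

Lemma measurable_core Q : measurable (core Q).
Proof. by apply: measurableD => //; exact: measurable_stopU. Qed.

Lemma mu_core Q : (mu (cell Q) <= 4%:E * mu (core Q))%E.
Proof.
have fS : mu (stopU Q) \is a fin_num.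
  rewrite ge0_fin_numE//; apply: le_lt_trans (@mu_cell_lty R n Q).
  by apply: le_mu => //; [exact: measurable_stopU|exact: stopU_sub].
have fC : mu (core Q) \is a fin_num.
  rewrite ge0_fin_numE//; apply: le_lt_trans (@mu_cell_lty R n Q).
  by apply: le_mu => //; [exact: measurable_core|exact: subDsetl].
have h : (mu (cell Q) <= mu (core Q) + mu (stopU Q))%E.
  apply: le_trans (measureU2 _ _ _); [|exact: measurable_core|exact: measurable_stopU].
  apply: le_mu => //; first by apply: measurableU; [exact: measurable_core|exact: measurable_stopU].
  move=> x Qx; have [Sx|nS] := pselect (stopU Q x); first by right.
  by left.
have := mu_stopU Q; move: h; rewrite mu_cell -(fineK fS) -(fineK fC) -EFinD -!EFinM !lee_fin.
lra.
Qed.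

Lemma reach_core P P' x : reach P P' -> core P x -> core P' x -> P = P'.
Proof.
move=> PP' Px [P'x _].
case: {-1}P P' / PP' (erefl P) P'x => [//|{}Q P1 {}P' sP1 P1P' e P'x].
case: Px => _ []; rewrite e; exists P1 => //.
exact: (reach_sub P1P').2.
Qed.

Lemma reach_core_triv c : trivIset (reach c) core.
Proof.
move=> P P' cP cP' [x [Px P'x]].
have [|] := reach_cmp cP cP' Px.1 P'x.1; first by move=> h; exact: (reach_core h Px P'x).
by move=> h; apply/esym; exact: (reach_core h P'x Px).
Qed.

Lemma family_core_triv : trivIset family core.
Proof.
move=> P P' FP FP' [x [Px P'x]].
have [c [_ cP cP']] := chain_common FP FP' Px.1 P'x.1.
by apply: (reach_core_triv cP cP'); exists x.
Qed.

(** Borel-Cantelli: each tree cell is at most four times its core, and the cores are disjoint inside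
    the root, so the measures of the tree cells are summable. *)
Lemma reach_finite c : {ae mu, forall x, exists K : int,
  forall P, reach c P -> cell P x -> P.1 <= K}.
Proof.
pose F := enum_fam (reach c) cell; pose G := enum_fam (reach c) core.
have mF j : measurable (F j) by exact: measurable_enum_fam.
have mG j : measurable (G j) by apply: measurable_enum_fam; exact: measurable_core.
have FG j : (mu (F j) <= 4%:E * mu (G j))%E.
  rewrite /F /G /enum_fam; case: pickle_inv => [P|]; last by rewrite !measure0 mule0.
  by case: asboolP => _; [exact: mu_core|rewrite !measure0 mule0].
have sumF : (\sum_(j <oo) mu (F j) < +oo)%E.
  apply: (@le_lt_trans _ _ (\sum_(j <oo) (4%:E * mu (G j)))%E).
    exact: lee_nneseries.
  rewrite nneseriesZl// -measure_semi_bigcup//; last 2 first.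
  - by apply: trivIset_enum_fam; exact: reach_core_triv.
  - exact: bigcupT_measurable.
  rewrite lte_mul_pinfty//; apply: le_lt_trans (@mu_cell_lty R n c).
  apply: le_mu => //; first exact: bigcupT_measurable.
  rewrite bigcup_enum_fam => x [P cP [Px _]].
  exact: (reach_sub cP).2.
have lim0 := lim_sup_set_cvg0 mF sumF.
exists (lim_sup_set F); split => //.
  by apply: bigcapT_measurable => k; apply: bigcup_measurable.
move=> x /= nK k _; apply: contrapT => nF; apply: nK.
(* Only cells with code below k contain x; the sum of the absolute values of their generations
   bounds each of them. *)
pose K := (\sum_(j < k) (if pickle_inv j is Some P then `|(P : cube).1|%N else 0%N))%N.
exists K%:Z => P cP Px.
have Pk : (pickle P < k)%N.
  rewrite ltnNge; apply/negP => kP; apply: nF; exists (pickle P); first exact: kP.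
  by rewrite /F enum_fam_pickle.
have : (`|P.1| <= K)%N.
  rewrite /K (bigD1 (Ordinal Pk))//= pickleK_inv.
  exact: leq_addr.
lia.
Qed.

Lemma ae_forall_count (I : countType) (Pr : I -> rv -> Prop) :
  (forall i, {ae mu, forall x, Pr i x}) -> {ae mu, forall x, forall i, Pr i x}.
Proof.
move=> H; have : {ae mu, forall x, forall j : nat,
    if pickle_inv j is Some i then Pr i x else True}.
  apply: ae_foralln => j; case: pickle_inv => [i|]; first exact: H.
  exact: aeW.
by apply: filterS => x hx i; have := hx (pickle i); rewrite pickleK_inv.
Qed.

Variables (u : cube -> rv -> R) (o : cube -> R) (C : R).
Hypothesis u_off : forall q, {ae mu, forall x, ~ E q x -> u q x <= C * o q}.
Hypothesis u_step : forall P Q, Q.1 <= P.1 -> cell P `<=` cell Q ->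
  (mu (cell P `&` E Q) <= (4^-1)%:E * mu (cell P))%E ->
  {ae mu, forall x, cell P x -> u Q x <= u P x + C * o Q}.

(** A branch of the tree through x has one cell per generation, so it is recorded as a
    duplicate-free list of generations. It ends where x leaves [stopU], hence is outside the
    exceptional set and the direct bound applies. *)
Lemma reach_bound : {ae mu, forall x, forall Q, cell Q x ->
  exists s : seq int, [/\ uniq s, forall k, k \in s -> reach Q (k, gen k x) &
    u Q x <= C * \sum_(k <- s) o (k, gen k x)]}.
Proof.
have a1 : {ae mu, forall x Q, ~ E Q x -> u Q x <= C * o Q} by exact: ae_forall_count.
have a2 : {ae mu, forall x (QP : cube * cube), stop QP.1 QP.2 -> cell QP.2 x ->
    u QP.1 x <= u QP.2 x + C * o QP.1}.
  apply: ae_forall_count => -[Q P] /=.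
  have [sP|nP] := pselect (stop Q P); last exact: aeW.
  have [QP sub] := stop_sub sP.
  by apply: filterS (u_step (ltW QP) sub (stop_small sP)) => x h _.
have a3 : {ae mu, forall x Q, cell Q x -> E Q x -> stopU Q x}.
  by apply: ae_forall_count; exact: stop_cover.
have a4 : {ae mu, forall x c, exists K : int, forall P, reach c P -> cell P x -> P.1 <= K}.
  by apply: ae_forall_count; exact: reach_finite.
have a12 : {ae mu, forall x, (forall Q, ~ E Q x -> u Q x <= C * o Q) /\
    (forall QP : cube * cube, stop QP.1 QP.2 -> cell QP.2 x ->
    u QP.1 x <= u QP.2 x + C * o QP.1)} by apply: filterS2 a1 a2.
apply: filterS3 a12 a3 a4 => x [h1 h2] h3 h4 Q Qx.
have [K HK] := h4 Q.
(* Induction on the number of generations left below K; every stopping cell is strictly finer. *)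
have [p pE] : exists p : nat, K - Q.1 < p%:Z by exists `|K - Q.1|.+1; lia.
elim: p Q Qx HK pE => [|p IH] Q Qx HK pE.
  by have := HK _ (reach_refl Q) Qx; lia.
have EQ := cell_inj Qx.
have [[P sP Px]|nS] := pselect (stopU Q x); last first.
  exists [:: Q.1]; split=> //.
    by move=> k; rewrite inE => /eqP ->; rewrite -EQ; exact: reach_refl.
  by rewrite big_seq1 -EQ; apply: h1 => /(h3 _ Qx).
have [QP _] := stop_sub sP.
have [||s [us sr us2]] := IH P Px.
- by move=> P' PP'; apply: HK; exact: reach_step PP'.
- by lia.
exists (Q.1 :: s); split.
- rewrite /= us andbT; apply/negP => /sr /reach_sub[/=]; lia.
- move=> k; rewrite inE => /orP[/eqP ->|/sr]; first by rewrite -EQ; exact: reach_refl.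
  exact: reach_step.
- rewrite big_cons -EQ mulrDr addrC; apply: le_trans (h2 (Q, P) sP Px) _.
  by rewrite lerD2r.
Qed.

End stopping_tree.

(** * The one-third trick *)

Section one_third.
Context (R : realType) (n : nat).
Local Notation mu := (lebesgue_rV R n).
Local Notation "'rv'" := ('rV[R]_n).
Local Notation dil := (@dil R n).
Implicit Types (x y : rv) (q : int * 'rV[int]_n).

(** If the interval overshoots m + 1, then lo > m + 2/3, and the unit interval starting at m + 1/3
    or at m + 2/3, according to the sign s, contains it. *)
Lemma one_third_shift (lo hi s : R) : hi - lo <= 3^-1 -> s = 1 \/ s = -1 ->
  exists (a : R) (m : int), (a = 0 \/ a = 3^-1) /\
    m%:~R + s * a <= lo /\ hi <= m%:~R + s * a + 1.
Proof.
move=> d hs; have := floor_itv lo; rewrite intrD; set m := Num.floor lo => /andP[h1 h2].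
have [h|h] := leP hi (m%:~R + 1).
  by exists 0, m; split; [left|rewrite mulr0 addr0].
case: hs => ->.
  by exists 3^-1, m; split; [right|split; lra].
by exists 3^-1, (m + 1); split; [right|rewrite intrD; split; lra].
Qed.

Lemma sign_exp (k : int) : (-1 : R) ^ k = 1 \/ (-1 : R) ^ k = -1.
Proof.
case: k => p; rewrite /exprz; first by case: (signr_eq0 R p) => _; rewrite -signr_odd; case: odd; [right|left]; rewrite ?expr1 ?expr0.
by rewrite -signr_odd; case: odd; [right|left]; rewrite ?expr1 ?expr0 ?invrN1 ?invr1.
Qed.

Lemma dyadic_cubeP (alpha : rv) (k : int) (m : 'rV[int]_n) :
  dyadic_cube alpha k m = [set x | forall i,
    (side R k * ((m ord0 i)%:~R + (-1) ^ k * alpha ord0 i)) <= x ord0 i <=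
    (side R k * ((m ord0 i)%:~R + (-1) ^ k * alpha ord0 i + 1))].
Proof.
have s0 := side_gt0 R k.
apply/seteqP; split=> [_ [v hv <-] i|x hx].
  have := hv i; rewrite !mxE -/(side R k) => /andP[h1 h2].
  by rewrite !ler_pM2l//; apply/andP; split; lra.
exists (\row_i ((side R k)^-1 * x ord0 i - ((m ord0 i)%:~R + (-1) ^ k * alpha ord0 i))).
  move=> i; rewrite !mxE; have /andP[h1 h2] := hx i.
  rewrite subr_ge0 lerBlDl [(side R k)^-1 * _]mulrC ler_pdivlMr// ler_pdivrMr//.
  by rewrite ![_ * side R k]mulrC h1.
apply/rowP => i; rewrite !mxE -/(side R k).
by rewrite -addrA subrK mulrA mulfV ?mul1r// gt_eqF.
Qed.

(** J generations up, the enlargement has relative side (2N+1) / 2^J <= 1/3. The shift is chosen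
    coordinate by coordinate, which is why all vectors alpha with entries 0 and 1/3 occur. *)
Lemma dyadic_cover (N J : nat) q : (3 * (2 * N).+1 <= 2 ^ J)%N ->
  exists P : set rv, [/\ dyadic P, dil N q `<=` P, measurable P &
    mu P = ((2 ^+ J * side R q.1) ^+ n)%:E].
Proof.
move=> NJ; pose k := q.1 - J%:Z; pose p : R := 2 ^+ J.
have p0 : 0 < p by rewrite /p exprn_gt0.
have skE : side R k = p * side R q.1 by exact: sideB.
have sk z : side R k * (z / p) = z * side R q.1.
  by rewrite skE mulrC mulrA divfK// gt_eqF.
pose lo i : R := ((q.2 ord0 i)%:~R - N%:R) / p.
pose hi i : R := ((q.2 ord0 i)%:~R + N%:R + 1) / p.
have len i : hi i - lo i <= 3^-1.
  rewrite /hi /lo -mulrBl ler_pdivrMr// mulrC ler_pdivlMr//.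
  have : ((3 * (2 * N).+1)%:R <= (2 ^ J)%:R :> R) by rewrite ler_nat.
  by rewrite natrM -[(2 * N).+1%:R]natr1 natrM natrX -/p; lra.
have /choice[a Ha] := fun i => one_third_shift (len i) (sign_exp k).
have {Ha}/choice[m Hm] := Ha.
pose alpha : rv := \row_i a i; pose mm : 'rV[int]_n := \row_i m i.
have s0 := side_gt0 R k.
have E : dyadic_cube alpha k mm = [set x : rv | forall i,
  (\row_j (side R k * ((m j)%:~R + (-1) ^ k * a j))) ord0 i <= x ord0 i <=
  (\row_j (side R k * ((m j)%:~R + (-1) ^ k * a j + 1))) ord0 i].
  rewrite dyadic_cubeP; apply/seteqP; split=> x hx i;
  by have := hx i; rewrite !mxE.
exists (dyadic_cube alpha k mm); split.
- exists alpha; first by move=> i; rewrite mxE; exact: (Hm i).1.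
  by exists k, mm.
- move=> x /dilPs hx; rewrite dyadic_cubeP => i; have [_ [h1 h2]] := Hm i.
  have /andP[x1 x2] := hx i; rewrite !mxE; apply/andP; split.
    by apply: le_trans x1; rewrite -sk ler_pM2l.
  by apply: (le_trans (ltW x2)); rewrite -sk ler_pM2l.
- rewrite E (_ : [set x | _] = \bigcap_(i in [set: 'I_n]) (@rV_coord R n i @^-1`
     `[side R k * ((m i)%:~R + (-1) ^ k * a i), side R k * ((m i)%:~R + (-1) ^ k * a i + 1)])).
    apply: fin_bigcap_measurable => //= i _.
    by rewrite -[X in measurable X]setTI; exact: measurable_rV_coord.
  apply/seteqP; split=> [x /= H i _ | x H i]/=.
    by rewrite in_itv/=; have := H i; rewrite !mxE.
  by have := H i I; rewrite /= in_itv !mxE.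
- rewrite E lebesgue_rV_box; last first.
    by move=> i; rewrite !mxE ler_pM2l// lerDl.
  congr EFin; rewrite (eq_bigr (fun=> side R k)).
    by rewrite prodr_const card_ord skE.
  by move=> i _; rewrite !mxE -mulrBr addrC addKr mulr1.
Qed.

Lemma osc_dyadic (f : rv -> R) (A P : set rv) (c : R) :
  f \in Lfun mu 2%:E -> measurable A -> measurable P ->
  (0 < mu A)%E -> (mu P < +oo)%E -> A `<=` P -> (mu P <= c%:E * mu A)%E ->
  osc A f <= 2 * c * osc P f.
Proof.
move=> Lf mA mP A0 Poo AP PA.
have AleP : (mu A <= mu P)%E by apply: le_measure; rewrite ?inE.
have Ab : (0 < mu A < +oo)%E by rewrite A0 (le_lt_trans AleP).
have Pb : (0 < mu P < +oo)%E by rewrite Poo (lt_le_trans A0).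
have iP : mu.-integrable P (EFin \o f) by exact: L2_integrable.
have iA : mu.-integrable A (EFin \o f).
  by apply: L2_integrable => //; case/andP: Ab.
have mf := L2_meas Lf.
have h : ((osc A f)%:E * mu A <= (2 * c * osc P f)%:E * mu A)%E.
  rewrite oscE//; apply: (le_trans (mean_osc (mean P f) mA Ab iA)).
  apply: (@le_trans _ _ (2%:E * ((osc P f)%:E * mu P))%E).
    rewrite lee_wpmul2l// oscE//; apply: ge0_subset_integral => //.
    apply: measurable_funTS; apply: measurable_absE.
    exact: measurable_funB.
  have -> : ((2 * c * osc P f)%:E * mu A = 2%:E * ((osc P f)%:E * (c%:E * mu A)))%E.
    by rewrite (_ : 2 * c * osc P f = 2 * (osc P f * c)); [rewrite !EFinM !muleA|ring].
  apply: lee_wpmul2l => //; apply: lee_wpmul2l => //.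
  by rewrite lee_fin osc_ge0.
move: h; rewrite lee_pmul2r// ?lee_fin//.
by case/andP: Ab => ? ?; rewrite ge0_fin_numE.
Qed.

End one_third.

(** * From local to global domination *)

Section exhaustion.
Context (R : realType) (n : nat).
Local Notation mu := (lebesgue_rV R n).
Local Notation L2 := (Lfun mu 2%:E).
Local Notation "'rv'" := ('rV[R]_n).
Local Notation dil := (@dil R n).
Local Notation cell := (@cell R n).
Local Notation cube := (int * 'rV[int]_n)%type.
Implicit Types (x y : rv) (q c : cube).
Definition chain_up c (j : nat) : cube := (c.1 - j%:Z, c.2).

Lemma chain_up_chain c j : chain c -> chain (chain_up c j).
Proof. by []. Qed.

Lemma cell_chain_up c j : chain c -> cell c `<=` cell (chain_up c j).
Proof. by case: c => k m cm; apply: chain_cell => //; rewrite /=; lia. Qed.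

Lemma chain_exists x : exists c, chain c /\ cell c x.
Proof.
pose p := Num.bound `|x|.
exists (- p%:Z, gen (- p%:Z) x); split=> // i; rewrite /= genE.
have hx : `|x ord0 i| < 2 ^+ p.
  apply: (le_lt_trans (coord_le_norm x i)).
  apply: (lt_trans (archi_boundP (normr_ge0 x))).
  by rewrite -natrX ltr_nat ltn_expl.
rewrite exp2V /side opprK /exprz/=; set t := _^-1 * _.
have /andP[t1 t2] : -1 < t < 1.
  rewrite -ltr_norml /t normrM normfV (@ger0_norm _ (2 ^+ p)) ?exprn_ge0//.
  by rewrite mulrC ltr_pdivrMr ?exprn_gt0// mul1r.
have [t0|t0] := leP 0 t; [left|right]; apply/eqP; rewrite floor_eq.
  by rewrite t0.
by rewrite mulrN1z addNr t0 andbT ltW.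
Qed.

Hypothesis n_gt0 : (0 < n)%N.
Variable N : nat.
Hypothesis N0 : (0 < N)%N.

Lemma dil_chain_up_mono c i j : chain c -> (i <= j)%N ->
  dil N (chain_up c i) `<=` dil N (chain_up c j).
Proof.
move=> cc ij y yi; set x := corner R c.
have Ex l : chain_up c l = (c.1 - l%:Z, gen (c.1 - l%:Z) x).
  have := cell_inj (cell_chain_up l cc (corner_cell R c)).
  by rewrite /chain_up /= => ->.
rewrite Ex in yi; rewrite Ex; apply: gen_le_near yi; lia.
Qed.

(** The cells of a chain fill only one orthant, but indices of chain cells of one generation differ
    by at most 1 <= N, so their enlargements reach all orthants. *)
Lemma dil_chain_up_cover c y : chain c -> exists j, dil N (chain_up c j) y.
Proof.
move=> cc; have [d [cd dy]] := chain_exists y.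
exists `|c.1 - d.1|%N.
have le : c.1 - `|c.1 - d.1|%N%:Z <= d.1 by lia.
set k := c.1 - _ in le *.
have h : chain (k, gen k y).
  by apply: (chain_anc le); rewrite -(cell_inj dy).
move=> i; rewrite /chain_up /= -/k; have := h i; have := cc i.
rewrite /=; move: (gen k y ord0 i) (c.2 ord0 i) => a b.
by move=> [->|->] [->|->]; lia.
Qed.

Variable f : rv -> R.
Hypothesis Lf : f \in L2.

Lemma tail_small c (e : R) : chain c -> 0 < e -> exists j0, forall j, (j0 <= j)%N ->
  (sqnorm mu (fun y => (f y * \1_(~` dil N (chain_up c j)) y)%R) <= e%:E)%E.
Proof.
move=> cc e0; have /L2P[mf foo] := Lf.
have msq := measurable_sq mf.
pose D j := dil N (chain_up c j).
have mD j : measurable (D j) by exact: measurable_dil.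
have UD : \bigcup_j D j = setT.
  by apply/seteqP; split=> // y _; have [j hj] := dil_chain_up_cover y cc; exists j.
have DT j : (\int[mu]_(y in D j) (f y ^+ 2)%:E +
    sqnorm mu (fun y => (f y * \1_(~` D j) y)%R) = sqnorm mu f)%E.
  have -> : (sqnorm mu (fun y => (f y * \1_(~` D j) y)%R) =
     \int[mu]_(y in ~` D j) (f y ^+ 2)%:E)%E.
    rewrite /sqnorm [RHS]integral_mkcond; apply: eq_integral => y _.
    by rewrite patchE indicE; case: ifP => _; rewrite ?mulr1 ?mulr0 ?expr0n.
  rewrite -ge0_integral_setU ?setUv//; first exact: measurableC.
  - by move=> y _; exact: sqE_ge0.
  - by apply/disj_setPS; rewrite setICr.
have cv : (\int[mu]_(y in D j) (f y ^+ 2)%:E)%E @[j --> \oo] --> sqnorm mu f.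
  rewrite /sqnorm -UD; apply: ge0_nondecreasing_set_cvg_integral => //.
  - move=> i j ij; apply/subsetPset; exact: dil_chain_up_mono.
  - by move=> i; apply: measurable_funTS.
  - by move=> i y _; exact: sqE_ge0.
have ffin : sqnorm mu f \is a fin_num by rewrite ge0_fin_numE// sqnorm_ge0.
move: cv; rewrite -(fineK ffin) => /fine_cvgP[_ /cvgrPdist_lt/(_ _ e0)[j0 _ Hj]].
exists j0 => j jj; have := Hj j jj; rewrite /= => /ltW.
have Dfin : (\int[mu]_(y in D j) (f y ^+ 2)%:E)%E \is a fin_num.
  rewrite ge0_fin_numE; last by apply: integral_ge0 => y _; exact: sqE_ge0.
  apply: le_lt_trans foo; apply: ge0_subset_integral => // y _; exact: sqE_ge0.
have := DT j; set t := sqnorm mu (fun y => _); set d := (\int[mu]_(y in D j) _)%E in Dfin *.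
move: ffin; set F := sqnorm mu f => Ffin dtF.
have tE : t = (fine F - fine d)%:E.
  move: Dfin Ffin dtF; move: d t F => [d| |] [t| |] [F| |]//= _ _ [<-].
  by congr EFin; ring.
by rewrite tE lee_fin; apply: le_trans; exact: ler_norm.
Qed.

(** Split |f| <= d + f^2 / d with d = e/2; once the volume of the enlargement exceeds F / d^2, F
    being the squared L^2 norm, both averages are at most d. *)
Lemma cmean_small c (e : R) : 0 < e -> exists j0, forall j, (j0 <= j)%N ->
  `|cmean N f (chain_up c j)| <= e.
Proof.
move=> e0; have /L2P[mf foo] := Lf.
have Ffin : sqnorm mu f \is a fin_num by rewrite ge0_fin_numE// sqnorm_ge0.
set F := fine (sqnorm mu f); pose d := e / 2; have d0 : 0 < d by rewrite divr_gt0.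
have F0 : 0 <= F by rewrite fine_ge0// sqnorm_ge0.
pose B := Num.max 1 (F / d ^+ 2); have s0 := side_gt0 R c.1.
have B1 : 1 <= B by rewrite le_max lexx.
exists (Num.bound (B / side R c.1)) => j jj.
pose q := chain_up c j.
have hB : B <= side R q.1.
  rewrite /q /chain_up /= sideB -ler_pdivrMr//.
  apply: (@le_trans _ _ j%:R); last by rewrite -natrX ler_nat ltnW// ltn_expl.
  apply: (@le_trans _ _ (Num.bound (B / side R c.1))%:R); last by rewrite ler_nat.
  by apply: ltW; apply: le_lt_trans (archi_boundP _) => //; rewrite divr_ge0 ?(ltW s0)// (le_trans ler01).
have msm : ((F / d ^+ 2)%:E <= mu (dil N q))%E.
  rewrite mu_dil_cell mu_cell -EFinM lee_fin.
  apply: (@le_trans _ _ (side R q.1 ^+ n)).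
    apply: (@le_trans _ _ B); first by rewrite le_max lexx orbT.
    apply: (le_trans hB); rewrite -[leLHS]expr1 ler_weXn2l//.
    exact: le_trans hB.
  by rewrite ler_peMl ?exprn_ge0 ?(ltW (side_gt0 _ _))// exprn_ege1// ler1n.
have mq : measurable (dil N q) by exact: measurable_dil.
have h1 := mean_sub 0 mq (dil_mu_bounds R N q) (int_dil N Lf q).
have h2 : (\int[mu]_(x in dil N q) `|f x - 0|%:E <= d%:E * mu (dil N q) + (F / d)%:E)%E.
  apply: (@le_trans _ _ (\int[mu]_(x in dil N q) (d%:E + (d^-1)%:E * (f x ^+ 2)%:E))%E).
    apply: ge0_le_integral => //.
    - by apply: measurable_funTS; apply: measurable_absE; exact: measurable_funB.
    - apply: measurable_funTS; apply: emeasurable_funD => //.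
      by apply: emeasurable_funM => //; exact: measurable_sq.
    move=> x _; rewrite subr0 -EFinM -EFinD lee_fin.
    rewrite -(ler_pM2l d0) mulrDr mulrA mulfV ?gt_eqF// mul1r.
    rewrite -[f x ^+ 2]real_normK ?num_real//.
    have : 0 <= (`|f x| - d) ^+ 2 by exact: sqr_ge0.
    have : 0 <= d * d by exact: mulr_ge0 (ltW d0) (ltW d0).
    have : 0 <= `|f x| ^+ 2 by exact: sqr_ge0.
    rewrite !expr2; lra.
  rewrite ge0_integralD//; first last.
  - by apply: measurable_funTS; apply: emeasurable_funM => //; exact: measurable_sq.
  - by move=> x _; rewrite mule_ge0 ?sqE_ge0 ?lee_fin ?invr_ge0 ?(ltW d0).
  - by move=> x _; rewrite lee_fin ltW.
  rewrite integral_cst// leeD2l// ge0_integralZl//; first last.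
  - by rewrite lee_fin invr_ge0 ltW.
  - by move=> x _; exact: sqE_ge0.
  - by apply: measurable_funTS; exact: measurable_sq.
  rewrite [(F / d)%R]mulrC EFinM lee_wpmul2l ?lee_fin ?invr_ge0 ?(ltW d0)//.
  rewrite fineK//; apply: ge0_subset_integral => //; first exact: measurable_sq.
  by move=> x _; exact: sqE_ge0.
have h3 : ((F / d)%:E <= d%:E * mu (dil N q))%E.
  apply: (@le_trans _ _ (d%:E * (F / d ^+ 2)%:E)%E).
    rewrite -EFinM lee_fin le_eqVlt; apply/orP; left; apply/eqP.
    by field; rewrite gt_eqF.
  by rewrite lee_wpmul2l// lee_fin ltW.
have h4 : (`|cmean N f q - 0|%:E * mu (dil N q) <= e%:E * mu (dil N q))%E.
  apply: (le_trans h1); apply: (le_trans h2).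
  rewrite (_ : e = d + d); last by rewrite /d; field.
  rewrite EFinD ge0_muleDl ?lee_fin ?(ltW d0)//.
  by rewrite leeD2l.
move: h4; rewrite subr0.
have /andP[dg0 doo] := dil_mu_bounds R N q.
by rewrite lee_pmul2r// ?lee_fin// ge0_fin_numE.
Qed.

End exhaustion.

(** * Passing to the limit along a chain *)

Section limit.
Context (R : realType) (n : nat).
Local Notation mu := (lebesgue_rV R n).
Local Notation L2 := (Lfun mu 2%:E).
Local Notation "'rv'" := ('rV[R]_n).
Local Notation dil := (@dil R n).
Local Notation cell := (@cell R n).
Variables (T : (rv -> R) -> rv -> R) (K : rv -> rv -> R).
Implicit Types (x y : rv) (q c : (int * 'rV[int]_n)%type).
Hypothesis n_gt0 : (0 < n)%N.
Hypothesis HT : L2_bounded_linear T.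
Hypothesis HTK : associated_kernel T K.
Variables (eps CK : R).
Hypothesis HK : sup_kernel K eps CK.
Variable N : nat.
Hypothesis N2n : (2 * n < N)%N.
Hypothesis N1 : (1 < N)%N.
Hypothesis HT1 : T1_eq0_BMO T K.

Lemma T_top : exists C1 : R, 0 <= C1 /\ forall f q, f \in L2 ->
  {ae mu, forall x, cell q x -> `|T f x| <= `|T (locf N f q) x| + `|cmean N f q| * C1 +
     `|T (fun y => f y * \1_(~` dil N q) y) x|}.
Proof.
have [C1 [C10 HC1]] := T1_bounded n_gt0 HT HTK HK N2n N1 HT1.
exists C1; split=> // f q Lf.
have mD : measurable (dil N q) by exact: measurable_dil.
have Lt : (fun y => f y * \1_(~` dil N q) y) \in L2.
  by apply: L2_mulI => //; exact: measurableC.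
have Ll := locf_L2 N Lf q.
have L1 : \1_(dil N q) \in L2 by apply: L2_indic => //; exact: mu_dil_lty.
have Ls : (fun y => locf N f q y + f y * \1_(~` dil N q) y) \in L2.
  rewrite (_ : (fun y => _) = fun y => 1 * locf N f q y + f y * \1_(~` dil N q) y).
    exact: L2_lin.
  by apply/funext => y; rewrite mul1r.
have fE : f = fun y => cmean N f q * \1_(dil N q) y +
    (locf N f q y + f y * \1_(~` dil N q) y).
  apply/funext => y; rewrite /locf !indicE in_setC.
  by case: (y \in _) => /=; ring.
have a1 := T_lin HT (cmean N f q) L1 Ls.
rewrite -fE in a1.
apply: filterS3 (HC1 q) a1 (T_add HT Ll Lt) => x h1 -> -> qx.
apply: (le_trans (ler_normD _ _)).
rewrite -addrA addrCA lerD//; first by rewrite normrM ler_wpM2l// h1.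
exact: ler_normD.
Qed.

(** The majorant [F] is independent of j. By [T_top] the error is a vanishing mean times a bounded
    function, plus T of an L^2-small tail, small in measure by Chebyshev; [ae_of_small]
    concludes. *)
Lemma local_limit (f : rv -> R) c (F : rv -> \bar R) : f \in L2 -> chain c ->
  (forall j, {ae mu, forall x, cell c x ->
     (`|T (locf N f (chain_up c j)) x|%:E <= F x)%E}) ->
  {ae mu, forall x, cell c x -> (`|T f x|%:E <= F x)%E}.
Proof.
move=> Lf cc HF; have [C1 [C10 Htop]] := T_top.
have [M [M0 HM]] := T_cheb HT.
have N0 : (0 < N)%N by exact: ltn_trans N1.
suff H : forall m : nat, {ae mu, forall x, cell c x ->
    (`|T f x|%:E <= F x + (m.+1%:R^-1)%:E)%E}.
  have {}H : {ae mu, forall x, forall m : nat, cell c x ->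
    (`|T f x|%:E <= F x + (m.+1%:R^-1)%:E)%E} by exact: ae_forall_count.
  apply: filterS H => x H cx; apply/lee_addgt0Pr => e e0.
  pose m := Num.bound e^-1.
  apply: (le_trans (H m cx)); rewrite leeD2l// lee_fin.
  rewrite invf_ple ?posrE//; apply: ltW.
  apply: (lt_trans (archi_boundP _)); first by rewrite invr_ge0 ltW.
  by rewrite ltr_nat.
move=> m; pose t : R := m.+1%:R^-1 / 2.
have t0 : 0 < t by rewrite divr_gt0// invr_gt0.
apply: ae_of_small => e e0.
have d0 : 0 < t ^+ 2 * e / (M + 1).
  by rewrite divr_gt0 ?mulr_gt0 ?exprn_gt0// ltr_wpDl.
have d1 : 0 < t / (C1 + 1) by rewrite divr_gt0// ltr_wpDl.
have [j1 H1] := tail_small n_gt0 N0 Lf cc d0.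
have [j2 H2] := cmean_small n_gt0 N Lf c d1.
pose j := maxn j1 j2.
have {}H1 := H1 j (leq_maxl _ _); have {}H2 := H2 j (leq_maxr _ _).
set q := chain_up c j in H1 H2; set h := (fun y => _) in H1.
have Lh : h \in L2.
  by apply: L2_mulI => //; apply: measurableC; exact: measurable_dil.
exists [set x | t < `|T h x|]; split.
- exact: measurable_gt (T_meas HT Lh).
- have t20 : 0 < t ^+ 2 by rewrite exprn_gt0.
  rewrite -(@lee_pmul2l _ (t ^+ 2)%:E) ?lte_fin//.
  apply: (le_trans (HM h t Lh (ltW t0))).
  apply: (@le_trans _ _ (M%:E * (t ^+ 2 * e / (M + 1))%:E)%E).
    by rewrite lee_wpmul2l// lee_fin.
  rewrite -!EFinM lee_fin mulrA ler_pdivrMr ?ltr_wpDl// mulrC.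
  by rewrite ler_wpM2l ?mulr_ge0 ?(ltW e0) ?(ltW t20)// lerDl.
apply: filterS2 (HF j) (Htop f q Lf) => x h1 h2 cx nE.
have qx : cell q x := cell_chain_up j cc cx.
apply: (@le_trans _ _ (`|T (locf N f q) x|%:E + (t + t)%:E)%E).
  rewrite -EFinD lee_fin; apply: (le_trans (h2 qx)).
  rewrite -addrA lerD2l lerD//; last by rewrite leNgt; exact/negP.
  apply: (@le_trans _ _ (t / (C1 + 1) * C1)); first by rewrite ler_wpM2r.
  by rewrite -mulrA ler_piMr ?(ltW t0)// mulrC ler_pdivrMr ?ltr_wpDl// mul1r lerDl.
rewrite (_ : t + t = m.+1%:R^-1); last by rewrite /t; field.
by rewrite leeD2r//; exact: h1.
Qed.

End limit.

Section sparse_family.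
Context (R : realType) (n : nat).
Local Notation mu := (lebesgue_rV R n).
Local Notation L2 := (Lfun mu 2%:E).
Local Notation "'rv'" := ('rV[R]_n).
Local Notation dil := (@dil R n).
Local Notation cell := (@cell R n).
Local Notation cube := (int * 'rV[int]_n)%type.
Implicit Types (x y : rv) (q c : cube).
Variables (N J : nat) (p : cube -> set rv).
Hypothesis dyadic_p : forall q, dyadic (p q).
Hypothesis dil_p : forall q, dil N q `<=` p q.
Hypothesis mu_p : forall q, mu (p q) = ((2 ^+ J * side R q.1) ^+ n)%:E.

(** [p] need not be injective, so each dyadic cube takes the core of one chosen preimage;
    disjointness survives. The parameter combines the factor 4 with the volume ratio 2^(Jn) between
    [p q] and q. *)
Lemma sparse_image (F : set cube) (A : cube -> set rv) :
  trivIset F A -> (forall q, measurable (A q)) -> (forall q, A q `<=` cell q) ->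
  (forall q, (mu (cell q) <= 4%:E * mu (A q))%E) ->
  sparse (4^-1 / 2 ^+ (J * n)) (p @` F).
Proof.
move=> tA mA Ac mcA; split; first by move=> _ [q _ <-].
have /choice[r rP] : forall P, exists q, (p @` F) P -> F q /\ p q = P.
  move=> P; have [[q Fq <-]|nP] := pselect ((p @` F) P); first by exists q.
  by exists (0, 0).
exists (A \o r); split.
  move=> P Q FP FQ /= APQ; have [Fr e] := rP _ FP; have [Fr' e'] := rP _ FQ.
  by rewrite -e -e'; congr p; exact: tA.
move=> P FP; have [Fr e] := rP _ FP; split; first exact: mA.
  by move=> x Ax; rewrite -e; exact: (dil_p (cell_sub_dil N (Ac _ _ Ax))).
have aoo : mu (A (r P)) \is a fin_num.
  rewrite ge0_fin_numE//; apply: le_lt_trans (@mu_cell_lty R n (r P)).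
  by apply: le_measure; rewrite ?inE//; exact: measurable_cell.
rewrite -[in X in (X <= _)%E]e mu_p /=; have := mcA (r P); rewrite mu_cell -(fineK aoo).
rewrite -!EFinM !lee_fin exprMn -exprM => h.
rewrite mulrA divfK ?expf_neq0//; lra.
Qed.

Hypothesis n_gt0 : (0 < n)%N.

(** Along one point the generations are distinct, hence so are the volumes of the cubes [p] since n
    > 0. No two terms of the list collapse in the sum over the image. *)
Lemma sum_le_esum (F : set cube) (f : rv -> R) x (s : seq int) : uniq s ->
  (forall k, k \in s -> F (k, gen k x)) ->
  ((\sum_(k <- s) osc (p (k, gen k x)) f)%:E <=
    \esum_(P in p @` F) (osc P f * \1_P x)%:E)%E.
Proof.
move=> us sF; pose g (k : int) := p (k, gen k x).
have gI : injective g.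
  move=> j k /(congr1 mu); rewrite /g !mu_p => -[] /eqP.
  rewrite eqrXn2 ?mulr_ge0 ?exprn_ge0 ?(ltW (side_gt0 _ _))// => /eqP /mulfI.
  rewrite expf_neq0// => /(_ isT) /ieexprIz/oppr_inj; apply.
    exact: ltr0n.
  by rewrite pnatr_eq1.
apply: ereal_sup_ubound => /=.
exists [set` map g s].
  split; first exact: finite_seq.
  by move=> P /= /mapP[k ks ->]; exists (k, gen k x) => //; exact: sF.
rewrite -fsbig_seq/= ?map_inj_uniq// big_map -sumEFin; apply: eq_bigr => k _.
by rewrite indicE mem_set ?mulr1//; exact: (dil_p (cell_sub_dil N (cell_gen _ _))).
Qed.

End sparse_family.

Theorem proposition9 (R : realType) (n : nat) (n_gt0 : (0 < n)%N) :
  exists eta : R, (0 < eta < 1) /\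
    forall (T : ('rV[R]_n -> R) -> 'rV[R]_n -> R)
           (K : 'rV[R]_n -> 'rV[R]_n -> R),
      calderon_zygmund T K -> T1_eq0_BMO T K ->
      exists C : R, forall f : 'rV[R]_n -> R,
        f \in Lfun (lebesgue_rV R n) 2%:E ->
        exists S : set (set 'rV[R]_n), sparse eta S /\
          {ae lebesgue_rV R n, forall x : 'rV[R]_n,
            (`|T f x|%:E <=
             C%:E * \esum_(Q in S) (osc Q f * \1_Q x)%:E)%E}.
Proof.
have [N [N2n N1]] : exists N, (2 * n < N)%N /\ (1 < N)%N by exists (2 * n).+1; lia.
have [J NJ] : exists J, (3 * (2 * N).+1 <= 2 ^ J)%N.
  by exists (3 * (2 * N).+1)%N; rewrite ltnW// ltn_expl.
have [c cE] : exists c : R, c = 2 ^+ (J * n) by exists (2 ^+ (J * n)).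
have c1 : 1 <= c by rewrite cE exprn_ege1// ler1n.
have c0 : 0 < c := lt_le_trans ltr01 c1.
(* N, J and hence c depend on n only, so the sparse parameter is fixed before T and f. *)
exists (4^-1 / c); split.
  rewrite divr_gt0 ?invr_gt0//= ltr_pdivrMr// mul1r.
  by apply: lt_le_trans c1; rewrite invf_lt1// ltr1n.
move=> T K [HT /CZ_sup_kernel[eps [CK HK]] HTK] HT1.
have [|C [C0 HC]] := local_step n_gt0 HT HTK HK N2n N1 HT1 (delta := delta R n).
  rewrite delta_gt0//= /delta.
  by have := theta_le R n; lra.
exists (C * (2 * c)) => f Lf.
have [E [mE muE u_off u_step]] := HC f Lf.
have /choice[p Hp] : forall q, exists P : set 'rV[R]_n, [/\ dyadic P, dil N q `<=` P,
    measurable P & lebesgue_rV R n P = ((2 ^+ J * side R q.1) ^+ n)%:E].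
  by move=> q; exact: dyadic_cover.
have dyp q : dyadic (p q) by case: (Hp q).
have dilp q : dil N q `<=` p q by case: (Hp q).
have mp q : measurable (p q) by case: (Hp q).
have mup q : lebesgue_rV R n (p q) = ((2 ^+ J * side R q.1) ^+ n)%:E by case: (Hp q).
exists (p @` family E); split.
  rewrite cE; apply: (sparse_image dyp dilp mup (A := core E)).
  - exact: family_core_triv.
  - exact: measurable_core.
  - by move=> q x [].
  - exact: mu_core.
set S := p @` _; pose F x := ((C * (2 * c))%:E * \esum_(Q in S) (osc Q f * \1_Q x)%:E)%E.
(* The 2 is the cost of changing the mean, and c bounds the volume of [p q] against that of the
   enlargement. *)
have oscp q : oscN N f q <= 2 * c * osc (p q) f.
  apply: osc_dyadic => //; first exact: measurable_dil.
  - by case/andP: (dil_mu_bounds R N q).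
  - by rewrite mup ltry.
  rewrite mup mu_dil -EFinM lee_fin exprMn -exprM -cE ler_wpM2l ?(ltW c0)//.
  by rewrite lerXn2r ?nnegrE ?mulr_ge0 ?(ltW (side_gt0 _ _))// ler_peMl ?(ltW (side_gt0 _ _))// ler1n.
have loc q : chain q -> {ae lebesgue_rV R n, forall x, cell q x ->
    (`|T (locf N f q) x|%:E <= F x)%E}.
  move=> cq; apply: filterS (reach_bound n_gt0 mE muE u_off u_step) => x Hx qx.
  have [s [us sF le]] := Hx q qx.
  have le2 : \sum_(k <- s) oscN N f (k, gen k x) <=
      2 * c * \sum_(k <- s) osc (p (k, gen k x)) f.
    by rewrite mulr_sumr; apply: ler_sum => k _; exact: oscp.
  have {le2}le2 := le_trans le (ler_wpM2l C0 le2).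
  have : ((\sum_(k <- s) osc (p (k, gen k x)) f)%:E <=
      \esum_(Q in S) (osc Q f * \1_Q x)%:E)%E.
    have H : forall k, k \in s -> family E (k, gen k x) by move=> k ks; exists q; split=> //; exact: sF.
    exact: (sum_le_esum dilp mup n_gt0 f us H).
  rewrite /F; move: le2; move: (\sum_(k <- s) osc _ f) (\esum_(Q in S) _)%E => u e.
  move=> le2 ue; rewrite mulrA in le2; apply: (@le_trans _ _ ((C * (2 * c))%:E * u%:E)%E).
    by rewrite -EFinM lee_fin.
  by apply: lee_wpmul2l ue; rewrite lee_fin mulr_ge0 ?mulr_ge0 ?(ltW c0).
(* The family contains the trees of all chain cells, so the same [F] bounds the local pieces at
   every [chain_up q j], as the limit requires. *)
have all : {ae lebesgue_rV R n, forall x q, chain q -> cell q x -> (`|T f x|%:E <= F x)%E}.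
  apply: ae_forall_count => q.
  have [cq|ncq] := pselect (chain q); last exact: aeW.
  apply: filterS (local_limit n_gt0 HT HTK HK N2n N1 HT1 Lf cq _) => [x h _|j]; first exact: h.
  apply: filterS (loc _ (chain_up_chain j cq)) => x h qx; apply: h.
  exact: cell_chain_up qx.
apply: filterS all => x h; have [q [cq qx]] := chain_exists x.
exact: h cq qx.
Qed.
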